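(* For $\beta>3/2$, as $x\to0$ ($x$ real, $x\ne0$), the two-point correlation function of $\mathsf{Sine}_\beta$ satisfies $$\rho_\beta^{(2)}(0,x)=C_\beta^{(2)}|x|^\beta\left[1-\frac{\beta^2}{40(2\beta-1)}x^2+\frac{\beta^4(7\beta-10)}{4480(2\beta-1)(2\beta-3)(5\beta-2)}x^4+o(x^4)\right].$$
   Context: $\mathsf{Sine}_\beta$ is the limiting point process on $\mathbb R$, as $N\to\infty$, of the points $N\theta_j$ ($\theta_j\in(-\pi,\pi]$) of the circular $\beta$-ensemble with density proportional to $\prod_{j<k}|e^{i\theta_j}-e^{i\theta_k}|^\beta$; thus it has intensity $1/(2\pi)$. $\rho_\beta^{(m)}$ denotes its $m$-point correlation function. The following representation is known: $$\rho_\beta^{(m)}(x_1,\dots,x_m)=C_\beta^{(m)}\prod_{i<j}|x_i-x_j|^\beta\;\mathbb E\prod_{j=2}^m|\xi^{\beta,m\beta/2}(x_j-x_1)|^\beta,$$ where, with $h=\beta/2$, $$C_\beta^{(m)}=\frac{h^{hm(m-1)}\Gamma(1+h)^m}{(2\pi)^m}\,\frac{\prod_{j=0}^{m-1}\Gamma(1+jh)}{\prod_{j=m}^{2m-1}\Gamma(1+jh)},$$ and where $\xi^{\beta,\alpha/2}$ ($\alpha>0$) is the random entire function, with $\xi^{\beta,\alpha/2}(0)=1$, that is the limit in law (locally uniformly on $\mathbb C$) as $N\to\infty$ of $f_N(z)=e^{-iz/2}\prod_{j=1}^N\frac{e^{iz/N}-e^{i\theta_j}}{1-e^{i\theta_j}}$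 under the circular Jacobi law with density proportional to $\prod_{j<k}|e^{i\theta_j}-e^{i\theta_k}|^\beta\prod_{j=1}^N|1-e^{i\theta_j}|^\alpha$ with respect to $\prod_j d\theta_j/(2\pi)$. *)

(* Defs.v *)
From HB Require Import structures.
From mathcomp Require Import all_boot all_order all_algebra.
From mathcomp Require Import all_classical all_reals all_analysis.
From mathcomp Require Import measurable_realfun complex.

Set Implicit Arguments.
Unset Strict Implicit.
Unset Printing Implicit Defensive.

Import Order.TTheory GRing.Theory Num.Theory.
Import numFieldNormedType.Exports.

Local Open Scope classical_set_scope.
Local Open Scope ring_scope.

(* The order on R[i] makes `|z| an element of R[i]; cmod is real-valued. *)
Definition cmod (R : realType) (z : R[i]) : R := ComplexField.Normc.normc z.

Definition cexp (R : realType) (z : R[i]) : R[i] :=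
  Complex (expR (complex.Re z) * cos (complex.Im z))
          (expR (complex.Re z) * sin (complex.Im z)).

(* e^{it} for real t *)
Definition cis (R : realType) (t : R) : R[i] := cexp (Complex 0 t).

Definition entire (R : realType) (f : R[i] -> R[i]) : Prop :=
  forall z : R[i], derivable (f : R[i]^o -> R[i]^o) z 1.

Definition Gamma (R : realType) (x : R) : R :=
  \int[@lebesgue_measure R]_(t in `]0, +oo[) (t `^ (x - 1) * expR (- t)).

(* C_beta^{(m)}, with h = beta / 2 *)
Definition corr_const (R : realType) (beta : R) (m : nat) : R :=
  let h := beta / 2 in
  h `^ (h * (m * m.-1)%:R) * Gamma (1 + h) ^+ m / (2 * pi) ^+ m *
  ((\prod_(0 <= j < m) Gamma (1 + j%:R * h)) /
   (\prod_(m <= j < m.*2) Gamma (1 + j%:R * h))).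

Lemma minus_pi_lt_pi (R : realType) : - pi < pi :> R.
Proof. by rewrite gtrN // pi_gt0. Qed.

Definition torus_cons (R : realType) (n : nat)
    (x : measurableTypeR R * n.-tuple R) : n.+1.-tuple R :=
  [tuple of (x.1 : R) :: x.2].

Lemma measurable_torus_cons (R : realType) (n : nat) :
  measurable_fun setT (@torus_cons R n).
Proof.
apply: (@measurable_cons _ _ _ R (fun x : measurableTypeR R * n.-tuple R => x.1)
  n snd) => //.
exact: (@measurable_fst _ _ (measurableTypeR R) (n.-tuple R)).
Qed.

HB.instance Definition _ (R : realType) (n : nat) :=
  isMeasurableFun.Build _ _ _ _ (@torus_cons R n) (@measurable_torus_cons R n).

(* The measure prod_j dtheta_j / (2 pi) on (-pi, pi]^n: the n-fold product of
   the uniform law (uniform_prob is on the closed interval, which differs by a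
   null set). *)
Fixpoint torus_prob (R : realType) (n : nat) : probability (n.-tuple R) R :=
  match n return probability (n.-tuple R) R with
  | 0 => \d_ ([tuple] : 0.-tuple R)
  | m.+1 => distribution
              (uniform_prob (minus_pi_lt_pi R) \x torus_prob R m)%E
              (@torus_cons R m)
  end.

(* Expectation of F under the law on (-pi, pi]^n with density proportional
   to w. *)
Definition mean_density (R : realType) (n : nat) (w F : n.-tuple R -> R) : R :=
  (\int[torus_prob R n]_t (w t * F t)) / \int[torus_prob R n]_t w t.

Definition circular_weight (R : realType) (beta : R) (n : nat)
    (theta : n.-tuple R) : R :=
  \prod_(j < n) \prod_(k < n | (j < k)%N)
     cmod (cis (tnth theta j) - cis (tnth theta k)) `^ beta.

Definition circular_jacobi_weight (R : realType) (beta alpha : R) (n : nat)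
    (theta : n.-tuple R) : R :=
  circular_weight beta theta *
  \prod_(j < n) cmod (1 - cis (tnth theta j)) `^ alpha.

(* A point process on the line without multiple points: a random locally
   finite set whose counts on Borel sets are measurable. *)
Definition is_point_process (R : realType) (d : measure_display)
    (T : measurableType d) (X : T -> set R) : Prop :=
  (forall (w : T) (a b : R), finite_set (X w `&` `[a, b])) /\
  (forall B : set R, measurable B ->
     measurable_fun setT (fun w => counting (X w `&` B) : \bar R)).

(* X is the limit in law of the point processes {N theta_j : j <= N} as
   N -> oo: every linear statistic with a continuous compactly supported test
   function converges in law, which is convergence in law for the vague
   topology. *)
Definition is_sine_beta (R : realType) (beta : R) (d : measure_display)
    (T : measurableType d) (P : probability T R) (X : T -> set R) : Prop :=
  is_point_process X /\
  forall phi g : R -> R,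
    continuous phi -> (exists M : R, forall x, M < `|x| -> phi x = 0) ->
    continuous g -> (exists M : R, forall y, `|g y| <= M) ->
    mean_density (@circular_weight R beta N)
      (fun theta => g (\sum_(j < N) phi (N%:R * tnth theta j)))
      @[N --> \oo] --> \int[P]_w g (\sum_(x \in X w) phi x).

(* rho is a density of the second factorial moment measure of X; this determines
   rho only almost everywhere. *)
Definition is_two_point_correlation (R : realType) (d : measure_display)
    (T : measurableType d) (P : probability T R) (X : T -> set R)
    (rho : R -> R -> R) : Prop :=
  [/\ measurable_fun setT (fun p : R * R => rho p.1 p.2),
      forall x y, 0 <= rho x y &
      forall F : R * R -> \bar R,
        measurable_fun setT F -> (forall p, 0 <= F p)%E ->
        ((\int[P]_w \esum_(p in [set q : R * R |
                                 [/\ X w q.1, X w q.2 & q.1 != q.2]]) F p)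
         = \int[@lebesgue_measure R \x @lebesgue_measure R]_p
             (F p * (rho p.1 p.2)%:E))%E].

(* f_N(z) *)
Definition char_ratio (R : realType) (n : nat) (theta : n.-tuple R)
    (z : R[i]) : R[i] :=
  cexp (- (Complex 0 1 * z / 2%:R)) *
  \prod_(j < n) ((cexp (Complex 0 1 * z / n%:R) - cis (tnth theta j)) /
                 (1 - cis (tnth theta j))).

(* xi is a random entire function with the law of xi^{beta, alpha/2}: the limit
   in law of f_N under the circular Jacobi law, on the space of entire functions
   with the topology of locally uniform convergence. *)
Definition is_xi (R : realType) (beta alpha : R) (d : measure_display)
    (T : measurableType d) (P : probability T R)
    (xi : T -> R[i] -> R[i]) : Prop :=
  [/\ forall w, entire (xi w),
      forall w, xi w 0 = 1,
      forall z, measurable_fun setT (fun w => complex.Re (xi w z)) /\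
                measurable_fun setT (fun w => complex.Im (xi w z)) &
      forall Phi : {family compact, R[i]^o -> R[i]^o} -> R,
        {within [set f : {family compact, R[i]^o -> R[i]^o} | entire f],
           continuous Phi} ->
        (exists M : R, forall f, `|Phi f| <= M) ->
        mean_density (@circular_jacobi_weight R beta alpha N)
          (fun theta => Phi (char_ratio theta))
          @[N --> \oo] --> \int[P]_w Phi (xi w)].

(* Main.v *)
(* The exponent of the representation is alpha = 2 beta, so the expectation is
   the limit of a mean under the circular Jacobi weight W. Rotating by half of
   u = x / N turns the integrand into one that is even in u, namely W times
   prod_j |1 - s / sin(theta_j / 2)^2|^beta with s = sin(u / 4)^2. Expanding in s
   brings in the means of A = sum_j 1 / sin(theta_j / 2)^2, of A^2 and of
   P = sum_j 1 / sin(theta_j / 2)^4. Integrating by parts along fields built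
   from cot(theta_j / 2) gives linear relations (loop equations) that determine
   the mean of A, determine the second-order coefficient up to lower order in N,
   and bound the moment of order 1 + r of A by a constant times N^(2 + 2 r) when
   r < beta - 1/2. As beta > 3/2 one can take r > 1, so the error is
   O(|x|^(2 + 2 r)) = o(x^4), uniformly in N. Where some angle is too close to 0
   for the expansion, one rotates back. The square of the ratio also has bounded
   mean, by a rotation, so the limit in law gives the limit of the mean. *)

Require Import Defs.
From HB Require Import structures.
From mathcomp Require Import all_boot all_order all_algebra.
From mathcomp Require Import all_classical all_reals all_analysis.
From mathcomp Require Import measurable_realfun complex ring lra.

Set Implicit Arguments.
Unset Strict Implicit.
Unset Printing Implicit Defensive.

Import Order.TTheory GRing.Theory Num.Theory.
Import numFieldNormedType.Exports.

Local Open Scope classical_set_scope.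
Local Open Scope ring_scope.

(** With alpha = 2 beta the points 0 and u carry the same exponent in the numerator, which is why
    rotating by u / 2 makes it even. Near theta_j = 0 the weight is of order |theta_j|^(2 beta) and
    A^(1 + r) of order |theta_j|^(-2 - 2 r): r < beta - 1/2 is exactly the range of integrability.
    The obstacle: integration by parts is justified here only for fields of order sqrt A, the size
    of a cotangent, for which weight times field vanishes to second order at theta_j = 0. The
    second-order equations need cubic fields, so these are cut off by a function of A at scale 1 /
    s. The expansion parameter s thus doubles as cutoff scale; as A is of order N^2 and s about x^2
    / (16 N^2), the derivatives of the cutoff cost only N^4 |x|^(2 r - 2). With B = sum_j
    cot(theta_j / 2) and D = sum_j cot(theta_j / 2) / sin(theta_j / 2)^2, the means of A B^2, A^2, B
    D and P are the second-order unknowns. Four fields give four equations: two rotate all angles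
    together, so that the Vandermonde factor drops out, and two move each angle by its own
    amount. *)

Local Notation tuple_fun F := (fun x : _.-tuple _ => F (tnth x)).
Local Notation mean F := (\int[torus_prob _ _]_x F (tnth x)).

(** * Rotations of the torus *)

Section circle_translation.
Context {R : realType}.
Local Notation mu := (@lebesgue_measure R).
Implicit Types (v : R) (g : R -> \bar R).

Definition translate v (x : measurableTypeR R) : measurableTypeR R := x + v.

Lemma measurable_translate v : measurable_fun setT (translate v).
Proof. exact: measurable_funD. Qed.

HB.instance Definition _ v :=
  isMeasurableFun.Build _ _ _ _ (translate v) (measurable_translate v).

Lemma lebesgue_measure_translate v (A : set R) : measurable A ->
  pushforward mu (translate v) A = mu A.
Proof.
move=> mA; apply/esym/lebesgue_measure_unique => // _ [[a b]] _ <-.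
rewrite /= /pushforward.
have -> : translate v @^-1` `]a, b]%classic = `]a - v, b - v]%classic.
  by apply/seteqP; split=> x /=; rewrite !in_itv/= ltrBlDr lerBrDr.
rewrite !lebesgue_measure_itv/= !lte_fin ltrD2r.
by case: ifPn => // _; rewrite -!EFinB; congr (_%:E); ring.
Qed.

Lemma ge0_integral_translate v g (a b : R) :
  measurable_fun setT g -> (forall x, 0 <= g x)%E ->
  (\int[mu]_(x in `[a, b]) g (x + v)%R = \int[mu]_(x in `[(a + v)%R, (b + v)%R]) g x)%E.
Proof.
move=> mg g0.
rewrite (_ : `[a, b]%classic = translate v @^-1` `[a + v, b + v]%classic); last first.
  by apply/seteqP; split=> x /=; rewrite !in_itv/= !lerD2r.
rewrite -(@ge0_integral_pushforward _ _ _ _ _ (translate v)) //=; last exact: measurable_funTS.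
apply: eq_measure_integral => //= A mA AS; exact: lebesgue_measure_translate.
Qed.

Lemma ge0_integral_itvcc_split g (a b c : R) : a <= b -> b <= c ->
  measurable_fun setT g -> (forall x, 0 <= g x)%E ->
  (\int[mu]_(x in `[a, c]) g x =
   \int[mu]_(x in `[a, b]) g x + \int[mu]_(x in `[b, c]) g x)%E.
Proof.
move=> ab bc mg g0.
have -> : `[a, c]%classic = `[a, b[%classic `|` `[b, c]%classic.
  by rewrite -itv_bndbnd_setU // bnd_simp.
rewrite ge0_integral_setU //=.
- by rewrite integral_itv_bndo_bndc //; exact: measurable_funTS.
- exact: measurable_funTS.
- apply/disj_setPRL => x /=; rewrite !in_itv/= => /andP[bx _].
  by rewrite ltNge bx andbF.
Qed.

(** A period shifted by [0 <= w <= 2 * pi] is cut at [pi], and the piece beyond [pi] is carried back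
    by one period. For negative [v] the shifted function is itself shifted by [- v]. *)
Lemma ge0_integral_circle_shift v g : `|v| <= 2 * pi ->
  measurable_fun setT g -> (forall x, 0 <= g x)%E ->
  (forall x, g (x + 2 * pi) = g x) ->
  (\int[mu]_(x in `[(- pi)%R, pi]) g (x + v)%R = \int[mu]_(x in `[(- pi)%R, pi]) g x)%E.
Proof.
have main w h : 0 <= w <= 2 * pi -> measurable_fun setT h ->
    (forall x, 0 <= h x)%E -> (forall x, h (x + 2 * pi) = h x) ->
    (\int[mu]_(x in `[(- pi)%R, pi]) h (x + w)%R = \int[mu]_(x in `[(- pi)%R, pi]) h x)%E.
  move=> /andP[w0 w1] mh h0 hp.
  rewrite ge0_integral_translate //.
  rewrite (@ge0_integral_itvcc_split h (- pi + w) pi (pi + w)) //; [|lra|lra].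
  rewrite (@ge0_integral_itvcc_split h (- pi) (- pi + w) pi) //; [|lra|lra].
  rewrite addeC; congr (_ + _)%E.
  rewrite -[RHS](_ : \int[mu]_(x in `[(- pi)%R, (- pi + w)%R]) h (x + 2 * pi)%R = _)%E.
    rewrite ge0_integral_translate //.
    have -> : - pi + 2 * pi = pi :> R by ring.
    by have -> : - pi + w + 2 * pi = pi + w :> R by ring.
  by apply: eq_integral => x _.
have [v0|v0] := leP 0 v => vpi mg g0 gp.
  by apply: main => //; rewrite v0 (le_trans (ler_norm _)).
rewrite -[LHS](@main (- v) (fun x => g (x + v))) //.
- by apply: eq_integral => x _; rewrite subrK.
- by rewrite oppr_ge0 (ltW v0)/= (le_trans _ vpi)// ltr0_norm.
- by apply: measurableT_comp => //; exact: measurable_translate.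
- by move=> x; rewrite addrAC gp.
Qed.

End circle_translation.

(** * Translations of the torus, one angle at a time *)

Section torus_translation.
Context {R : realType}.
Local Notation mu := (@lebesgue_measure R).

Definition upd n (x : 'I_n -> R) (j : 'I_n) (t : R) : 'I_n -> R :=
  fun i => if i == j then t else x i.

Definition fcons n (t : R) (x : 'I_n -> R) : 'I_n.+1 -> R :=
  fun i => oapp x t (unlift ord0 i).

Lemma tnth_torus_cons n (p : measurableTypeR R * n.-tuple R) :
  tnth (torus_cons p) = fcons p.1 (tnth p.2).
Proof.
apply/funext => i; rewrite /fcons /torus_cons /=.
by case: unliftP => [j ->|->] /=; rewrite ?tnthS ?tnth0.
Qed.

Definition shift_periodic n T (F : ('I_n -> R) -> T) :=
  forall x j, F (upd x j (x j + 2 * pi)) = F x.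

Lemma ge0_integral_torusS n (F : n.+1.-tuple R -> \bar R) :
  measurable_fun setT F -> (forall x, 0 <= F x)%E ->
  (\int[torus_prob R n.+1]_x F x =
   \int[uniform_prob (minus_pi_lt_pi R)]_t \int[torus_prob R n]_x
     F (torus_cons (t, x)))%E.
Proof.
move=> mF F0.
rewrite /= ge0_integral_distribution //.
rewrite fubini_tonelli1 //=; last first.
  by apply: measurableT_comp => //; exact: measurable_torus_cons.
Qed.

(** Tonelli peels off one angle at a time; nonnegative extended real integrands keep this free of
    integrability conditions. The shifts may differ between angles: rotations take them equal,
    differentiation moves a single angle. *)
Lemma integral_torus_shift n (v : 'I_n -> R) (F : ('I_n -> R) -> \bar R) :
  (forall i, `|v i| <= 2 * pi) ->
  measurable_fun setT (fun x : n.-tuple R => F (tnth x)) ->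
  (forall x, 0 <= F x)%E -> shift_periodic F ->
  (\int[torus_prob R n]_x F (fun i => tnth x i + v i)%R =
   \int[torus_prob R n]_x F (tnth x))%E.
Proof.
elim: n v F => [|n IH] v F vpi mF F0 Fp.
  by apply: eq_integral => x _; congr (F _); apply/funext => -[].
have mS (w : 'I_n.+1 -> R) :
    measurable_fun setT (fun x : n.+1.-tuple R => F (fun i => tnth x i + w i)).
  rewrite (_ : (fun x => _) = (fun x : n.+1.-tuple R => F (tnth x)) \o
     (fun x => [tuple tnth x i + w i | i < n.+1])); last first.
    by apply/funext => x /=; congr (F _); apply/funext => i; rewrite tnth_mktuple.
  apply: measurableT_comp => //; apply/measurable_fun_tnthP => i.
  rewrite (_ : _ \o _ = fun x => tnth x i + w i).
    by apply: measurable_funD => //; exact: measurable_tnth.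
  by apply/funext => x /=; rewrite tnth_mktuple.
have mcons (G : n.+1.-tuple R -> \bar R) t : measurable_fun setT G ->
    measurable_fun setT (fun x : n.-tuple R => G (torus_cons (t, x))).
  move=> mG; apply: measurableT_comp => //.
  apply: measurableT_comp; first exact: measurable_torus_cons.
  exact: (@measurable_pair1 _ _ (measurableTypeR R) (n.-tuple R)).
rewrite (ge0_integral_torusS (mS v) (fun=> F0 _)).
rewrite (ge0_integral_torusS mF (fun=> F0 _)).
have -> : (\int[uniform_prob (minus_pi_lt_pi R)]_t \int[torus_prob R n]_x
     F (fun i => tnth (torus_cons (t, x)) i + v i)%R =
    \int[uniform_prob (minus_pi_lt_pi R)]_t \int[torus_prob R n]_x
     F (fcons (t + v ord0)%R (tnth x)))%E.
  apply: eq_integral => t _.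
  rewrite -(IH (v \o lift ord0) (fun y => F (fcons (t + v ord0) y))) //.
  - apply: eq_integral => x _; congr (F _); apply/funext => i.
    rewrite tnth_torus_cons /fcons /=.
    by case: unliftP => [j ->|->].
  - by move=> i; exact: vpi.
  - rewrite (_ : (fun _ => _) =
       fun x => F (tnth (torus_cons (t + v ord0, x)))); first exact: (mcons (fun x => F (tnth x))).
    by apply/funext => x; rewrite tnth_torus_cons.
  - move=> x j; rewrite -(Fp (fcons (t + v ord0) x) (lift ord0 j)).
    congr (F _); apply/funext => i; rewrite /fcons /upd.
    case: unliftP => [k ->|->] /=.
      by rewrite (inj_eq lift_inj) liftK.
    by [].
have mG : measurable_fun setT
    (fun t => \int[torus_prob R n]_x F (fcons t (tnth x)))%E.
  rewrite (_ : (fun _ => _) = fubini_F (torus_prob R n)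
     (fun p : measurableTypeR R * n.-tuple R => F (tnth (torus_cons p)))).
    apply: measurable_fun_fubini_tonelli_F => //.
    by apply: (measurableT_comp mF); exact: measurable_torus_cons.
  apply/funext => t; apply: eq_integral => x _; rewrite tnth_torus_cons //.
have G0 t : (0 <= \int[torus_prob R n]_x F (fcons t (tnth x)))%E.
  exact: integral_ge0.
transitivity (\int[uniform_prob (minus_pi_lt_pi R)]_t
   \int[torus_prob R n]_x F (fcons t (tnth x)))%E; last first.
  by apply: eq_integral => t _; apply: eq_integral => x _; rewrite tnth_torus_cons.
have mGv := measurableT_comp mG (measurable_translate (v ord0)).
rewrite (integral_uniform _ mGv (fun=> G0 _)) (integral_uniform _ mG G0).
congr (_ * _)%E.
apply: (@ge0_integral_circle_shift R (v ord0)
  (fun t => \int[torus_prob R n]_x F (fcons t (tnth x)))%E) => //.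
move=> t; apply: eq_integral => x _.
  rewrite -(Fp (fcons t (tnth x)) ord0); congr (F _).
apply/funext => i; rewrite /fcons /upd.
by case: unliftP => [k ->|->] /=; rewrite ?eqxx ?unlift_none // eq_sym.
Qed.

End torus_translation.

(** * Bounded measurable functions under a probability *)

Section bounded_measurable.
Context d (T : measurableType d) {R : realType} (P : probability T R).
Implicit Types f g : T -> R.

(** Over a probability this implies integrability and, unlike integrability, passes to products. The
    weights below cancel the poles of their cofactors, so that most integrands are of this kind. *)
Definition bounded_mfun f := measurable_fun setT f /\ exists K, forall x, `|f x| <= K.

Lemma bounded_mfun_cst (c : R) : bounded_mfun (fun=> c).
Proof. by split; [exact: measurable_cst|exists `|c|]. Qed.

Lemma bounded_mfunD f g : bounded_mfun f -> bounded_mfun g ->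
  bounded_mfun (fun x => f x + g x).
Proof.
move=> [mf [K fK]] [mg [L gL]]; split; first exact: measurable_funD.
by exists (K + L) => x; rewrite (le_trans (ler_normD _ _))// lerD.
Qed.

Lemma bounded_mfunM f g : bounded_mfun f -> bounded_mfun g ->
  bounded_mfun (fun x => f x * g x).
Proof.
move=> [mf [K fK]] [mg [L gL]]; split; first exact: measurable_funM.
by exists (K * L) => x; rewrite normrM ler_pM.
Qed.

Lemma bounded_mfunZ (c : R) f : bounded_mfun f -> bounded_mfun (fun x => c * f x).
Proof. by apply: bounded_mfunM; exact: bounded_mfun_cst. Qed.

Lemma bounded_mfun_sum I (r : seq I) (p : pred I) (F : I -> T -> R) :
  (forall i, bounded_mfun (F i)) ->
  bounded_mfun (fun x => \sum_(i <- r | p i) F i x).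
Proof.
move=> bF; elim: r => [|i r IH].
  under eq_fun do rewrite big_nil; exact: bounded_mfun_cst.
under eq_fun do rewrite big_cons; case: (p i) => //.
exact: bounded_mfunD.
Qed.

Lemma bounded_mfun_integrable f : bounded_mfun f ->
  P.-integrable setT (EFin \o f).
Proof.
move=> [mf [K fK]]; apply: measurable_bounded_integrable => //=.
  by rewrite probability_setT ltry.
by exists K; split; rewrite ?num_real// => M KM x _ /=; rewrite (le_trans (fK x))// ltW.
Qed.

Lemma bounded_RintegralZ (c : R) f : bounded_mfun f ->
  \int[P]_x (c * f x) = c * \int[P]_x f x.
Proof. by move=> bf; rewrite RintegralZl//; exact: bounded_mfun_integrable. Qed.

Lemma bounded_RintegralD f g : bounded_mfun f -> bounded_mfun g ->
  \int[P]_x (f x + g x) = \int[P]_x f x + \int[P]_x g x.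
Proof. by move=> bf bg; rewrite RintegralD//; exact: bounded_mfun_integrable. Qed.

Lemma bounded_Rintegral_sum I (r : seq I) (p : pred I) (F : I -> T -> R) :
  (forall i, bounded_mfun (F i)) ->
  \int[P]_x (\sum_(i <- r | p i) F i x) = \sum_(i <- r | p i) \int[P]_x F i x.
Proof.
move=> bF; elim: r => [|i r IH].
  rewrite big_nil; under eq_Rintegral do rewrite big_nil.
  by rewrite Rintegral_cst// mul0r.
rewrite big_cons -IH; under eq_Rintegral do rewrite big_cons.
case: (p i) => //; rewrite bounded_RintegralD//.
exact: bounded_mfun_sum.
Qed.

Lemma bounded_le_Rintegral f g : bounded_mfun f -> bounded_mfun g ->
  (forall x, f x <= g x) -> \int[P]_x f x <= \int[P]_x g x.
Proof. by move=> bf bg fg; apply: le_Rintegral => //; exact: bounded_mfun_integrable. Qed.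

Lemma bounded_convergence (f_ : nat -> T -> R) f (K : R) :
  (forall n, measurable_fun setT (f_ n)) ->
  (forall n x, `|f_ n x| <= K) ->
  (forall x, f_ n x @[n --> \oo] --> f x) ->
  \int[P]_x f_ n x @[n --> \oo] --> \int[P]_x f x.
Proof.
move=> mf fK fcvg.
have bf n : bounded_mfun (f_ n) by split=> //; exists K.
have bK : P.-integrable setT (cst K%:E).
  exact: (bounded_mfun_integrable (bounded_mfun_cst K)).
have [] := @dominated_convergence _ _ _ P setT measurableT
  (fun n => EFin \o f_ n) (EFin \o f) (cst K%:E).
- by move=> n; exact/measurable_EFinP.
- apply/measurable_EFinP; exact: (measurable_fun_cvg mf (fun x _ => fcvg x)).
- apply: aeW => x _; apply: cvg_EFin; last exact: fcvg.
  by apply: nearW => n.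
- exact: bK.
- by apply: aeW => x n _; rewrite /= lee_fin.
move=> intf _ h; apply: fine_cvg; rewrite /Rintegral fineK //.
exact: integrable_fin_num.
Qed.

Lemma fine_bounded_integral f : bounded_mfun f ->
  ((\int[P]_x f x)%:E = \int[P]_x (f x)%:E)%E.
Proof.
move=> bf; rewrite /Rintegral fineK//.
by apply: integrable_fin_num => //; exact: bounded_mfun_integrable.
Qed.

End bounded_measurable.

(** * Derivatives have mean zero on the torus *)

Section torus_calculus.
Context {R : realType} (n : nat).
Implicit Types (F : ('I_n -> R) -> R).

Lemma measurable_torus_shift (w : 'I_n -> R) F :
  measurable_fun setT (tuple_fun F) ->
  measurable_fun setT (fun x : n.-tuple R => F (fun i => tnth x i + w i)).
Proof.
move=> mF; rewrite (_ : (fun x => _) = (tuple_fun F) \o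
   (fun x => [tuple tnth x i + w i | i < n])); last first.
  by apply/funext => x /=; congr (F _); apply/funext => i; rewrite tnth_mktuple.
apply: (measurableT_comp mF); apply/measurable_fun_tnthP => i.
rewrite (_ : _ \o _ = fun x => tnth x i + w i).
  by apply: measurable_funD => //; exact: measurable_tnth.
by apply/funext => x /=; rewrite tnth_mktuple.
Qed.

Lemma Rintegral_torus_shift (v : 'I_n -> R) F :
  (forall i, `|v i| <= 2 * pi) ->
  bounded_mfun (tuple_fun F) -> shift_periodic F ->
  \int[torus_prob R n]_x F (fun i => tnth x i + v i) = mean F.
Proof.
move=> vpi [mF [K FK]] Fp.
have FK' x : `|F x| <= K by have := FK (mktuple x); rewrite (_ : tnth _ = x)//;
  apply/funext => i; rewrite tnth_mktuple.
have bs (w : 'I_n -> R) : bounded_mfun (fun x : n.-tuple R => F (fun i => tnth x i + w i)).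
  by split; [exact: measurable_torus_shift|exists K].
have bF : bounded_mfun (tuple_fun F) by split=> //; exists K.
have bK : bounded_mfun (fun _ : n.-tuple R => K) by exact: bounded_mfun_cst.
(* Adding the constant bound makes the integrand nonnegative, as [integral_torus_shift] requires. *)
apply: (addIr (\int[torus_prob R n]_x K)).
rewrite -!bounded_RintegralD//.
congr fine; apply: (@integral_torus_shift R n v (fun x => (F x + K)%:E)) => //.
- by apply/measurable_EFinP; apply: measurable_funD.
- by move=> x; rewrite lee_fin; have := FK' x; rewrite ler_norml => /andP[]; lra.
- by move=> x j; rewrite Fp.
Qed.

Lemma upd_id (x : 'I_n -> R) j : upd x j (x j) = x.
Proof. by apply/funext => i; rewrite /upd; case: eqP => [->|]. Qed.

Lemma derive_quotient_cvg (f : R -> R) (t l : R) : is_derive t 1 f l ->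
  k.+1%:R * (f (t + k.+1%:R^-1) - f t) @[k --> \oo] --> l.
Proof.
move=> [df <-].
move: df; rewrite /derivable /= => df.
have : (fun h => h^-1 *: ((f \o shift t) (h *: 1) - f t)) @ 0^' --> 'D_1 f t by [].
move=> /cvgr_dnbhsP /(_ (fun k => k.+1%:R^-1)) h.
rewrite (_ : (fun k => _) = fun k =>
    (k.+1%:R^-1)^-1 *: ((f \o shift t) (k.+1%:R^-1 *: 1) - f t)); last first.
  by apply/funext => k; rewrite invrK /= /shift /= [_ + t]addrC scaler1.
apply: h; split => [k|]; first by rewrite invr_eq0 pnatr_eq0.
exact: cvg_harmonic.
Qed.

Lemma derive_quotient_le (f df : R -> R) (K t : R) (k : nat) :
  (forall u : R, is_derive u 1 f (df u)) -> (forall u, `|df u| <= K) ->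
  `|k.+1%:R * (f (t + k.+1%:R^-1) - f t)| <= K.
Proof.
move=> hf hK.
have k0 : 0 < k.+1%:R^-1 :> R by rewrite invr_gt0.
have [||c _ ->] := @MVT R f df t (t + k.+1%:R^-1).
- by rewrite ltrDl.
- by apply: derivable_within_continuous => u uI; have [] := hf u.
by rewrite (addrC t) addrK mulrCA mulfV ?pnatr_eq0// mulr1.
Qed.

(** Difference quotients with step [k.+1%:R^-1] have mean zero by translation invariance, are
    bounded by [K] by the mean value theorem, and converge pointwise to [D]; bounded convergence
    concludes. *)
Lemma torus_integral_derivative (j : 'I_n) F (D : ('I_n -> R) -> R) :
  bounded_mfun (tuple_fun F) -> bounded_mfun (tuple_fun D) -> shift_periodic F ->
  (forall (x : 'I_n -> R) (t : R), is_derive t 1 (fun u => F (upd x j u)) (D (upd x j t))) ->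
  mean D = 0.
Proof.
move=> bF [mD [K DK]] Fp FD.
have DK' x : `|D x| <= K by have := DK (mktuple x); rewrite (_ : tnth _ = x)//;
  apply/funext => i; rewrite tnth_mktuple.
pose v k : 'I_n -> R := fun i => if i == j then k.+1%:R^-1 else 0.
have shE k (x : 'I_n -> R) : (fun i => x i + v k i) = upd x j (x j + k.+1%:R^-1).
  by apply/funext => i; rewrite /v /upd; case: eqP => [->|]; rewrite ?addr0.
pose q k (x : n.-tuple R) : R :=
  k.+1%:R * (F (fun i => tnth x i + v k i) - F (tnth x)).
have mF := bF.1.
have bs k : bounded_mfun (fun x : n.-tuple R => F (fun i => tnth x i + v k i)).
  case: bF => _ [L FL]; split; first exact: measurable_torus_shift.
  exists L => x; have := FL [tuple tnth x i + v k i | i < n].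
  by rewrite (_ : tnth _ = (fun i => tnth x i + v k i))//;
    apply/funext => i; rewrite tnth_mktuple.
have bN : bounded_mfun (fun x : n.-tuple R => -1 * F (tnth x)) by exact: bounded_mfunZ.
have q0 k : \int[torus_prob R n]_x q k x = 0.
  rewrite /q bounded_RintegralZ; last first.
    by under eq_fun do rewrite -mulN1r; exact: bounded_mfunD.
  under eq_Rintegral do rewrite -mulN1r.
  rewrite bounded_RintegralD// bounded_RintegralZ// Rintegral_torus_shift//.
    by rewrite mulN1r subrr mulr0.
  move=> i; rewrite /v; case: ifP => _; last by rewrite normr0 mulr_ge0 ?pi_ge0.
  rewrite ger0_norm ?invr_ge0//; apply: (@le_trans _ _ 1).
    by rewrite invf_le1// ler1n.
  by have := pi_ge2 R; lra.
have : \int[torus_prob R n]_x q k x @[k --> \oo] --> mean D.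
  apply: (@bounded_convergence _ _ _ _ _ _ K).
  - move=> k; apply: measurable_funM => //; apply: measurable_funB => //.
    by have [] := bs k.
  - move=> k x; rewrite /q shE.
    have := @derive_quotient_le (fun u => F (upd (tnth x) j u))
      (fun u => D (upd (tnth x) j u)) K (tnth x j) k (FD _) (fun=> DK' _).
    by rewrite upd_id.
  - move=> x.
    have := derive_quotient_cvg (FD (tnth x) (tnth x j)).
    by rewrite upd_id; under eq_fun do rewrite -shE.
under eq_fun do rewrite q0.
by move=> /cvg_lim <- //; rewrite lim_cst.
Qed.

End torus_calculus.

Lemma eq_ler (R : realType) (a b : R) : a = b -> a <= b.
Proof. by move=> ->. Qed.

(** * Derivatives of chord lengths *)

Section derivative_rules.
Context {R : realType}.
Implicit Types (f g : R -> R) (t l : R).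

Lemma is_derive_mul f g t (a b : R) : is_derive t 1 f a -> is_derive t 1 g b ->
  is_derive t 1 (fun u => f u * g u) (a * g t + f t * b).
Proof.
move=> df dg; apply: (is_derive_eq (is_deriveM df dg)).
by rewrite /GRing.scale /= addrC [g t * a]mulrC.
Qed.

Lemma is_derive_add f g t (a b : R) : is_derive t 1 f a -> is_derive t 1 g b ->
  is_derive t 1 (fun u => f u + g u) (a + b).
Proof. by move=> df dg; exact: is_deriveD. Qed.

Lemma is_derive_const (c t : R) : is_derive t 1 (fun _ : R => c) 0.
Proof. exact: is_derive_cst. Qed.

Lemma is_derive_bigsum I (r : seq I) (p : pred I) (F : I -> R -> R) (dF : I -> R) t :
  (forall i, is_derive t 1 (F i) (dF i)) ->
  is_derive t 1 (fun u => \sum_(i <- r | p i) F i u) (\sum_(i <- r | p i) dF i).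
Proof.
move=> h; elim: r => [|i r IH].
  under eq_fun do rewrite big_nil; rewrite big_nil; exact: is_derive_const.
under eq_fun do rewrite big_cons; rewrite big_cons; case: (p i) => //.
exact: is_derive_add.
Qed.

(* A logarithmic derivative [L] of [F] is encoded as [F' = F * L], which still
   makes sense at the zeros of [F]. *)
Lemma is_derive_log_prod I (r : seq I) (p : pred I) (F : I -> R -> R) (L : I -> R) t :
  (forall i, is_derive t 1 (F i) (F i t * L i)) ->
  is_derive t 1 (fun u => \prod_(i <- r | p i) F i u)
    ((\prod_(i <- r | p i) F i t) * \sum_(i <- r | p i) L i).
Proof.
move=> h; elim: r => [|i r IH].
  under eq_fun do rewrite big_nil; rewrite !big_nil mulr0; exact: is_derive_const.
under eq_fun do rewrite big_cons; rewrite !big_cons; case: (p i) => //.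
apply: (is_derive_eq (is_derive_mul (h i) IH)); ring.
Qed.

Lemma is_derive_compose f g t (a b : R) :
  is_derive (g t) 1 f a -> is_derive t 1 g b ->
  is_derive t 1 (fun u => f (g u)) (a * b).
Proof. by move=> df dg; exact: is_derive1_comp. Qed.

Lemma abs_sin_le (u : R) : `|sin u| <= `|u|.
Proof.
have h (v : R) : 0 < v -> `|sin v| <= v.
  move=> v0; have [|c _] := @MVT R sin cos 0 v v0.
    exact/continuous_subspaceT/continuous_sin.
  rewrite sin0 !subr0 => ->; rewrite normrM (gtr0_norm v0).
  by rewrite ler_piMl ?(ltW v0)// cos_max.
have [u0|u0|->] := ltgtP u 0; last by rewrite sin0.
  have := h (- u); rewrite oppr_gt0 sinN normrN => /(_ u0) /le_trans; apply.
  by rewrite -normrN ler_norm.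
by rewrite (le_trans (h _ u0))// ler_norm.
Qed.

(** For the zeros of chord powers, where the logarithmic derivative is singular: the difference
    quotient is of order |u - t|^(p - 1). *)
Lemma is_derive_powR_bound f t (K p : R) : 1 < p -> f t = 0 ->
  (forall u, `|f u| <= K * `|u - t| `^ p) -> is_derive t 1 f 0.
Proof.
move=> p1 ft fK.
have h : (fun h => h^-1 *: ((f \o shift t) (h *: 1) - f t)) @ 0^' --> (0 : R).
  apply/cvgr0Pnorm_le => e e0.
  have K0 : 0 <= `|K| + 1 by rewrite addr_ge0.
  have q0 : 0 < p - 1 by rewrite subr_gt0.
  near=> x.
  have x0 : x != 0 by near: x; exact: nbhs_dnbhs_neq.
  rewrite /= ft subr0 scaler1 normrZ normfV.
  rewrite ler_pdivrMl ?normr_gt0//.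
  rewrite (le_trans (fK _))// addrK.
  rewrite -[X in X <= _]mulr1 -(mulr_powRB1 (normr_ge0 x) (lt_trans ltr01 p1)).
  rewrite mulr1 mulrCA ler_wpM2l//.
  apply: (@le_trans _ _ ((`|K| + 1) * `|x| `^ (p - 1))).
    by rewrite ler_wpM2r ?powR_ge0// (le_trans (ler_norm _))// lerDl.
  rewrite mulrC -ler_pdivlMr; last by rewrite ltr_wpDl.
  (* Written as a power with exponent [p - 1], the bound shows the threshold for [x] by comparing
     bases. *)
  have -> : e / (`|K| + 1) = ((e / (`|K| + 1)) `^ (p - 1)^-1) `^ (p - 1).
    rewrite -powRrM mulVf ?gt_eqF// powRr1// divr_ge0// ltW//.
  apply: ge0_ler_powR => //.
  - exact: ltW.
  - by rewrite nnegrE powR_ge0.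
  by near: x; apply: dnbhs0_le; rewrite powR_gt0// divr_gt0// ltr_wpDl.
apply: DeriveDef; first by apply/cvg_ex; exists 0.
exact/cvg_lim.
Unshelve. all: by end_near.
Qed.

End derivative_rules.

(** * Chords, cotangents and cosecants of half angles *)

Section half_angle.
Context {R : realType}.
Implicit Types (t u p : R).

(* [|1 - e^{it}|^p]. *)
Definition chordp p t : R := (4 * sin (t / 2) ^+ 2) `^ (p / 2).
(** At multiples of [2 * pi] both this and [cosec2] are 0, by the convention for the inverse of 0.
    Identities such as [cosec2_cotan2] therefore ask for a nonzero sine. *)
Definition cotan2 t : R := cos (t / 2) / sin (t / 2).
Definition cosec2 t : R := (sin (t / 2) ^+ 2)^-1.

Lemma sin2_2pi t : sin ((t + 2 * pi) / 2) = - sin (t / 2).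
Proof.
rewrite (_ : (t + 2 * pi) / 2 = t / 2 + pi); first by rewrite sinDpi.
by rewrite mulrDl mulrAC mulfV ?mul1r.
Qed.

Lemma cos2_2pi t : cos ((t + 2 * pi) / 2) = - cos (t / 2).
Proof.
rewrite (_ : (t + 2 * pi) / 2 = t / 2 + pi); first by rewrite cosDpi.
by rewrite mulrDl mulrAC mulfV ?mul1r.
Qed.

Lemma chordp_2pi p t : chordp p (t + 2 * pi) = chordp p t.
Proof. by rewrite /chordp sin2_2pi sqrrN. Qed.

Lemma chordpN p t : chordp p (- t) = chordp p t.
Proof. by rewrite /chordp mulNr sinN sqrrN. Qed.

Lemma cotan2_2pi t : cotan2 (t + 2 * pi) = cotan2 t.
Proof. by rewrite /cotan2 sin2_2pi cos2_2pi invrN mulrNN. Qed.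

Lemma cosec2_2pi t : cosec2 (t + 2 * pi) = cosec2 t.
Proof. by rewrite /cosec2 sin2_2pi sqrrN. Qed.

Lemma chordp_ge0 p t : 0 <= chordp p t.
Proof. exact: powR_ge0. Qed.

Lemma chordp0 p t : p != 0 -> sin (t / 2) = 0 -> chordp p t = 0.
Proof.
move=> p0 s0; rewrite /chordp s0 expr0n/= mulr0 powR0//.
by rewrite mulf_neq0// invr_eq0.
Qed.

Lemma chordp_eq0 p t : chordp p t = 0 -> sin (t / 2) = 0.
Proof.
by move=> /powR_eq0_eq0/eqP; rewrite mulf_eq0 (_ : (4 == 0 :> R) = false)/= ?sqrf_eq0;
  [move=> /eqP|apply/negbTE; rewrite pnatr_eq0].
Qed.

Lemma chordpE p t : chordp p t = (2 * `|sin (t / 2)|) `^ p.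
Proof.
rewrite /chordp [in RHS](_ : p = 2 * (p / 2)); last by rewrite mulrCA mulfV ?mulr1.
rewrite [RHS]powRrM powR_mulrn ?mulr_ge0//; congr (_ `^ _).
by rewrite exprMn real_normK ?num_real//; congr (_ * _); ring.
Qed.

Lemma chordp_le p t : 0 <= p -> chordp p t <= 2 `^ p.
Proof.
move=> p0; rewrite chordpE; apply: ge0_ler_powR; rewrite ?nnegrE// ?mulr_ge0//.
by rewrite ler_piMr// sin_max.
Qed.

(** Trades the real exponent for a natural one, so that powers of the sine can be cancelled against
    poles. *)
Lemma chordp_le_sinX p t (k : nat) : k%:R <= p -> chordp p t <= 2 `^ p * `|sin (t / 2)| ^+ k.
Proof.
move=> kp; rewrite chordpE powRM//.
rewrite ler_wpM2l ?powR_ge0//.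
have := sin_max (t / 2); have := normr_ge0 (sin (t / 2)).
rewrite le_eqVlt => /predU1P[<-|s0] s1.
  case: k kp => [|k] kp; first by rewrite expr0 le_eqVlt; case: (eqVneq p 0) => [->|p0];
    rewrite ?powRr0 ?eqxx// powR0// ltr01 orbT.
  rewrite powR0 ?exprn_ge0//.
  by apply: lt0r_neq0; apply: lt_le_trans kp; rewrite ltr0n.
rewrite -powR_mulrn ?(ltW s0)//; apply: ger_powR => //.
by rewrite s0.
Qed.

Lemma measurable_half (f : R -> R) : continuous f ->
  measurable_fun setT (fun t : R => f (t / 2)).
Proof.
move=> cf; apply: (measurableT_comp (f := f)).
  exact: continuous_measurable_fun.
exact: mulrr_measurable.
Qed.

Lemma measurable_inv_ge0 d (T : measurableType d) (f : T -> R) :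
  (forall x, 0 <= f x) -> measurable_fun setT f ->
  measurable_fun setT (fun x => (f x)^-1).
Proof.
move=> f0 mf; rewrite (_ : (fun x => _) = (fun x => f x `^ (-1))).
  by apply: (measurableT_comp (measurable_powR _) mf).
by apply/funext => x; rewrite powR_inv1.
Qed.

Lemma measurable_chordp p : measurable_fun setT (chordp p).
Proof.
apply: (measurableT_comp (measurable_powR _)).
apply: measurable_funM => //; apply: measurable_funX.
exact: measurable_half (@continuous_sin R).
Qed.

Lemma measurable_cosec2 : measurable_fun setT (cosec2 : R -> R).
Proof.
apply: measurable_inv_ge0 => [t|]; first exact: sqr_ge0.
apply: measurable_funX; exact: measurable_half (@continuous_sin R).
Qed.

Lemma cotan2E t : cotan2 t = cos (t / 2) * sin (t / 2) * cosec2 t.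
Proof.
rewrite /cotan2 /cosec2; have [->|s0] := eqVneq (sin (t / 2)) 0.
  by rewrite invr0 !mulr0 mul0r.
by field.
Qed.

Lemma measurable_cotan2 : measurable_fun setT (cotan2 : R -> R).
Proof.
rewrite (_ : cotan2 = fun t => cos (t / 2) * sin (t / 2) * cosec2 t); last first.
  by apply/funext => t; exact: cotan2E.
apply: measurable_funM; last exact: measurable_cosec2.
by apply: measurable_funM; apply: measurable_half;
  [exact: continuous_cos|exact: continuous_sin].
Qed.

Lemma cosec2_cotan2 t : sin (t / 2) != 0 -> cosec2 t = 1 + cotan2 t ^+ 2.
Proof.
move=> s0; rewrite /cosec2 /cotan2 expr_div_n cos2sin2.
by field.
Qed.

Lemma is_derive_half t : is_derive t 1 (fun u : R => u / 2) 2^-1.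
Proof.
have := is_derive_mul (is_derive_id t 1) (is_derive_const 2^-1 t).
by rewrite mulr0 addr0 mul1r.
Qed.

Lemma is_derive_sin2 t : is_derive t 1 (fun u : R => sin (u / 2)) (cos (t / 2) / 2).
Proof. exact: is_derive_compose (is_derive_sin _) (is_derive_half t). Qed.

Lemma is_derive_cos2 t : is_derive t 1 (fun u : R => cos (u / 2)) (- sin (t / 2) / 2).
Proof. exact: is_derive_compose (is_derive_cos _) (is_derive_half t). Qed.

Lemma is_derive_cotan2 t : sin (t / 2) != 0 ->
  is_derive t 1 cotan2 (- cosec2 t / 2).
Proof.
move=> s0.
have dV := is_deriveV (f := fun u : R => sin (u / 2)) s0 (is_derive_sin2 t).
apply: (is_derive_eq (is_derive_mul (is_derive_cos2 t) dV)).
rewrite /cosec2 /GRing.scale /=.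
have := cos2Dsin2 (t / 2); set s := sin _ in s0 *; set c := cos _ => h.
have -> : - s / 2 * s^-1 + c * (- s ^- 2 * (c / 2)) = - ((c ^+ 2 + s ^+ 2) / s ^+ 2) / 2.
  by field.
by rewrite h div1r.
Qed.

(** Where the sine vanishes the right side is 0, and [chordp p u] is at most |u - t|^p, hence flat
    at [t]. Elsewhere it is the chain rule. *)
Lemma is_derive_chordp p t : 1 < p ->
  is_derive t 1 (chordp p) (chordp p t * (p / 2 * cotan2 t)).
Proof.
move=> p1; have [s0|s0] := eqVneq (sin (t / 2)) 0.
  have p0 : p != 0 by rewrite gt_eqF// (lt_trans ltr01).
  rewrite [X in is_derive _ _ _ X](_ : _ = 0); last by rewrite chordp0// mul0r.
  apply: (@is_derive_powR_bound _ _ _ 1 p) => //; first exact: chordp0.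
  move=> u; rewrite mul1r ger0_norm ?chordp_ge0// chordpE.
  apply: ge0_ler_powR; rewrite ?nnegrE// ?mulr_ge0// ?(le_trans ler01 (ltW p1))//.
  have -> : `|u - t| = 2 * `|(u - t) / 2|.
    by rewrite normrM normfV [`|2|]ger0_norm// mulrCA mulfV// mulr1.
  rewrite ler_wpM2l//; apply: le_trans (abs_sin_le _).
  rewrite mulrBl sinB s0 mulr0 subr0 normrM.
  by rewrite sin0cos1// mulr1.
have x0 : 0 < 4 * sin (t / 2) ^+ 2 by rewrite mulr_gt0// exprn_even_gt0.
have d1 : is_derive t 1 (fun u : R => 4 * sin (u / 2) ^+ 2)
    (4 * (2 * sin (t / 2) * (cos (t / 2) / 2))).
  have dX := is_derive_mul (is_derive_sin2 t) (is_derive_sin2 t).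
  apply: (is_derive_eq (is_derive_mul (is_derive_const 4 t) dX)); ring.
have d2 := is_derive_compose (f := fun y => y `^ (p / 2)) (g := fun u => 4 * sin (u / 2) ^+ 2) (is_derive1_powR (p / 2) x0) d1.
rewrite (_ : chordp p = fun u => (4 * sin (u / 2) ^+ 2) `^ (p / 2))//.
apply: (is_derive_eq d2).
rewrite powRB; last by rewrite (gt_eqF x0) implybT.
rewrite powRr1 ?ltW// /chordp /cotan2.
set y := _ `^ _; move: s0; set s := sin _ => s0.
by field.
Qed.

Lemma chordp_cotan2_le p t : 1 <= p -> `|chordp p t * cotan2 t| <= 2 `^ p.
Proof.
move=> p1; rewrite normrM (ger0_norm (chordp_ge0 _ _)).
apply: (@le_trans _ _ (2 `^ p * `|sin (t / 2)| ^+ 1 * `|cotan2 t|)).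
  by rewrite ler_wpM2r// chordp_le_sinX.
rewrite -mulrA ler_piMr ?powR_ge0// expr1 -normrM /cotan2.
have [->|s0] := eqVneq (sin (t / 2)) 0; first by rewrite mul0r normr0.
by rewrite mulrCA mulfV// mulr1 cos_max.
Qed.

End half_angle.

(** * The circular Jacobi weight *)

Section circular_jacobi.
Context {R : realType} (beta : R) (n : nat).
Implicit Types (x : 'I_n -> R) (i j : 'I_n).

Definition vander x : R :=
  \prod_(p : 'I_n * 'I_n | (p.1 < p.2)%N) chordp beta (x p.1 - x p.2).
Definition radial x : R := \prod_i chordp (2 * beta) (x i).
(** The circular Jacobi weight at exponent 2 beta, as [circular_jacobi_weightE] confirms. The
    factors stay apart because rotations fix [vander] and move only [radial]. *)
Definition weight x : R := vander x * radial x.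
(** The logarithmic derivative of [vander] in the angle [j]; the two indicators differentiate
    [x p.1 - x p.2]. *)
Definition dlog_vander j x : R := \sum_(p : 'I_n * 'I_n | (p.1 < p.2)%N)
  beta / 2 * cotan2 (x p.1 - x p.2) * ((p.1 == j)%:R - (p.2 == j)%:R).
Definition cosecS x : R := \sum_i cosec2 (x i).
Definition regular x := forall i, sin (x i / 2) != 0.

Lemma cosec2_ge0 (t : R) : 0 <= cosec2 t.
Proof. by rewrite invr_ge0 sqr_ge0. Qed.

Lemma cosecS_ge0 x : 0 <= cosecS x.
Proof. by apply: sumr_ge0 => i _; exact: cosec2_ge0. Qed.

Lemma measurable_at (f : R -> R) i : measurable_fun setT f ->
  measurable_fun setT (fun x : n.-tuple R => f (tnth x i)).
Proof. by move=> mf; apply: (measurableT_comp mf); exact: measurable_tnth. Qed.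

Lemma measurable_at2 (f : R -> R) i j : measurable_fun setT f ->
  measurable_fun setT (fun x : n.-tuple R => f (tnth x i - tnth x j)).
Proof.
move=> mf; apply: (measurableT_comp mf).
by apply: measurable_funB; exact: measurable_tnth.
Qed.

Lemma measurable_cosecS : measurable_fun setT (tuple_fun cosecS).
Proof. by apply: measurable_sum => i; apply: measurable_at; exact: measurable_cosec2. Qed.

Lemma measurable_vander : measurable_fun setT (tuple_fun vander).
Proof.
rewrite /vander; under eq_fun do rewrite big_mkcond/=.
apply: measurable_prod => p _; case: (_ < _)%N => //.
by apply: measurable_at2; exact: measurable_chordp.
Qed.

Lemma measurable_radial : measurable_fun setT (tuple_fun radial).
Proof. by apply: measurable_prod => p _; apply: measurable_at; exact: measurable_chordp. Qed.

Lemma measurable_weight : measurable_fun setT (tuple_fun weight).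
Proof. by apply: measurable_funM; [exact: measurable_vander|exact: measurable_radial]. Qed.

Lemma measurable_dlog_vander j : measurable_fun setT (tuple_fun (dlog_vander j)).
Proof.
rewrite /dlog_vander; under eq_fun do rewrite big_mkcond/=.
apply: measurable_sum => p; case: (_ < _)%N => //.
apply: measurable_funM => //; apply: measurable_funM => //.
by apply: measurable_at2; exact: measurable_cotan2.
Qed.

Lemma upd2piE (f : R -> R) x j i : (forall t, f (t + 2 * pi) = f t) ->
  f (upd x j (x j + 2 * pi) i) = f (x i).
Proof. by move=> fp; rewrite /upd; case: eqP => [->|]. Qed.

Lemma upd2pi2E (f : R -> R) x j i k : (forall t, f (t + 2 * pi) = f t) ->
  f (upd x j (x j + 2 * pi) i - upd x j (x j + 2 * pi) k) = f (x i - x k).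
Proof.
move=> fp; rewrite /upd; case: eqP => [->|_]; case: eqP => [->|_] //.
- by congr f; ring.
- by rewrite addrAC fp.
- by rewrite -[LHS]fp; congr f; ring.
Qed.

Lemma periodic_vander : shift_periodic vander.
Proof. by move=> x j; apply: eq_bigr => p _; apply: upd2pi2E; exact: chordp_2pi. Qed.

Lemma periodic_radial : shift_periodic radial.
Proof. by move=> x j; apply: eq_bigr => p _; apply: upd2piE; exact: chordp_2pi. Qed.

Lemma periodic_weight : shift_periodic weight.
Proof. by move=> x j; rewrite /weight periodic_vander periodic_radial. Qed.

Lemma periodic_cosecS : shift_periodic cosecS.
Proof. by move=> x j; apply: eq_bigr => p _; apply: upd2piE; exact: cosec2_2pi. Qed.

Lemma vander_ge0 x : 0 <= vander x.
Proof. by apply: prodr_ge0 => p _; exact: chordp_ge0. Qed.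

Lemma radial_ge0 x : 0 <= radial x.
Proof. by apply: prodr_ge0 => p _; exact: chordp_ge0. Qed.

Lemma weight_ge0 x : 0 <= weight x.
Proof. by rewrite mulr_ge0 ?vander_ge0 ?radial_ge0. Qed.

Hypothesis beta_gt : 3 / 2 < beta.

Let beta_gt1 : 1 < beta. Proof. by have := beta_gt; lra. Qed.
Let beta_gt0 : 0 < beta. Proof. by have := beta_gt; lra. Qed.

Lemma vander_le x : vander x <= \prod_(p : 'I_n * 'I_n | (p.1 < p.2)%N) 2 `^ beta.
Proof. by apply: ler_prod => p _; rewrite chordp_ge0 chordp_le// ltW. Qed.

(** The pole of the cotangent at coinciding angles is cancelled by the chord of the same pair in
    [vander], because [1 < beta]. *)
Lemma vander_cotan2_le x (p : 'I_n * 'I_n) : (p.1 < p.2)%N ->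
  `|vander x * cotan2 (x p.1 - x p.2)| <=
  \prod_(p : 'I_n * 'I_n | (p.1 < p.2)%N) 2 `^ beta.
Proof.
move=> pp; rewrite /vander (bigD1 p)//= [leRHS](bigD1 p)//= mulrAC normrM.
rewrite ler_pM// ?chordp_cotan2_le ?(ltW beta_gt1)// ger0_norm; last first.
  by apply: prodr_ge0 => q _; exact: chordp_ge0.
by apply: ler_prod => q _; rewrite chordp_ge0 chordp_le// ltW.
Qed.

Lemma vander_dlog_bounded j : exists K, forall x, `|vander x * dlog_vander j x| <= K.
Proof.
exists (\sum_(p : 'I_n * 'I_n | (p.1 < p.2)%N)
  (beta / 2 * (\prod_(p : 'I_n * 'I_n | (p.1 < p.2)%N) 2 `^ beta) * 2)) => x.
rewrite /dlog_vander mulr_sumr (le_trans (ler_norm_sum _ _ _))//.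
apply: ler_sum => p pp.
have -> (e c : R) : vander x * (beta / 2 * c * e) = beta / 2 * (vander x * c) * e by ring.
rewrite normrM; apply: ler_pM => //.
  rewrite normrM.
  have b2 : 0 <= beta / 2 by have := beta_gt0; lra.
  by rewrite [`|beta / 2|]ger0_norm// ler_wpM2l// vander_cotan2_le.
by case: eqP => _; case: eqP => _; rewrite ?subrr ?subr0 ?sub0r ?normrN ?normr0 ?normr1 ?ler1n// ler0n.
Qed.

Lemma not_regular_radial x : ~ regular x -> radial x = 0.
Proof.
move=> nx; have [i si] : exists i, sin (x i / 2) = 0.
  by apply: contrapT => h; apply: nx => i; apply/eqP => si; apply: h; exists i.
by rewrite /radial (bigD1 i)//= chordp0 ?mul0r// gt_eqF// mulr_gt0.
Qed.

Lemma regular_radial x : regular x -> radial x != 0.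
Proof.
move=> rx; apply/prodf_neq0 => i _; apply/eqP => /chordp_eq0 s0.
by have := rx i; rewrite s0 eqxx.
Qed.

Lemma not_regular_weight x : ~ regular x -> weight x = 0.
Proof. by move=> nx; rewrite /weight not_regular_radial// mulr0. Qed.

Lemma weight_neq0 x : weight x != 0 ->
  regular x /\ forall i j, i != j -> sin ((x i - x j) / 2) != 0.
Proof.
move=> wx; split.
  by apply: contrapT => /not_regular_weight w0; rewrite w0 eqxx in wx.
have h i j : (i < j)%N -> sin ((x i - x j) / 2) != 0.
  move=> ij; apply: contra_neq wx => s0.
  by rewrite /weight /vander (bigD1 (i, j))//= chordp0 ?mul0r// gt_eqF.
move=> i j; rewrite neq_ltn => /orP[/h//|/h].
by rewrite -opprB mulNr sinN oppr_eq0.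
Qed.

(** A common lower bound for the sines, used to count powers: [radial] is at most of order
    [sinP ^+ 3] and [cosecS] at most of order [sinP ^- 2]. *)
Let sinP x : R := \prod_i `|sin (x i / 2)|.

Lemma sinP_le x i : sinP x <= `|sin (x i / 2)|.
Proof.
rewrite /sinP (bigD1 i)//= ler_piMr//.
by apply: prodr_ile1 => j _; rewrite normr_ge0 sin_max.
Qed.

(** The exponent 3 is the integer that [3 / 2 < beta] guarantees below [2 * beta]. It exceeds by one
    the two powers that [cosecS] consumes. *)
Lemma radial_le x :
  radial x <= (\prod_(i < n) 2 `^ (2 * beta)) * sinP x ^+ 3.
Proof.
rewrite /sinP -prodrXl -big_split/=; apply: ler_prod => i _.
rewrite chordp_ge0 chordp_le_sinX//; have := beta_gt; lra.
Qed.

Lemma sinP_gt0 x : regular x -> 0 < sinP x.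
Proof. by move=> rx; apply: prodr_gt0 => i _; rewrite normr_gt0. Qed.

Lemma cosec2_le_cosecS x i : cosec2 (x i) <= cosecS x.
Proof.
rewrite /cosecS (bigD1 i)//= lerDl sumr_ge0// => j _; exact: cosec2_ge0.
Qed.

Lemma cosecS_le x : regular x -> cosecS x <= (n%:R / sinP x) ^+ 2.
Proof.
move=> rx; have s0 := sinP_gt0 rx.
apply: (@le_trans _ _ (\sum_(i < n) (sinP x ^+ 2)^-1)).
  apply: ler_sum => i _.
  have si : 0 < sin (x i / 2) ^+ 2 by rewrite exprn_even_gt0//= rx.
  have sp : 0 < sinP x ^+ 2 by rewrite exprn_gt0.
  rewrite lef_pV2 ?posrE//.
  by rewrite -[leRHS]real_normK ?num_real// lerXn2r ?nnegrE ?(ltW s0)// sinP_le.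
rewrite sumr_const card_ord expr_div_n -[leLHS]mulr_natl ler_wpM2r//.
  by rewrite invr_ge0 exprn_ge0// ltW.
(* Passing from n to n^2 makes the bound a perfect square, for [sqrt_cosecS_le]. *)
by rewrite -natrX ler_nat; case: n => // m; rewrite leq_pmulr.
Qed.

Lemma sqrt_cosecS_le x : regular x -> Num.sqrt (cosecS x) <= n%:R / sinP x.
Proof.
move=> rx; rewrite -[leRHS]ger0_norm ?divr_ge0// ?(ltW (sinP_gt0 rx))//.
by rewrite -sqrtr_sqr ler_wsqrtr// cosecS_le.
Qed.

Lemma cotan2_sqr_le (t : R) : cotan2 t ^+ 2 <= cosec2 t.
Proof.
have [s0|s0] := eqVneq (sin (t / 2)) 0.
  by rewrite /cotan2 /cosec2 s0 !invr0 mulr0 expr0n/= invr0.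
by rewrite cosec2_cotan2// lerDr.
Qed.

Lemma cotan2_le_sqrt x i : `|cotan2 (x i)| <= Num.sqrt (cosecS x).
Proof.
rewrite -sqrtr_sqr; apply: ler_wsqrtr.
exact: le_trans (cotan2_sqr_le _) (cosec2_le_cosecS _ _).
Qed.

(** One of the three powers of [sinP] pays for the square root; the two that are left make the
    product flat at the zeros of [sin (x j / 2)]. *)
Lemma radial_sqrt_le : exists2 K, 0 <= K & forall x j, regular x ->
  radial x * Num.sqrt (cosecS x) <= K * sin (x j / 2) ^+ 2.
Proof.
exists ((\prod_(i < n) 2 `^ (2 * beta)) * n%:R).
  by rewrite mulr_ge0// prodr_ge0// => i _; rewrite powR_ge0.
move=> x j rx; have s0 := sinP_gt0 rx.
apply: (@le_trans _ _ ((\prod_(i < n) 2 `^ (2 * beta)) * sinP x ^+ 3 * (n%:R / sinP x))).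
  by apply: ler_pM; rewrite ?radial_ge0 ?sqrtr_ge0 ?radial_le ?sqrt_cosecS_le.
rewrite (_ : _ * (_ / _) = (\prod_(i < n) 2 `^ (2 * beta)) * n%:R * sinP x ^+ 2); last first.
  by field; rewrite gt_eqF.
rewrite ler_wpM2l ?mulr_ge0 ?prodr_ge0//.
by rewrite -[leRHS]real_normK ?num_real// lerXn2r ?nnegrE ?(ltW s0)// sinP_le.
Qed.

Lemma radial_cosecS_le : exists2 K, 0 <= K & forall x, regular x ->
  radial x * cosecS x <= K.
Proof.
exists ((\prod_(i < n) 2 `^ (2 * beta)) * n%:R ^+ 2).
  by rewrite mulr_ge0// prodr_ge0// => i _; rewrite powR_ge0.
move=> x rx; have s0 := sinP_gt0 rx.
apply: (@le_trans _ _ ((\prod_(i < n) 2 `^ (2 * beta)) * sinP x ^+ 3 * (n%:R / sinP x) ^+ 2)).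
  by apply: ler_pM; rewrite ?radial_ge0 ?cosecS_ge0 ?radial_le ?cosecS_le.
rewrite (_ : _ * (_ / _) ^+ 2 = (\prod_(i < n) 2 `^ (2 * beta)) * n%:R ^+ 2 * sinP x); last first.
  by field; rewrite gt_eqF.
rewrite ler_piMr// ?mulr_ge0 ?prodr_ge0//.
by apply: prodr_ile1 => i _; rewrite normr_ge0 sin_max.
Qed.

Lemma is_derive_upd x j i (t : R) :
  is_derive t 1 (fun u => upd x j u i) (i == j)%:R.
Proof.
rewrite /upd; case: eqP => _; [exact: is_derive_id|exact: is_derive_const].
Qed.

Lemma is_derive_vander x j (t : R) :
  is_derive t 1 (fun u => vander (upd x j u))
    (vander (upd x j t) * dlog_vander j (upd x j t)).
Proof.
apply: is_derive_log_prod => p.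
have d1 : is_derive t 1 (fun u => upd x j u p.1 - upd x j u p.2)
    ((p.1 == j)%:R - (p.2 == j)%:R).
  apply: is_derive_add; first exact: is_derive_upd.
  have := is_derive_mul (is_derive_const (-1) t) (is_derive_upd x j p.2 t).
  by rewrite mul0r add0r mulN1r; under eq_fun do rewrite mulN1r.
apply: (is_derive_eq (is_derive_compose (is_derive_chordp _ beta_gt1) d1)).
by rewrite !mulrA.
Qed.

Lemma is_derive_radial x j (t : R) :
  is_derive t 1 (fun u => radial (upd x j u))
    (radial (upd x j t) * (beta * cotan2 t)).
Proof.
have beta2 : 1 < 2 * beta by have := beta_gt1; lra.
have sE : \sum_i (2 * beta) / 2 * cotan2 (upd x j t i) * (i == j)%:R = beta * cotan2 t.
  rewrite (bigD1 j)//= big1 => [|i /negbTE ->]; last by rewrite mulr0.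
  by rewrite /upd eqxx mulr1 addr0 [2 * _]mulrC mulfK.
rewrite -sE; apply: is_derive_log_prod => i.
apply: (is_derive_eq (is_derive_compose (is_derive_chordp _ beta2) (is_derive_upd x j i t))).
ring.
Qed.

Lemma is_derive_weight x j (t : R) :
  is_derive t 1 (fun u => weight (upd x j u))
    (weight (upd x j t) * (dlog_vander j (upd x j t) + beta * cotan2 t)).
Proof.
apply: (is_derive_eq (is_derive_mul (is_derive_vander x j t) (is_derive_radial x j t))).
rewrite /weight; ring.
Qed.

Lemma upd_upd x j (t u : R) : upd (upd x j t) j u = upd x j u.
Proof. by apply/funext => i; rewrite /upd; case: eqP. Qed.

Lemma sin2_le1 (t : R) : sin t ^+ 2 <= 1.
Proof. by rewrite -(cos2Dsin2 t) lerDr sqr_ge0. Qed.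

Lemma upd_at x j (t : R) : upd x j t j = t.
Proof. by rewrite /upd eqxx. Qed.

(** * Integration by parts along singular fields *)

Section divergence.
Variables (j : 'I_n) (v dv : ('I_n -> R) -> R) (K : R).
Hypotheses (mv : measurable_fun setT (tuple_fun v))
  (mdv : measurable_fun setT (tuple_fun dv)) (pv : shift_periodic v).
Hypothesis v_le : forall x, regular x -> `|v x| <= K * Num.sqrt (cosecS x).
Hypothesis dv_le : forall x, regular x -> `|dv x| <= K * cosecS x.
Hypothesis v_dv : forall x, regular x ->
  is_derive (x j) 1 (fun u => v (upd x j u)) (dv x).

(* [weight * divergence] is the derivative of [weight * v] in the angle [j]. *)
Definition divergence x : R :=
  dv x + v x * (dlog_vander j x + beta * cotan2 (x j)).

Lemma measurable_divergence : measurable_fun setT (tuple_fun divergence).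
Proof.
apply: measurable_funD => //; apply: measurable_funM => //.
apply: measurable_funD; first exact: measurable_dlog_vander.
by apply: measurable_funM => //; apply: measurable_at; exact: measurable_cotan2.
Qed.

Lemma K_ge0 x : regular x -> 0 <= K.
Proof.
move=> rx; have := le_trans (normr_ge0 _) (v_le rx).
rewrite pmulr_lge0// sqrtr_gt0 (lt_le_trans _ (cosec2_le_cosecS x j))//.
by rewrite invr_gt0 exprn_even_gt0// rx.
Qed.

Lemma weight_field_le : exists2 L, 0 <= L &
  forall x, `|weight x * v x| <= L * sin (x j / 2) ^+ 2.
Proof.
have [L L0 hL] := radial_sqrt_le.
have V0 : 0 <= \prod_(p : 'I_n * 'I_n | (p.1 < p.2)%N) 2 `^ beta.
  by apply: prodr_ge0 => p _; rewrite powR_ge0.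
exists ((\prod_(p : 'I_n * 'I_n | (p.1 < p.2)%N) 2 `^ beta) * L * `|K|).
  by rewrite !mulr_ge0.
move=> x; have [rx|rx] := pselect (regular x); last first.
  by rewrite not_regular_weight// mul0r normr0 mulr_ge0 ?sqr_ge0// mulr_ge0// mulr_ge0.
rewrite /weight -mulrA normrM ger0_norm ?vander_ge0// -!mulrA.
apply: ler_pM; rewrite ?vander_ge0 ?vander_le//.
rewrite normrM ger0_norm ?radial_ge0//.
apply: (@le_trans _ _ (radial x * (K * Num.sqrt (cosecS x)))).
  by rewrite ler_wpM2l ?radial_ge0// v_le.
rewrite mulrCA [leRHS]mulrCA; apply: ler_pM => //.
- exact: K_ge0 rx.
- by rewrite mulr_ge0 ?radial_ge0 ?sqrtr_ge0.
- exact: ler_norm.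
- exact: hL.
Qed.

Lemma bounded_weight_divergence :
  bounded_mfun (fun x : n.-tuple R => weight (tnth x) * divergence (tnth x)).
Proof.
split.
  by apply: measurable_funM; [exact: measurable_weight|exact: measurable_divergence].
have [L L0 hL] := radial_sqrt_le.
have [M M0 hM] := radial_cosecS_le.
have [N hN] := vander_dlog_bounded j.
pose V := \prod_(p : 'I_n * 'I_n | (p.1 < p.2)%N) 2 `^ beta.
have V0 : 0 <= V by apply: prodr_ge0 => p _; rewrite powR_ge0.
exists (V * (`|K| * M) + N * (`|K| * L) + V * (`|K| * M) * beta) => y.
set x := tnth y.
have N0 := le_trans (normr_ge0 _) (hN x).
have [rx|rx] := pselect (regular x); last first.
  rewrite not_regular_weight// mul0r normr0.
  by rewrite !addr_ge0// ?mulr_ge0// ?mulr_ge0// ltW.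
have K0 := K_ge0 rx.
have rK : `|K| = K by rewrite ger0_norm.
have b1 : radial x * `|dv x| <= `|K| * M.
  apply: (@le_trans _ _ (K * (radial x * cosecS x))).
    by rewrite mulrCA ler_wpM2l ?radial_ge0// dv_le.
  by rewrite rK ler_wpM2l// hM.
have b2 : radial x * `|v x| <= `|K| * L.
  apply: (@le_trans _ _ (K * (radial x * Num.sqrt (cosecS x)))).
    by rewrite mulrCA ler_wpM2l ?radial_ge0// v_le.
  by rewrite rK ler_wpM2l// (le_trans (hL x j rx))// ler_piMr// sin2_le1.
have b3 : radial x * (`|v x| * `|cotan2 (x j)|) <= `|K| * M.
  apply: (@le_trans _ _ (K * (radial x * cosecS x))).
    rewrite [leRHS]mulrCA ler_wpM2l ?radial_ge0//.
    apply: (@le_trans _ _ ((K * Num.sqrt (cosecS x)) * Num.sqrt (cosecS x))).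
      by apply: ler_pM => //; [exact: v_le|exact: cotan2_le_sqrt].
    by rewrite -mulrA -expr2 sqr_sqrtr ?cosecS_ge0.
  by rewrite rK ler_wpM2l// hM.
rewrite /weight /divergence.
(* Every pole is grouped with the factor that cancels it: [dlog_vander] with [vander], the others
   with [radial]. *)
have -> : vander x * radial x * (dv x + v x * (dlog_vander j x + beta * cotan2 (x j))) =
  vander x * (radial x * dv x) + vander x * dlog_vander j x * (radial x * v x) +
  vander x * (radial x * (v x * cotan2 (x j))) * beta by ring.
apply: (le_trans (ler_normD _ _)); apply: lerD.
  apply: (le_trans (ler_normD _ _)); apply: lerD.
    rewrite normrM ger0_norm ?vander_ge0//.
    apply: ler_pM; rewrite ?vander_ge0 ?vander_le// normrM ger0_norm ?radial_ge0//.
  rewrite normrM; apply: ler_pM => //.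
  by rewrite normrM ger0_norm ?radial_ge0.
rewrite normrM (gtr0_norm beta_gt0) ler_wpM2r ?(ltW beta_gt0)//.
rewrite normrM ger0_norm ?vander_ge0//.
apply: ler_pM; rewrite ?vander_ge0 ?vander_le//.
by rewrite normrM ger0_norm ?radial_ge0// normrM.
Qed.

(** At regular configurations this is the product rule. If the angle [j] sits at a zero of the sine,
    [weight_field_le] makes the product flat there; if only another angle does, the weight is
    identically 0 along the line. *)
Lemma integral_divergence :
  mean (fun x => weight x * divergence x) = 0.
Proof.
apply: (@torus_integral_derivative R n j (fun x => weight x * v x)).
- split; first by apply: measurable_funM => //; exact: measurable_weight.
  have [L L0 hL] := weight_field_le; exists L => x; rewrite (le_trans (hL _))//.
  by rewrite ler_piMr// sin2_le1.
- exact: bounded_weight_divergence.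
- by move=> x k; rewrite periodic_weight pv.
move=> x t; have [ry|ry] := pselect (regular (upd x j t)).
  have := v_dv ry; rewrite upd_at; under eq_fun do rewrite upd_upd.
  move=> dvt; apply: (is_derive_eq (is_derive_mul (is_derive_weight x j t) dvt)).
  rewrite /divergence upd_at; ring.
rewrite not_regular_weight// mul0r.
have [t0|t0] := eqVneq (sin (t / 2)) 0.
  have [L L0 hL] := weight_field_le.
  apply: (@is_derive_powR_bound _ _ _ L 2); first by rewrite ltr1n.
    by rewrite not_regular_weight// mul0r.
  move=> u; rewrite (le_trans (hL _))// ler_wpM2l//.
  rewrite powR_mulrn// upd_at -[leLHS]real_normK ?num_real//.
  rewrite lerXn2r ?nnegrE//.
  apply: (@le_trans _ _ `|(u - t) / 2|).
    apply: le_trans (abs_sin_le _).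
    by rewrite mulrBl sinB t0 mulr0 subr0 normrM sin0cos1// mulr1.
  rewrite normrM ler_piMr// normfV ger0_norm//; lra.
rewrite (_ : (fun u => _) = fun _ : R => 0); first exact: is_derive_const.
apply/funext => u; rewrite not_regular_weight ?mul0r// => ru.
apply: ry => i; have := ru i; rewrite /upd; by case: (i =P j).
Qed.

End divergence.
End circular_jacobi.

(** * Loop equations *)

Section loop_equations.
Context {R : realType} (beta : R) (n : nat).
Implicit Types (x : 'I_n -> R) (i j : 'I_n).
Local Notation W := (@weight R beta n).
Local Notation A := (@cosecS R n).

Definition cotS x : R := \sum_i cotan2 (x i).
Definition cosec2S x : R := \sum_i cosec2 (x i) ^+ 2.
(** Minus the derivative of [cosecS] when all angles rotate together. *)
Definition cotcosecS x : R := \sum_i cotan2 (x i) * cosec2 (x i).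
(** The squared length of the gradient of [cosecS]; it appears when a field along that gradient
    differentiates a function of [cosecS]. *)
Definition cot2cosec2S x : R := \sum_i cotan2 (x i) ^+ 2 * cosec2 (x i) ^+ 2.

Lemma is_derive_cosec2 (t : R) : sin (t / 2) != 0 ->
  is_derive t 1 cosec2 (- (cotan2 t * cosec2 t)).
Proof.
move=> s0.
have s20 : sin (t / 2) ^+ 2 != 0 by rewrite sqrf_eq0.
have d2 := is_derive_mul (is_derive_sin2 t) (is_derive_sin2 t).
have dV := is_deriveV (f := fun u : R => sin (u / 2) ^+ 2) s20 d2.
apply: (is_derive_eq dV).
by rewrite /cotan2 /cosec2 /GRing.scale /=; field.
Qed.

Lemma is_derive_cotcosec2 (t : R) : sin (t / 2) != 0 ->
  is_derive t 1 (fun u => cotan2 u * cosec2 u) (- (3 / 2) * cosec2 t ^+ 2 + cosec2 t).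
Proof.
move=> s0; apply: (is_derive_eq (is_derive_mul (is_derive_cotan2 s0) (is_derive_cosec2 s0))).
have := cosec2_cotan2 s0; set a := cosec2 t; set w := cotan2 t => ->; by field.
Qed.

Lemma is_derive_sum_upd (f : R -> R) (l : R) x j : is_derive (x j) 1 f l ->
  is_derive (x j) 1 (fun u => \sum_i f (upd x j u i)) l.
Proof.
move=> df.
have : is_derive (x j) 1 (fun u => \sum_i f (upd x j u i)) (\sum_i (if i == j then l else 0)).
  apply: is_derive_bigsum => i; rewrite /upd; case: eqP => _ //.
  exact: is_derive_const.
by rewrite -big_mkcond/= big_pred1_eq.
Qed.

Lemma measurable_cotS : measurable_fun setT (tuple_fun cotS).
Proof. by apply: measurable_sum => i; apply: measurable_at; exact: measurable_cotan2. Qed.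

Lemma measurable_cosec2S : measurable_fun setT (tuple_fun cosec2S).
Proof.
apply: measurable_sum => i; apply: measurable_funX.
by apply: measurable_at; exact: measurable_cosec2.
Qed.

Lemma measurable_cotcosec2 : measurable_fun setT (fun t : R => cotan2 t * cosec2 t).
Proof. by apply: measurable_funM; [exact: measurable_cotan2|exact: measurable_cosec2]. Qed.

Lemma measurable_cotcosecS : measurable_fun setT (tuple_fun cotcosecS).
Proof.
by apply: measurable_sum => i; apply: (measurable_at i measurable_cotcosec2).
Qed.

Lemma measurable_cot2cosec2S : measurable_fun setT (tuple_fun cot2cosec2S).
Proof.
apply: measurable_sum => i; apply: measurable_funM; apply: measurable_funX;
  apply: measurable_at; [exact: measurable_cotan2|exact: measurable_cosec2].
Qed.

Lemma periodic_cotS : shift_periodic cotS.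
Proof. by move=> x j; apply: eq_bigr => p _; apply: upd2piE; exact: cotan2_2pi. Qed.

Lemma periodic_cotcosecS : shift_periodic cotcosecS.
Proof.
move=> x j; apply: eq_bigr => p _; apply: (upd2piE (f := fun t => cotan2 t * cosec2 t)).
by move=> t; rewrite cotan2_2pi cosec2_2pi.
Qed.

Lemma cotS_le x : `|cotS x| <= n%:R * Num.sqrt (A x).
Proof.
rewrite (le_trans (ler_norm_sum _ _ _))//.
rewrite (le_trans (ler_sum _ (fun i _ => cotan2_le_sqrt x i)))//.
by rewrite sumr_const card_ord mulr_natl.
Qed.

Lemma cosec2S_ge0 x : 0 <= cosec2S x.
Proof. by apply: sumr_ge0 => i _; rewrite sqr_ge0. Qed.

Lemma cosec2S_le x : cosec2S x <= A x ^+ 2.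
Proof.
rewrite expr2 {1}/cosecS mulr_suml; apply: ler_sum => i _.
by rewrite expr2 ler_wpM2l ?cosec2_ge0// cosec2_le_cosecS.
Qed.

Lemma cosecS_sqrtE x : A x = Num.sqrt (A x) ^+ 2.
Proof. by rewrite sqr_sqrtr ?cosecS_ge0. Qed.

Lemma cotcosec_le x i : `|cotan2 (x i) * cosec2 (x i)| <= Num.sqrt (A x) * A x.
Proof.
by rewrite normrM ler_pM ?cotan2_le_sqrt// ger0_norm ?cosec2_ge0// cosec2_le_cosecS.
Qed.

(* Cauchy-Schwarz, so that the bound does not depend on the number of angles. *)
Lemma cotcosecS_sqr_le x : cotcosecS x ^+ 2 <= A x ^+ 3.
Proof.
have [A0|A0] := eqVneq (A x) 0.
  have c0 i : cosec2 (x i) = 0.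
    by apply/eqP; move/eqP: A0; rewrite psumr_eq0 => [/allP/(_ i)|k _];
      [apply; rewrite mem_index_enum|exact: cosec2_ge0].
  by rewrite /cotcosecS big1 ?expr0n/= ?exprn_ge0 ?cosecS_ge0// => i _; rewrite c0 mulr0.
have Apos : 0 < A x by rewrite lt_neqAle eq_sym A0 cosecS_ge0.
set D := cotcosecS x.
(* A weighted variance: for the weights [cosec2 (x i)], the quotient [D / A x] is the mean of the
   cotangents. *)
have h : 0 <= \sum_i cosec2 (x i) * (cotan2 (x i) - D / A x) ^+ 2.
  by apply: sumr_ge0 => i _; rewrite mulr_ge0 ?sqr_ge0 ?cosec2_ge0.
have E : \sum_i cosec2 (x i) * (cotan2 (x i) - D / A x) ^+ 2 =
   \sum_i cotan2 (x i) ^+ 2 * cosec2 (x i) - D ^+ 2 / A x.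
  transitivity (\sum_i (cotan2 (x i) ^+ 2 * cosec2 (x i)
     + (- 2 * (D / A x)) * (cotan2 (x i) * cosec2 (x i)) + (D / A x) ^+ 2 * cosec2 (x i))).
    by apply: eq_bigr => i _; ring.
  rewrite !big_split/= -!mulr_sumr -/(cotcosecS x) -/D -/(cosecS x); by field.
have le2 : \sum_i cotan2 (x i) ^+ 2 * cosec2 (x i) <= A x * A x.
  rewrite {2}/cosecS mulr_sumr; apply: ler_sum => i _.
  rewrite ler_wpM2r ?cosec2_ge0// (le_trans (cotan2_sqr_le _))//.
  exact: cosec2_le_cosecS.
move: h; rewrite E subr_ge0 ler_pdivrMr// => /le_trans; apply.
by rewrite exprSr expr2 ler_wpM2r// ltW.
Qed.

Lemma cot2cosec2S_le x : cot2cosec2S x <= A x ^+ 3.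
Proof.
apply: (@le_trans _ _ (\sum_i cosec2 (x i) * A x ^+ 2)).
  apply: ler_sum => i _; apply: ler_pM; rewrite ?sqr_ge0 ?cotan2_sqr_le//.
  by rewrite lerXn2r ?nnegrE ?cosec2_ge0 ?cosecS_ge0// cosec2_le_cosecS.
by rewrite -mulr_suml exprS.
Qed.

Lemma cot2cosec2S_ge0 x : 0 <= cot2cosec2S x.
Proof. by apply: sumr_ge0 => i _; rewrite mulr_ge0 ?sqr_ge0. Qed.

Lemma regular_cosecS_ge1 x (j : 'I_n) : regular x -> 1 <= A x.
Proof.
move=> rx; apply: le_trans (cosec2_le_cosecS x j).
by rewrite cosec2_cotan2// lerDl sqr_ge0.
Qed.

Lemma cosecS_gt0 x (j : 'I_n) : regular x -> 0 < A x.
Proof. by move=> /(regular_cosecS_ge1 j); exact: lt_le_trans. Qed.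

(** Exchanging the sums shows that a pair sees only the difference of the field at its two angles:
    equal components drop out, and a difference that vanishes as the angles meet cancels the
    pole. *)
Lemma sum_field_dlog_vander (v : 'I_n -> R) x :
  \sum_j v j * dlog_vander beta j x =
  \sum_(p : 'I_n * 'I_n | (p.1 < p.2)%N)
    beta / 2 * (cotan2 (x p.1 - x p.2) * (v p.1 - v p.2)).
Proof.
rewrite /dlog_vander; under eq_bigr do rewrite mulr_sumr.
rewrite exchange_big/=; apply: eq_bigr => p _.
have sel k : \sum_j v j * (k == j)%:R = v k.
  rewrite (bigD1 k)//= eqxx mulr1 big1 ?addr0// => j /negbTE.
  by rewrite eq_sym => ->; rewrite mulr0.
transitivity (beta / 2 * cotan2 (x p.1 - x p.2) *
  (\sum_j v j * (p.1 == j)%:R - \sum_j v j * (p.2 == j)%:R)); last by rewrite !sel mulrA.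
rewrite -sumrB mulr_sumr; apply: eq_bigr => j _; ring.
Qed.

(** The subtraction formula for the cotangent without its denominator. It removes the pole of the
    pair interaction and leaves products of functions of one angle. *)
Lemma cotan2_sub_mul (s t : R) : sin (s / 2) != 0 -> sin (t / 2) != 0 ->
  sin ((s - t) / 2) != 0 ->
  cotan2 (s - t) * (cotan2 s - cotan2 t) = - (1 + cotan2 s * cotan2 t).
Proof.
rewrite /cotan2 mulrBl sinB cosB.
set a := sin (s / 2); set b := sin (t / 2); set c := cos (s / 2); set e := cos (t / 2).
by move=> a0 b0 ab0; field; rewrite a0 b0 ab0.
Qed.

Lemma sum_lt_pairs (g : 'I_n -> 'I_n -> R) : (forall i k, g i k = g k i) ->
  \sum_(p : 'I_n * 'I_n | (p.1 < p.2)%N) g p.1 p.2 =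
  (\sum_i \sum_k g i k - \sum_i g i i) / 2.
Proof.
move=> gC; rewrite pair_bigA/=.
rewrite [X in _ = (X - _) / 2](bigID (fun p : 'I_n * 'I_n => p.1 == p.2))/=.
rewrite [X in _ = (X + _ - _) / 2](_ : _ = \sum_i g i i); last first.
  rewrite -(pair_big_dep xpredT (fun i k => i == k) g)/=.
  by apply: eq_bigr => i _; rewrite (big_pred1 i)// => k; rewrite eq_sym.
rewrite addrAC subrr add0r.
rewrite [X in _ = X / 2](bigID (fun p : 'I_n * 'I_n => (p.1 < p.2)%N))/=.
rewrite [X in _ = (X + _) / 2](eq_bigl (fun p : 'I_n * 'I_n => (p.1 < p.2)%N)); last first.
  by move=> p /=; rewrite andbC -val_eqE/= neq_ltn; case: (p.1 < p.2)%N.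
rewrite [X in _ = (_ + X) / 2](_ : _ = \sum_(p : 'I_n * 'I_n | (p.1 < p.2)%N) g p.1 p.2).
  by field.
rewrite (reindex_inj (h := fun p : 'I_n * 'I_n => (p.2, p.1)))/=; last first.
  by move=> [a b] [c e] [-> ->].
apply: eq_big => [p|p _]; last by rewrite gC.
by rewrite -val_eqE/= neq_ltn /=; case: ltngtP.
Qed.

Hypothesis beta_gt : 3 / 2 < beta.

Lemma bounded_weight_mul (f : ('I_n -> R) -> R) (K : R) :
  measurable_fun setT (tuple_fun f) -> (forall x, regular x -> `|f x| <= K * A x) ->
  bounded_mfun (fun x : n.-tuple R => W (tnth x) * f (tnth x)).
Proof.
move=> mf fK; split; first by apply: measurable_funM => //; exact: measurable_weight.
have [M M0 hM] := radial_cosecS_le n beta_gt.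
have V0 : 0 <= \prod_(p : 'I_n * 'I_n | (p.1 < p.2)%N) 2 `^ beta.
  by apply: prodr_ge0 => p _; rewrite powR_ge0.
exists ((\prod_(p : 'I_n * 'I_n | (p.1 < p.2)%N) 2 `^ beta) * (M * `|K|)) => y.
set x := tnth y; have [rx|rx] := pselect (regular x); last first.
  by rewrite (not_regular_weight beta_gt)// mul0r normr0 mulr_ge0// mulr_ge0.
rewrite /weight -mulrA normrM ger0_norm ?vander_ge0//.
apply: ler_pM; rewrite ?vander_ge0 ?vander_le//.
rewrite normrM ger0_norm ?radial_ge0//.
apply: (@le_trans _ _ (radial beta x * (`|K| * A x))).
  rewrite ler_wpM2l ?radial_ge0// (le_trans (fK _ rx))//.
  by rewrite ler_wpM2r ?cosecS_ge0// ler_norm.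
by rewrite mulrCA mulrC ler_wpM2r// hM.
Qed.

(** * Loop equations with a free function of [cosecS] *)

Section fields.
Variables psi dpsi : R -> R.
Hypothesis mpsi : measurable_fun setT (tuple_fun (fun x => psi (A x))).
Hypothesis mdpsi : measurable_fun setT (tuple_fun (fun x => dpsi (A x))).
Hypothesis psi_dpsi : forall a : R, 0 < a -> is_derive a 1 psi (dpsi a).

Lemma is_derive_psi_upd x j : regular x ->
  is_derive (x j) 1 (fun u => psi (A (upd x j u)))
    (- (dpsi (A x) * (cotan2 (x j) * cosec2 (x j)))).
Proof.
move=> rx.
have dA : is_derive (x j) 1 (fun u => A (upd x j u)) (- (cotan2 (x j) * cosec2 (x j))).
  by apply: is_derive_sum_upd; exact: is_derive_cosec2.
have A0 : 0 < A (upd x j (x j)).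
  by rewrite upd_id (cosecS_gt0 j).
by apply: (is_derive_eq (is_derive_compose (psi_dpsi A0) dA)); rewrite upd_id mulrN.
Qed.

(** The sum of [integral_divergence] over the angles. The formula for [F] is asked at distinct
    regular angles, since the weight is 0 elsewhere. *)
Lemma loop_field (v dv : 'I_n -> ('I_n -> R) -> R) (K : R) (F : ('I_n -> R) -> R) :
  (forall j, measurable_fun setT (tuple_fun (v j))) ->
  (forall j, measurable_fun setT (tuple_fun (dv j))) ->
  (forall j, shift_periodic (v j)) ->
  (forall j x, regular x -> `|v j x| <= K * Num.sqrt (A x)) ->
  (forall j x, regular x -> `|dv j x| <= K * A x) ->
  (forall j x, regular x -> is_derive (x j) 1 (fun u => v j (upd x j u)) (dv j x)) ->
  (forall x, regular x -> (forall i j, i != j -> sin ((x i - x j) / 2) != 0) ->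
    F x = \sum_j dv j x + (\sum_(p : 'I_n * 'I_n | (p.1 < p.2)%N)
      beta / 2 * (cotan2 (x p.1 - x p.2) * (v p.1 x - v p.2 x)) +
      beta * \sum_j v j x * cotan2 (x j))) ->
  mean (fun x => W x * F x) = 0.
Proof.
move=> mv mdv pv vK dvK vdv FE.
transitivity (mean (fun x => \sum_j W x * divergence beta j (v j) (dv j) x)).
  apply: eq_Rintegral => y _; set x := tnth y.
  have [->|W0] := eqVneq (W x) 0; first by rewrite mul0r big1// => j _; rewrite mul0r.
  have [rx sx] := weight_neq0 beta_gt W0.
  rewrite -mulr_sumr; congr (_ * _); rewrite FE// /divergence big_split/=; congr (_ + _).
  under [RHS]eq_bigr do rewrite mulrDr.
  rewrite big_split/=; congr (_ + _); first by rewrite sum_field_dlog_vander.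
  by rewrite mulr_sumr; apply: eq_bigr => j _; ring.
rewrite bounded_Rintegral_sum => [|j]; last first.
  apply: (@bounded_weight_divergence R beta n beta_gt j (v j) (dv j) K); [exact: mv|exact: mdv|exact: vK|exact: dvK].
rewrite big1// => j _.
exact: (integral_divergence beta_gt (mv j) (mdv j) (pv j) (vK j) (dvK j) (vdv j)).
Qed.

Let measurable_dpsi_cotcosec j :
  measurable_fun setT (fun x : n.-tuple R =>
    - (dpsi (A (tnth x)) * (cotan2 (tnth x j) * cosec2 (tnth x j)))).
Proof.
apply: measurable_funN; apply: measurable_funM => //.
exact: (measurable_at j measurable_cotcosec2).
Qed.

Variable K : R.

(** * Fields linear in the cotangent *)

Section degree_one.
Hypothesis psi_le : forall a : R, 0 < a -> `|psi a| <= K.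
Hypothesis dpsi_le : forall a : R, 0 < a -> `|a * dpsi a| <= K.

Let K0 : 0 <= K.
Proof. exact: le_trans (normr_ge0 _) (psi_le ltr01). Qed.

Lemma dpsi_cotcosec_le x j : regular x ->
  `|dpsi (A x) * (cotan2 (x j) * cosec2 (x j))| <= K * Num.sqrt (A x).
Proof.
move=> rx; have A0 := cosecS_gt0 j rx.
rewrite normrM (le_trans (ler_wpM2l (normr_ge0 _) (cotcosec_le x j)))//.
rewrite mulrCA mulrC ler_wpM2r ?sqrtr_ge0//.
by rewrite mulrC -[X in X * `|_|](gtr0_norm A0) -normrM dpsi_le.
Qed.

Lemma dcotan2_psi_le x j : regular x ->
  `|- cosec2 (x j) / 2 * psi (A x)| <= K * A x.
Proof.
move=> rx; have A0 := cosecS_gt0 j rx.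
rewrite normrM mulrC ler_pM// ?psi_le// mulNr normrN ger0_norm ?divr_ge0 ?cosec2_ge0//.
by have := cosec2_le_cosecS x j; have := cosec2_ge0 (x j); lra.
Qed.

(* The field is the same at all the angles, so that the Vandermonde factor drops
   out. *)
Lemma loop_rotation_cot :
  mean (fun x => W x * (beta * (cotS x ^+ 2 * psi (A x)) - A x * psi (A x) / 2
    - cotS x * cotcosecS x * dpsi (A x))) = 0.
Proof.
pose v (j : 'I_n) x := cotS x * psi (A x).
pose dv (j : 'I_n) x := - cosec2 (x j) / 2 * psi (A x) +
  cotS x * - (dpsi (A x) * (cotan2 (x j) * cosec2 (x j))).
pose F x := beta * (cotS x ^+ 2 * psi (A x)) - A x * psi (A x) / 2
    - cotS x * cotcosecS x * dpsi (A x).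
apply: (@loop_field v dv (n%:R * K + K) F).
- by move=> j; apply: measurable_funM => //; exact: measurable_cotS.
- move=> j; apply: measurable_funD.
    apply: measurable_funM => //; apply: measurable_funM => //.
    by apply: measurable_funN; apply: measurable_at; exact: measurable_cosec2.
  by apply: measurable_funM; first exact: measurable_cotS.
- by move=> j x k; rewrite /v periodic_cotS periodic_cosecS.
- move=> j x rx; rewrite /v normrM.
  have A0 := cosecS_gt0 j rx.
  apply: (@le_trans _ _ (n%:R * Num.sqrt (A x) * K)).
    by apply: ler_pM; rewrite ?cotS_le ?psi_le.
  by rewrite mulrAC ler_wpM2r ?sqrtr_ge0// lerDl.
- move=> j x rx; rewrite /dv.
  rewrite (le_trans (ler_normD _ _))// [leRHS]mulrDl [leLHS]addrC; apply: lerD.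
    rewrite normrM normrN (le_trans (ler_pM _ _ (cotS_le x) (dpsi_cotcosec_le j rx)))//.
    by rewrite [A x in leRHS]cosecS_sqrtE; apply: eq_ler; ring.
  exact: dcotan2_psi_le.
- move=> j x rx.
  have dB : is_derive (x j) 1 (fun u => cotS (upd x j u)) (- cosec2 (x j) / 2).
    by apply: is_derive_sum_upd; exact: is_derive_cotan2.
  have := is_derive_mul dB (is_derive_psi_upd j rx).
  by rewrite upd_id.
- move=> x rx sx; rewrite /F /v /dv big_split/=.
  rewrite [X in _ + (X + _)]big1 ?add0r => [|p _]; last by rewrite subrr !mulr0.
  rewrite -!mulr_suml -!mulr_sumr sumrN sumrN -mulr_sumr -/(cotcosecS x) -/(cotS x) -/(A x); by field.
Qed.

(* The field [cotan2 (x j) * psi (A x)]; [cotan2_sub_mul] closes its interaction term. *)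
Lemma loop_cot :
  mean (fun x => W x * (- (A x * psi (A x)) / 2 - (cosec2S x - A x) * dpsi (A x)
    - beta / 4 * ((n%:R ^+ 2 + cotS x ^+ 2 - A x) * psi (A x))
    + beta * ((A x - n%:R) * psi (A x)))) = 0.
Proof.
pose v (j : 'I_n) x := cotan2 (x j) * psi (A x).
pose dv (j : 'I_n) x := - cosec2 (x j) / 2 * psi (A x) +
  cotan2 (x j) * - (dpsi (A x) * (cotan2 (x j) * cosec2 (x j))).
pose F x := - (A x * psi (A x)) / 2 - (cosec2S x - A x) * dpsi (A x)
    - beta / 4 * ((n%:R ^+ 2 + cotS x ^+ 2 - A x) * psi (A x))
    + beta * ((A x - n%:R) * psi (A x)).
apply: (@loop_field v dv (K + K) F).
- by move=> j; apply: measurable_funM => //; apply: measurable_at; exact: measurable_cotan2.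
- move=> j; apply: measurable_funD.
    apply: measurable_funM => //; apply: measurable_funM => //.
    by apply: measurable_funN; apply: measurable_at; exact: measurable_cosec2.
  by apply: measurable_funM => //; apply: measurable_at; exact: measurable_cotan2.
- by move=> j x k; rewrite /v periodic_cosecS (upd2piE _ _ _ (@cotan2_2pi R)).
- move=> j x rx; rewrite /v normrM.
  have A0 := cosecS_gt0 j rx.
  apply: (@le_trans _ _ (Num.sqrt (A x) * K)).
    by apply: ler_pM; rewrite ?cotan2_le_sqrt ?psi_le.
  by rewrite mulrC ler_wpM2r ?sqrtr_ge0// lerDl.
- move=> j x rx; rewrite /dv.
  rewrite (le_trans (ler_normD _ _))// [leRHS]mulrDl [leLHS]addrC; apply: lerD.
    rewrite normrM normrN (le_trans (ler_pM _ _ (cotan2_le_sqrt x j) (dpsi_cotcosec_le j rx)))//.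
    by rewrite [A x in leRHS]cosecS_sqrtE; apply: eq_ler; ring.
  exact: dcotan2_psi_le.
- move=> j x rx.
  have dB : is_derive (x j) 1 (fun u => cotan2 (upd x j u j)) (- cosec2 (x j) / 2).
    under eq_fun do rewrite upd_at; exact: is_derive_cotan2.
  have := is_derive_mul dB (is_derive_psi_upd j rx).
  by rewrite upd_id.
- move=> x rx sx.
  have w2 i : cotan2 (x i) ^+ 2 = cosec2 (x i) - 1.
    by rewrite (cosec2_cotan2 (rx i)) addrAC subrr add0r.
  have sw2 : \sum_i cotan2 (x i) ^+ 2 = A x - n%:R.
    by under eq_bigr do rewrite w2; rewrite big_split/= sumrN sumr_const card_ord.
  have E1 : \sum_j dv j x = - (A x * psi (A x)) / 2 - (cosec2S x - A x) * dpsi (A x).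
    rewrite /dv big_split/= -mulr_suml -mulr_suml sumrN -/(A x); congr (_ + _); first by field.
    transitivity (\sum_i (- dpsi (A x) * (cosec2 (x i) ^+ 2 - cosec2 (x i)))).
      apply: eq_bigr => i _.
      transitivity (- dpsi (A x) * (cotan2 (x i) ^+ 2 * cosec2 (x i))); first by ring.
      by rewrite w2; ring.
    by rewrite -mulr_sumr sumrB -/(cosec2S x) -/(A x); ring.
  have E2 : \sum_j v j x * cotan2 (x j) = (A x - n%:R) * psi (A x).
    by rewrite -sw2 mulr_suml; apply: eq_bigr => i _; rewrite /v; ring.
  have E3 : \sum_(p : 'I_n * 'I_n | (p.1 < p.2)%N)
      beta / 2 * (cotan2 (x p.1 - x p.2) * (v p.1 x - v p.2 x)) =
      - beta / 4 * ((n%:R ^+ 2 + cotS x ^+ 2 - A x) * psi (A x)).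
    transitivity (\sum_(p : 'I_n * 'I_n | (p.1 < p.2)%N)
       - beta / 2 * psi (A x) * (1 + cotan2 (x p.1) * cotan2 (x p.2))).
      apply: eq_bigr => p pp; rewrite /v -mulrBl [X in _ * X]mulrA cotan2_sub_mul//.
        by ring.
      by apply: sx; rewrite neq_ltn pp.
    rewrite -mulr_sumr (sum_lt_pairs (g := fun i k => 1 + cotan2 (x i) * cotan2 (x k))); last first.
      by move=> i k; rewrite [_ * cotan2 (x k)]mulrC.
    have -> : \sum_i \sum_k (1 + cotan2 (x i) * cotan2 (x k)) = n%:R ^+ 2 + cotS x ^+ 2.
      under eq_bigr do rewrite big_split/= sumr_const card_ord -mulr_sumr.
      by rewrite big_split/= sumr_const card_ord -mulr_suml -[_ *+ n]mulr_natl !expr2.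
    have -> : \sum_i (1 + cotan2 (x i) * cotan2 (x i)) = A x.
      by apply: eq_bigr => i _; rewrite (cosec2_cotan2 (rx i)).
    by field.
  by rewrite E1 E2 E3 /F; field.
Qed.

End degree_one.

(** * Fields cubic in the cotangent, brought down to its size by [psi] *)

Section degree_three.
Hypothesis psi_le : forall a : R, 0 < a -> `|a * psi a| <= K.
Hypothesis dpsi_le : forall a : R, 0 < a -> `|a ^+ 2 * dpsi a| <= K.

Let K0 : 0 <= K.
Proof. exact: le_trans (normr_ge0 _) (psi_le ltr01). Qed.

Let measurable_dcotcosec2_psi j :
  measurable_fun setT (fun x : n.-tuple R =>
    (- (3 / 2) * cosec2 (tnth x j) ^+ 2 + cosec2 (tnth x j)) * psi (A (tnth x))).
Proof.
apply: measurable_funM => //; apply: measurable_funD; last first.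
  by apply: measurable_at; exact: measurable_cosec2.
by apply: measurable_funM => //; apply: measurable_funX; apply: measurable_at; exact: measurable_cosec2.
Qed.

Lemma cosecS_dpsi_le x j : regular x ->
  `|dpsi (A x) * (cotan2 (x j) * cosec2 (x j))| * (Num.sqrt (A x) * A x) <= K * A x.
Proof.
move=> rx; have A0 := cosecS_gt0 j rx.
apply: (@le_trans _ _ (`|dpsi (A x)| * (Num.sqrt (A x) * A x) * (Num.sqrt (A x) * A x))).
  rewrite ler_wpM2r ?mulr_ge0 ?sqrtr_ge0 ?(ltW A0)// normrM.
  by rewrite ler_wpM2l// cotcosec_le.
have -> : `|dpsi (A x)| * (Num.sqrt (A x) * A x) * (Num.sqrt (A x) * A x) =
    `|A x ^+ 2 * dpsi (A x)| * (Num.sqrt (A x)) ^+ 2.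
  by rewrite normrM ger0_norm ?sqr_ge0//; ring.
by rewrite -cosecS_sqrtE ler_wpM2r ?(ltW A0)// dpsi_le.
Qed.

Lemma dcotcosec2_psi_le x j : regular x ->
  `|(- (3 / 2) * cosec2 (x j) ^+ 2 + cosec2 (x j)) * psi (A x)| <= 3 * K * A x.
Proof.
move=> rx; have A1 : 1 <= A x by exact: (regular_cosecS_ge1 j).
have A0 : 0 < A x by exact: lt_le_trans A1.
have c0 := cosec2_ge0 (x j); have cA := cosec2_le_cosecS x j.
apply: (@le_trans _ _ (3 * A x * (A x * `|psi (A x)|))).
  rewrite normrM mulrA ler_wpM2r//.
  have c2 : cosec2 (x j) ^+ 2 <= A x ^+ 2 by rewrite lerXn2r ?nnegrE// (ltW A0).
  have c20 := sqr_ge0 (cosec2 (x j)).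
  have AA : A x <= A x ^+ 2 by rewrite expr2 ler_peMl// ltW.
  rewrite -mulrA -expr2 ler_norml; apply/andP; split; lra.
rewrite -[X in X * `|_|](gtr0_norm A0) -normrM.
by rewrite [leRHS]mulrAC ler_wpM2l ?psi_le// mulr_ge0// ltW.
Qed.

(** Again a common rotation, now of speed [cotcosecS x * psi (A x)]: the pair interaction cancels,
    and the square of [cotcosecS] comes from differentiating [psi (A x)]. *)
Lemma loop_rotation_cotcosec :
  mean (fun x => W x * (beta * (cotS x * cotcosecS x * psi (A x))
    - 3 / 2 * (cosec2S x * psi (A x)) + A x * psi (A x)
    - cotcosecS x ^+ 2 * dpsi (A x))) = 0.
Proof.
pose v (j : 'I_n) x := cotcosecS x * psi (A x).
pose dv (j : 'I_n) x := (- (3 / 2) * cosec2 (x j) ^+ 2 + cosec2 (x j)) * psi (A x) +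
  cotcosecS x * - (dpsi (A x) * (cotan2 (x j) * cosec2 (x j))).
pose F x := beta * (cotS x * cotcosecS x * psi (A x))
    - 3 / 2 * (cosec2S x * psi (A x)) + A x * psi (A x)
    - cotcosecS x ^+ 2 * dpsi (A x).
have Dn x : `|cotcosecS x| <= n%:R * (Num.sqrt (A x) * A x).
  rewrite (le_trans (ler_norm_sum _ _ _))//.
  rewrite (le_trans (ler_sum _ (fun i _ => cotcosec_le x i)))//.
  by rewrite sumr_const card_ord mulr_natl.
apply: (@loop_field v dv (n%:R * K + 3 * K) F).
- by move=> j; apply: measurable_funM => //; exact: measurable_cotcosecS.
- move=> j; apply: measurable_funD => //.
  by apply: measurable_funM; first exact: measurable_cotcosecS.
- by move=> j x k; rewrite /v periodic_cotcosecS periodic_cosecS.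
- move=> j x rx; rewrite /v normrM.
  have A0 := cosecS_gt0 j rx.
  apply: (@le_trans _ _ (n%:R * (Num.sqrt (A x) * A x) * `|psi (A x)|)).
    by rewrite ler_wpM2r.
  have -> : n%:R * (Num.sqrt (A x) * A x) * `|psi (A x)| =
     n%:R * (`|A x * psi (A x)|) * Num.sqrt (A x).
    by rewrite normrM gtr0_norm//; ring.
  rewrite ler_wpM2r ?sqrtr_ge0// (le_trans (ler_wpM2l _ (psi_le A0)))// lerDl.
  by rewrite mulr_ge0.
- move=> j x rx; rewrite /dv.
  rewrite (le_trans (ler_normD _ _))// [leRHS]mulrDl [leLHS]addrC; apply: lerD.
    rewrite normrM normrN (le_trans (ler_wpM2r (normr_ge0 _) (Dn x)))//.
    rewrite -[leLHS]mulrA -[leRHS]mulrA ler_wpM2l// mulrC.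
    exact: cosecS_dpsi_le.
  exact: dcotcosec2_psi_le.
- move=> j x rx.
  have dB : is_derive (x j) 1 (fun u => cotcosecS (upd x j u))
      (- (3 / 2) * cosec2 (x j) ^+ 2 + cosec2 (x j)).
    by apply: (is_derive_sum_upd (f := fun t => cotan2 t * cosec2 t)); exact: is_derive_cotcosec2.
  have := is_derive_mul dB (is_derive_psi_upd j rx).
  by rewrite upd_id.
- move=> x rx sx; rewrite /F /v /dv big_split/=.
  rewrite [X in _ + (X + _)]big1 ?add0r => [|p _]; last by rewrite subrr !mulr0.
  rewrite -!mulr_suml -!mulr_sumr big_split/= sumrN -!mulr_sumr.
  rewrite -/(cotcosecS x) -/(cotS x) -/(A x) -/(cosec2S x); ring.
Qed.

(** The field [cotan2 * cosec2] is the cubic w + w^3 in the cotangent w. Its difference at two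
    angles is divisible by the difference of the cotangents, so that [cotan2_sub_mul] applies. *)
Lemma loop_cotcosec :
  mean (fun x => W x * ((7 / 4 * beta - 3 / 2) * (cosec2S x * psi (A x))
    - beta / 2 * (cotS x * cotcosecS x * psi (A x))
    - beta / 4 * (A x ^+ 2 * psi (A x)) - (3 / 2 * beta - 1) * (A x * psi (A x))
    - cot2cosec2S x * dpsi (A x))) = 0.
Proof.
pose v (j : 'I_n) x := cotan2 (x j) * cosec2 (x j) * psi (A x).
pose dv (j : 'I_n) x := (- (3 / 2) * cosec2 (x j) ^+ 2 + cosec2 (x j)) * psi (A x) +
  cotan2 (x j) * cosec2 (x j) * - (dpsi (A x) * (cotan2 (x j) * cosec2 (x j))).
pose F x := (7 / 4 * beta - 3 / 2) * (cosec2S x * psi (A x))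
    - beta / 2 * (cotS x * cotcosecS x * psi (A x))
    - beta / 4 * (A x ^+ 2 * psi (A x)) - (3 / 2 * beta - 1) * (A x * psi (A x))
    - cot2cosec2S x * dpsi (A x).
apply: (@loop_field v dv (K + 3 * K) F).
- by move=> j; apply: measurable_funM => //; exact: (measurable_at j measurable_cotcosec2).
- move=> j; apply: measurable_funD => //.
  by apply: measurable_funM => //; exact: (measurable_at j measurable_cotcosec2).
- by move=> j x k; rewrite /v periodic_cosecS (upd2piE _ _ _ (@cotan2_2pi R)) (upd2piE _ _ _ (@cosec2_2pi R)).
- move=> j x rx; rewrite /v normrM.
  have A0 := cosecS_gt0 j rx.
  apply: (@le_trans _ _ ((Num.sqrt (A x) * A x) * `|psi (A x)|)).
    by rewrite ler_wpM2r// cotcosec_le.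
  have -> : (Num.sqrt (A x) * A x) * `|psi (A x)| = `|A x * psi (A x)| * Num.sqrt (A x).
    by rewrite normrM gtr0_norm//; ring.
  rewrite ler_wpM2r ?sqrtr_ge0// (le_trans (psi_le A0))// lerDl.
  by rewrite mulr_ge0.
- move=> j x rx; rewrite /dv.
  rewrite (le_trans (ler_normD _ _))// [leRHS]mulrDl [leLHS]addrC; apply: lerD.
    rewrite normrM normrN (le_trans (ler_wpM2r (normr_ge0 _) (cotcosec_le x j)))//.
    by rewrite mulrC cosecS_dpsi_le.
  exact: dcotcosec2_psi_le.
- move=> j x rx.
  have dB : is_derive (x j) 1 (fun u => cotan2 (upd x j u j) * cosec2 (upd x j u j))
      (- (3 / 2) * cosec2 (x j) ^+ 2 + cosec2 (x j)).
    under eq_fun do rewrite upd_at; exact: is_derive_cotcosec2.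
  have := is_derive_mul dB (is_derive_psi_upd j rx).
  by rewrite upd_id.
- move=> x rx sx.
  have aE i : cosec2 (x i) = 1 + cotan2 (x i) ^+ 2 by exact: cosec2_cotan2.
  have w2 i : cotan2 (x i) ^+ 2 = cosec2 (x i) - 1 by rewrite aE addrAC subrr add0r.
  have E1 : \sum_j dv j x = - (3 / 2) * (cosec2S x * psi (A x)) + A x * psi (A x)
     - cot2cosec2S x * dpsi (A x).
    rewrite /dv big_split/= -mulr_suml big_split/= -mulr_sumr -/(A x) -/(cosec2S x).
    congr (_ + _); last by rewrite /cot2cosec2S mulr_suml -sumrN; apply: eq_bigr => i _; ring.
    ring.
  have E2 : \sum_j v j x * cotan2 (x j) = (cosec2S x - A x) * psi (A x).
    rewrite -sumrB mulr_suml; apply: eq_bigr => i _; rewrite /v.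
    transitivity (cotan2 (x i) ^+ 2 * cosec2 (x i) * psi (A x)); first by ring.
    by rewrite w2; ring.
  have E3 : \sum_(p : 'I_n * 'I_n | (p.1 < p.2)%N)
      beta / 2 * (cotan2 (x p.1 - x p.2) * (v p.1 x - v p.2 x)) =
      - (beta / 2) * ((cotS x * cotcosecS x - 3 / 2 * cosec2S x + A x + A x ^+ 2 / 2) * psi (A x)).
    (* [g] is 1 + w_i w_k times the quotient of the cubics, rewritten so that its double sum splits
       into products of [cotS], [cotcosecS] and [cosecS]. *)
    pose g i k := cotan2 (x i) * cotan2 (x k) * (cosec2 (x i) + cosec2 (x k)) +
      cosec2 (x i) * cosec2 (x k).
    transitivity (\sum_(p : 'I_n * 'I_n | (p.1 < p.2)%N)
       - (beta / 2) * psi (A x) * g p.1 p.2).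
      apply: eq_bigr => p pp; rewrite /v -mulrBl.
      have -> : cotan2 (x p.1) * cosec2 (x p.1) - cotan2 (x p.2) * cosec2 (x p.2) =
         (cotan2 (x p.1) - cotan2 (x p.2)) * (1 + cotan2 (x p.1) ^+ 2 +
           cotan2 (x p.1) * cotan2 (x p.2) + cotan2 (x p.2) ^+ 2).
        by rewrite !aE; ring.
      rewrite -[X in _ * (_ * X)]mulrA [X in _ * X]mulrA cotan2_sub_mul//; last first.
        by apply: sx; rewrite neq_ltn pp.
      by rewrite /g !aE; ring.
    rewrite -mulr_sumr (sum_lt_pairs (g := g)); last by move=> i k; rewrite /g; ring.
    have -> : \sum_i \sum_k g i k = 2 * (cotS x * cotcosecS x) + A x ^+ 2.
      transitivity (\sum_i (cotan2 (x i) * cosec2 (x i) * cotS x + cotan2 (x i) * cotcosecS x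
         + cosec2 (x i) * A x)).
        apply: eq_bigr => i _; rewrite !mulr_sumr -!big_split/=.
        by apply: eq_bigr => k _; rewrite /g; ring.
      by rewrite !big_split/= -!mulr_suml -/(cotcosecS x) -/(cotS x) -/(A x); ring.
    have -> : \sum_i g i i = 3 * cosec2S x - 2 * A x.
      rewrite !mulr_sumr -sumrB; apply: eq_bigr => i _; rewrite /g.
      transitivity (2 * cotan2 (x i) ^+ 2 * cosec2 (x i) + cosec2 (x i) ^+ 2); first by ring.
      by rewrite w2; ring.
    by field.
  by rewrite E1 E2 E3 /F; field.
Qed.

End degree_three.
End fields.
End loop_equations.

(** * Moments of the cosecant sums *)

Section weighted_mean.
Context {R : realType} (beta : R) (n : nat).
Implicit Types (x : 'I_n -> R) (f g : ('I_n -> R) -> R).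
Local Notation W := (@weight R beta n).
Local Notation A := (@cosecS R n).
Hypothesis beta_gt : 3 / 2 < beta.
Hypothesis n_gt0 : (0 < n)%N.

(** Not normalised: positivity of the total mass is obtained later, for large [n], from the assumed
    limit, so the division is postponed. *)
Definition wmean f : R := \int[torus_prob R n]_x (W (tnth x) * f (tnth x)).

(** A class of observables whose product with the weight is bounded: [radial] absorbs one factor
    [cosecS]. *)
Definition admissible f := measurable_fun setT (tuple_fun f) /\
  exists K, forall x, regular x -> `|f x| <= K * A x.

Lemma admissible_bounded f : admissible f ->
  bounded_mfun (fun x : n.-tuple R => W (tnth x) * f (tnth x)).
Proof. by move=> [mf [K fK]]; exact: bounded_weight_mul fK. Qed.

Lemma A_ge1 x : regular x -> 1 <= A x.
Proof. exact: (regular_cosecS_ge1 (Ordinal n_gt0)). Qed.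

Lemma admissible_le f g (K : R) : measurable_fun setT (tuple_fun f) -> admissible g ->
  (forall x, regular x -> `|f x| <= K * `|g x|) -> admissible f.
Proof.
move=> mf [mg [L gL]] fg; split=> //; exists (`|K| * `|L|) => x rx.
rewrite (le_trans (fg x rx))// -mulrA.
apply: (@le_trans _ _ (`|K| * `|g x|)); first by rewrite ler_wpM2r// ler_norm.
by rewrite ler_wpM2l// (le_trans (gL x rx))// ler_wpM2r ?cosecS_ge0// ler_norm.
Qed.

Lemma admissible_cst (c : R) : admissible (fun=> c).
Proof.
split=> //; exists `|c| => x rx; by rewrite ler_peMr// A_ge1.
Qed.

Lemma admissibleA : admissible A.
Proof.
split; first exact: measurable_cosecS.
by exists 1 => x rx; rewrite mul1r ger0_norm ?cosecS_ge0.
Qed.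

Lemma admissibleD f g : admissible f -> admissible g -> admissible (fun x => f x + g x).
Proof.
move=> [mf [K fK]] [mg [L gL]]; split; first exact: measurable_funD.
by exists (K + L) => x rx; rewrite (le_trans (ler_normD _ _))// mulrDl lerD ?fK ?gL.
Qed.

Lemma admissibleZ (c : R) f : admissible f -> admissible (fun x => c * f x).
Proof.
move=> [mf [K fK]]; split; first exact: measurable_funM.
by exists (`|c| * K) => x rx; rewrite normrM -mulrA ler_wpM2l ?fK.
Qed.

Lemma admissibleN f : admissible f -> admissible (fun x => - f x).
Proof. by move=> /(admissibleZ (-1)); under eq_fun do rewrite mulN1r. Qed.

Lemma admissibleB f g : admissible f -> admissible g -> admissible (fun x => f x - g x).
Proof. by move=> af ag; apply: admissibleD => //; exact: admissibleN. Qed.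

Lemma wmean_le f g : admissible f -> admissible g ->
  (forall x, regular x -> f x <= g x) -> wmean f <= wmean g.
Proof.
move=> af ag fg; apply: bounded_le_Rintegral; try exact: admissible_bounded.
move=> y; have [rx|rx] := pselect (regular (tnth y)).
  by rewrite ler_wpM2l ?weight_ge0// fg.
by rewrite (not_regular_weight beta_gt)// !mul0r.
Qed.

Lemma wmeanD f g : admissible f -> admissible g ->
  wmean (fun x => f x + g x) = wmean f + wmean g.
Proof.
move=> af ag; rewrite /wmean -bounded_RintegralD; try exact: admissible_bounded.
by apply: eq_Rintegral => y _; rewrite mulrDr.
Qed.

Lemma wmeanZ (c : R) f : admissible f -> wmean (fun x => c * f x) = c * wmean f.
Proof.
move=> af; rewrite /wmean -bounded_RintegralZ; last exact: admissible_bounded.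
by apply: eq_Rintegral => y _; rewrite mulrCA.
Qed.

Lemma wmeanN f : admissible f -> wmean (fun x => - f x) = - wmean f.
Proof.
move=> af; rewrite -mulN1r -wmeanZ//; congr wmean.
by apply/funext => x; rewrite mulN1r.
Qed.

Lemma wmeanB f g : admissible f -> admissible g ->
  wmean (fun x => f x - g x) = wmean f - wmean g.
Proof. by move=> af ag; rewrite wmeanD ?wmeanN//; exact: admissibleN. Qed.

Lemma wmean_cst (c : R) : wmean (fun=> c) = c * wmean (fun=> 1).
Proof. by rewrite -wmeanZ; [rewrite mulr1|exact: admissible_cst]. Qed.

Lemma wmean_ge0 f : (forall x, regular x -> 0 <= f x) -> 0 <= wmean f.
Proof.
move=> f0; apply: Rintegral_ge0 => y _.
have [rx|rx] := pselect (regular (tnth y)); first by rewrite mulr_ge0 ?weight_ge0 ?f0.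
by rewrite (not_regular_weight beta_gt)// mul0r.
Qed.

Lemma wmean_norm_le f g : admissible f -> admissible g ->
  (forall x, regular x -> `|f x| <= g x) -> `|wmean f| <= wmean g.
Proof.
move=> af ag fg; rewrite ler_norml -wmeanN//; apply/andP; split.
  apply: wmean_le => //; first exact: admissibleN.
  by move=> x rx; have := fg x rx; rewrite ler_norml => /andP[].
by apply: wmean_le => // x rx; exact: le_trans (ler_norm _) (fg x rx).
Qed.

Lemma cosec2S_ge x : regular x -> A x <= cosec2S x.
Proof.
move=> rx; apply: ler_sum => i _; rewrite expr2 ler_peMl ?cosec2_ge0//.
by rewrite cosec2_cotan2// lerDl sqr_ge0.
Qed.

(** With B for [cotS] and D for [cotcosecS], this is the arithmetic-geometric inequality for A B^2
    and D^2 / A, followed by D^2 <= A^3 from [cotcosecS_sqr_le]. *)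
Lemma cotS_cotcosecS_le x : regular x ->
  `|cotS x * cotcosecS x| <= (A x * cotS x ^+ 2 + A x ^+ 2) / 2.
Proof.
move=> rx; have A0 : 0 < A x by rewrite (lt_le_trans ltr01)// A_ge1.
have := cotcosecS_sqr_le x.
set B := cotS x; set D := cotcosecS x; set a := A x in A0 * => D2.
have D2' : D ^+ 2 / a <= a ^+ 2 by rewrite ler_pdivrMr// -exprSr.
have h1 : 0 <= a * (B - D / a) ^+ 2 by rewrite mulr_ge0 ?sqr_ge0// ltW.
have h2 : 0 <= a * (B + D / a) ^+ 2 by rewrite mulr_ge0 ?sqr_ge0// ltW.
have E1 : a * (B - D / a) ^+ 2 = a * B ^+ 2 + D ^+ 2 / a - 2 * (B * D).
  by field; rewrite gt_eqF.
have E2 : a * (B + D / a) ^+ 2 = a * B ^+ 2 + D ^+ 2 / a + 2 * (B * D).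
  by field; rewrite gt_eqF.
rewrite ler_norml; apply/andP; split; lra.
Qed.

Lemma cotS_sqr_le x : cotS x ^+ 2 <= n%:R ^+ 2 * A x.
Proof.
rewrite -[leLHS]real_normK ?num_real// [A x]cosecS_sqrtE -exprMn.
by rewrite lerXn2r ?nnegrE ?mulr_ge0 ?sqrtr_ge0// cotS_le.
Qed.

(** * Truncated powers of [cosecS] *)

Section truncation.
Variables (s : R).
Hypothesis s_gt0 : 0 < s.

Let trunc (a : R) := a / (1 + s * a).

(* [a `^ r] truncated at scale [s^-1], since [A `^ (1 + r)] is not known to be
   integrable beforehand. *)
Definition truncpow (r a : R) : R := trunc a `^ r.
Definition dtruncpow (r a : R) : R := r * truncpow r a / (a * (1 + s * a)).

Let den_gt0 a : 0 < a -> 0 < 1 + s * a.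
Proof. by move=> a0; rewrite addr_gt0 ?mulr_gt0. Qed.

Let trunc_gt0 a : 0 < a -> 0 < trunc a.
Proof. by move=> a0; rewrite divr_gt0 ?den_gt0. Qed.

Let trunc_le a : 0 < a -> trunc a <= a.
Proof.
move=> a0; rewrite ler_pdivrMr ?den_gt0// ler_peMr ?(ltW a0)//.
by rewrite lerDl mulr_ge0 ?(ltW a0) ?(ltW s_gt0).
Qed.

Let trunc_leV a : 0 < a -> s * trunc a <= 1.
Proof.
by move=> a0; rewrite mulrA ler_pdivrMr ?den_gt0// mul1r lerDr.
Qed.

Lemma truncpow_ge0 r a : 0 <= truncpow r a. Proof. exact: powR_ge0. Qed.

Lemma is_derive_truncpow r (a : R) : 0 < a -> is_derive a 1 (truncpow r) (dtruncpow r a).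
Proof.
move=> a0; have d0 := den_gt0 a0.
have dd : is_derive a 1 (fun u => 1 + s * u) s.
  have := is_derive_add (is_derive_const 1 a)
    (is_derive_mul (is_derive_const s a) (is_derive_id a 1)).
  by rewrite mul0r mulr1 !add0r.
have dt := is_derive_mul (is_derive_id a 1) (is_deriveV (f := fun u => 1 + s * u) (lt0r_neq0 d0) dd).
have := is_derive_compose (f := fun y => y `^ r) (g := trunc) (is_derive1_powR r (trunc_gt0 a0)) dt.
move=> h; apply: (is_derive_eq h).
rewrite powRB; last by rewrite (gt_eqF (trunc_gt0 a0)) implybT.
rewrite powRr1 ?(ltW (trunc_gt0 a0))// /dtruncpow /truncpow /GRing.scale /=.
set y := _ `^ r; rewrite /trunc.
by field; rewrite !gt_eqF.
Qed.

Lemma truncpow_bound r a : 0 <= r -> 0 < a -> truncpow r a <= s^-1 `^ r.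
Proof.
move=> r0 a0; apply: ge0_ler_powR; rewrite ?nnegrE ?invr_ge0 ?(ltW s_gt0) ?(ltW (trunc_gt0 a0))//.
by rewrite -(ler_pM2l s_gt0) mulfV ?gt_eqF// trunc_leV.
Qed.

Lemma dtruncpow_ge0 r a : 0 <= r -> 0 < a -> 0 <= dtruncpow r a.
Proof.
by move=> r0 a0; rewrite divr_ge0 ?mulr_ge0 ?truncpow_ge0 ?(ltW a0)// ltW ?den_gt0.
Qed.

(** The truncation keeps the differential inequality of the pure power, which makes the constant of
    the moment bound independent of [s]. *)
Lemma dtruncpow_le r a : 0 <= r -> 0 < a -> a * dtruncpow r a <= r * truncpow r a.
Proof.
move=> r0 a0; have d0 := den_gt0 a0.
rewrite (_ : a * _ = r * truncpow r a / (1 + s * a)); last first.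
  by rewrite /dtruncpow; field; rewrite !gt_eqF.
rewrite ler_pdivrMr// ler_peMr ?mulr_ge0 ?truncpow_ge0//.
by rewrite lerDl mulr_ge0 ?(ltW a0) ?(ltW s_gt0).
Qed.

Lemma measurable_truncpow r : measurable_fun setT (tuple_fun (fun x => truncpow r (A x))).
Proof.
apply: (measurableT_comp (measurable_powR _)).
apply: measurable_funM; first exact: measurable_cosecS.
apply: measurable_inv_ge0 => [x|].
  by rewrite addr_ge0// mulr_ge0 ?cosecS_ge0// ltW.
apply: measurable_funD => //; apply: measurable_funM => //; exact: measurable_cosecS.
Qed.

Lemma measurable_dtruncpow r : measurable_fun setT (tuple_fun (fun x => dtruncpow r (A x))).
Proof.
apply: measurable_funM.
  by apply: measurable_funM => //; exact: measurable_truncpow.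
apply: measurable_inv_ge0 => [x|].
  by rewrite mulr_ge0 ?cosecS_ge0// addr_ge0// mulr_ge0 ?cosecS_ge0// ltW.
apply: measurable_funM; first exact: measurable_cosecS.
apply: measurable_funD => //; apply: measurable_funM => //; exact: measurable_cosecS.
Qed.

Lemma admissible_truncpow r : 0 <= r -> admissible (fun x => truncpow r (A x)).
Proof.
move=> r0; apply: (admissible_le (K := 1) (measurable_truncpow r) (admissible_cst (s^-1 `^ r))).
move=> x rx; rewrite mul1r !ger0_norm ?powR_ge0// truncpow_bound//.
by rewrite (lt_le_trans ltr01)// A_ge1.
Qed.

Lemma admissible_A_truncpow r : 0 <= r -> admissible (fun x => A x * truncpow r (A x)).
Proof.
move=> r0; apply: (admissible_le (K := s^-1 `^ r) _ admissibleA).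
  by apply: measurable_funM; [exact: measurable_cosecS|exact: measurable_truncpow].
move=> x rx; rewrite normrM mulrC ler_wpM2r// ger0_norm ?powR_ge0// truncpow_bound//.
by rewrite (lt_le_trans ltr01)// A_ge1.
Qed.

Lemma admissible_cot2_truncpow r : 0 <= r -> admissible (fun x => cotS x ^+ 2 * truncpow r (A x)).
Proof.
move=> r0; apply: (admissible_le (K := n%:R ^+ 2) _ (admissible_A_truncpow r0)).
  apply: measurable_funM; last exact: measurable_truncpow.
  by apply: measurable_funX; exact: measurable_cotS.
move=> x rx; rewrite (normrM (cotS x ^+ 2)) (normrM (A x)) mulrA ler_wpM2r// ger0_norm ?sqr_ge0//.
by rewrite ger0_norm ?cosecS_ge0// cotS_sqr_le.
Qed.

Lemma measurable_cot2 : measurable_fun setT (tuple_fun (fun x => cotS x ^+ 2)).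
Proof. by apply: measurable_funX; exact: measurable_cotS. Qed.

(** * The moment of order [1 + r] *)

Section moment.
Variable r : R.
Hypothesis r_ge0 : 0 <= r.
Hypothesis r_lt : r < beta - 2^-1.

Let psi_le (a : R) : 0 < a -> `|truncpow r a| <= (1 + r) * s^-1 `^ r.
Proof.
move=> a0; rewrite ger0_norm ?truncpow_ge0// (le_trans (truncpow_bound r_ge0 a0))//.
by rewrite ler_peMl ?powR_ge0// lerDl.
Qed.

Let dpsi_le (a : R) : 0 < a -> `|a * dtruncpow r a| <= (1 + r) * s^-1 `^ r.
Proof.
move=> a0; rewrite ger0_norm; last by rewrite mulr_ge0 ?(ltW a0)// dtruncpow_ge0.
rewrite (le_trans (dtruncpow_le r_ge0 a0))//.
apply: ler_pM; rewrite ?truncpow_ge0 ?truncpow_bound//.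
by rewrite lerDr.
Qed.

Let psi x := truncpow r (A x).
Let dpsi x := dtruncpow r (A x).
Let A0 x : regular x -> 0 < A x := cosecS_gt0 (Ordinal n_gt0).

Let BD_le x : regular x ->
  `|cotS x * cotcosecS x * dpsi x| <= r / 2 * (cotS x ^+ 2 * psi x + A x * psi x).
Proof.
move=> rx; have a0 := A0 rx; have := cotS_cotcosecS_le rx => h.
have dp0 := dtruncpow_ge0 r_ge0 a0; have dp1 := dtruncpow_le r_ge0 a0.
rewrite normrM [`|dpsi x|]ger0_norm//.
apply: (le_trans (ler_wpM2r dp0 h)).
rewrite [leLHS](_ : _ = (cotS x ^+ 2 + A x) / 2 * (A x * dtruncpow r (A x))); last by rewrite /dpsi; field.
rewrite [leRHS](_ : _ = (cotS x ^+ 2 + A x) / 2 * (r * truncpow r (A x))); last by rewrite /psi; field.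
by rewrite ler_wpM2l// divr_ge0// addr_ge0 ?sqr_ge0 ?(ltW a0).
Qed.

Let P2_le x : regular x -> 0 <= (cosec2S x - A x) * dpsi x <= r * (A x * psi x).
Proof.
move=> rx; have a0 := A0 rx.
have dp0 := dtruncpow_ge0 r_ge0 a0; have dp1 := dtruncpow_le r_ge0 a0.
have h1 := cosec2S_ge rx; have h2 := cosec2S_le x.
rewrite mulr_ge0 ?subr_ge0//=.
apply: (@le_trans _ _ (A x ^+ 2 * dpsi x)).
  by rewrite ler_wpM2r// (le_trans _ h2)// gerBl ltW.
by rewrite expr2 -mulrA [leRHS]mulrCA ler_wpM2l// ltW.
Qed.

Let aB2 := admissible_cot2_truncpow r_ge0.
Let aA := admissible_A_truncpow r_ge0.
Let apsi := admissible_truncpow r_ge0.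

Let aBD : admissible (fun x => cotS x * cotcosecS x * dpsi x).
Proof.
apply: (admissible_le (K := r / 2) (g := fun x => cotS x ^+ 2 * psi x + A x * psi x)).
- apply: measurable_funM; last exact: measurable_dtruncpow.
  by apply: measurable_funM; [exact: measurable_cotS|exact: measurable_cotcosecS].
- exact: admissibleD.
- move=> x rx; rewrite [X in _ <= _ * X]ger0_norm ?BD_le//.
  by rewrite addr_ge0// mulr_ge0 ?sqr_ge0 ?powR_ge0 ?cosecS_ge0.
Qed.

Let aP2 : admissible (fun x => (cosec2S x - A x) * dpsi x).
Proof.
apply: (admissible_le (K := r) (g := fun x => A x * psi x)) => //.
- apply: measurable_funM; last exact: measurable_dtruncpow.
  by apply: measurable_funB; [exact: measurable_cosec2S|exact: measurable_cosecS].
- move=> x rx; have /andP[h1 h2] := P2_le rx.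
  by rewrite ger0_norm// [X in _ <= _ * X]ger0_norm ?h2// mulr_ge0 ?powR_ge0 ?cosecS_ge0.
Qed.

Let X := wmean (fun x => cotS x ^+ 2 * psi x).
Let Y := wmean (fun x => A x * psi x).

(** The rotation equation reads beta X - Y / 2 = E with |E| <= r (X + Y) / 2, hence (beta - r / 2) X
    <= (1 + r) Y / 2. The factor on the right is at most the one on the left exactly when r <= beta
    - 1/2. *)
Lemma wmean_cot2_truncpow_le : X <= Y.
Proof.
have h := loop_rotation_cot beta_gt (measurable_truncpow r) (measurable_dtruncpow r)
  (fun a a0 => is_derive_truncpow r a0) psi_le dpsi_le.
have {h} h : beta * X - 2^-1 * Y - wmean (fun x => cotS x * cotcosecS x * dpsi x) = 0.
  rewrite -h /X /Y -!wmeanZ// -!wmeanB//; try exact: admissibleZ.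
    by apply: eq_Rintegral => y _; congr (_ * _); rewrite /psi /dpsi; field.
  by apply: admissibleB => //; exact: admissibleZ.
have h2 : `|wmean (fun x => cotS x * cotcosecS x * dpsi x)| <= r / 2 * (X + Y).
  rewrite /X /Y -wmeanD// -wmeanZ; last exact: admissibleD.
  by apply: wmean_norm_le; [exact: aBD|exact: (admissibleZ _ (admissibleD aB2 aA))|exact: BD_le].
move: h2; rewrite ler_norml => /andP[_ h2].
have Y0 : 0 <= Y.
  by apply: wmean_ge0 => x rx; rewrite mulr_ge0 ?powR_ge0 ?cosecS_ge0.
have k0 : 0 < beta - r / 2 by have := beta_gt; have := r_lt; lra.
rewrite -(ler_pM2l k0); apply: (@le_trans _ _ ((1 + r) / 2 * Y)).
  by have := h; have := h2; lra.
by rewrite ler_wpM2r//; have := r_lt; lra.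
Qed.

(** Twice the constant of [wmean_A_truncpow_le0], so that half of [Y] can be absorbed in
    [wmean_A_truncpow_le]. It blows up at the integrability threshold r = beta - 1/2. *)
Definition moment_const := 5 * beta / (2 * (beta - 2^-1 - r)) * n%:R ^+ 2.

(** In [loop_cot] the derivative of the truncation takes at most [r * Y], and [X <= Y] takes
    [beta / 4 * Y]. This leaves [(beta - 2^-1 - r) * Y] against [5 / 4 * beta * n%:R ^+ 2] times the
    mean of [psi]. *)
Lemma wmean_A_truncpow_le0 :
  Y <= moment_const / 2 * wmean (fun x => psi x).
Proof.
have h := loop_cot beta_gt (measurable_truncpow r) (measurable_dtruncpow r)
  (fun a a0 => is_derive_truncpow r a0) psi_le dpsi_le.
have XY := wmean_cot2_truncpow_le.
set V := wmean (fun x => psi x).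
have V0 : 0 <= V by apply: wmean_ge0 => x rx; exact: powR_ge0.
have Y0 : 0 <= Y.
  by apply: wmean_ge0 => x rx; rewrite mulr_ge0 ?powR_ge0 ?cosecS_ge0.
have {}h : (5 / 4 * beta - 2^-1) * Y - wmean (fun x => (cosec2S x - A x) * dpsi x)
    - beta / 4 * X - (beta / 4 * n%:R ^+ 2 + beta * n%:R) * V = 0.
  rewrite -h /X /Y /V -!wmeanZ//.
  rewrite -!wmeanB//; try exact: admissibleZ.
  - by apply: eq_Rintegral => y _; congr (_ * _); rewrite /psi /dpsi; field.
  - exact: admissibleB (admissibleB (admissibleZ _ aA) aP2) (admissibleZ _ aB2).
  - exact: admissibleB (admissibleZ _ aA) aP2.
have h2 : wmean (fun x => (cosec2S x - A x) * dpsi x) <= r * Y.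
  rewrite /Y -wmeanZ//; apply: wmean_le => //; first exact: admissibleZ.
  by move=> x rx; have /andP[] := P2_le rx.
have n1 : 1 <= n%:R :> R by rewrite ler1n.
have k0 : 0 < beta - 2^-1 - r by have := r_lt; lra.
have b0 : 0 < beta by have := beta_gt; lra.
have nn : n%:R <= n%:R ^+ 2 :> R by rewrite expr2 ler_peMl// (le_trans ler01).
have h3 : (beta / 4 * n%:R ^+ 2 + beta * n%:R) * V <= 5 / 4 * beta * n%:R ^+ 2 * V.
  rewrite ler_wpM2r//.
  have := ler_wpM2l (ltW b0) nn; lra.
have h4 : beta / 4 * X <= beta / 4 * Y by rewrite ler_wpM2l// divr_ge0// ltW.
rewrite -(ler_pM2l k0).
have -> : (beta - 2^-1 - r) * (moment_const / 2 * V) = 5 / 4 * beta * n%:R ^+ 2 * V.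
  rewrite /moment_const; move: k0; move: (beta - 2^-1 - r) => k k0.
  by field; rewrite gt_eqF.
have := h; have := h2; have := h3; have := h4; lra.
Qed.

Lemma moment_const_gt0 : 0 < moment_const.
Proof.
have k0 : 0 < beta - 2^-1 - r by have := r_lt; lra.
have b0 : 0 < beta by have := beta_gt; lra.
by rewrite mulr_gt0 ?exprn_gt0 ?ltr0n// divr_gt0 ?mulr_gt0.
Qed.

Lemma wmean_A_truncpow_le :
  Y <= moment_const * moment_const `^ r * wmean (fun=> 1).
Proof.
move: moment_const_gt0 wmean_A_truncpow_le0; move: moment_const => T T0 h.
(* Where [T <= A x] the half of [A x * psi x] dominates; elsewhere [psi x] is at most T^r. *)
have h2 : T / 2 * wmean (fun x => psi x) <=
    wmean (fun x => 2^-1 * (A x * psi x) + T / 2 * T `^ r).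
  rewrite -wmeanZ//; apply: wmean_le; first exact: admissibleZ.
    by apply: admissibleD; [exact: admissibleZ|exact: admissible_cst].
  move=> x rx; have a0 := A0 rx.
  have [TA|AT] := leP T (A x).
    rewrite ler_wpDr ?mulr_ge0 ?powR_ge0 ?invr_ge0 ?(ltW T0)//.
    have := ler_wpM2r (truncpow_ge0 r (A x)) TA; rewrite /psi; lra.
  rewrite ler_wpDl ?mulr_ge0 ?powR_ge0 ?invr_ge0 ?(ltW a0)//.
  rewrite ler_wpM2l ?divr_ge0 ?(ltW T0)//.
  apply: ge0_ler_powR; rewrite ?nnegrE ?(ltW T0) ?(ltW (trunc_gt0 a0))//.
  exact: le_trans (trunc_le a0) (ltW AT).
rewrite wmeanD in h2; [|exact: admissibleZ|exact: admissible_cst].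
rewrite (wmeanZ _ aA) wmean_cst -/Y in h2.
have := le_trans h h2; set Z := wmean _; lra.
Qed.

End moment.
End truncation.

(** With [psi] constant the derivative terms disappear: the rotation equation expresses the mean of
    [cotS ^+ 2] through that of [A], and [loop_cot] closes exactly, without error in [n]. *)
Lemma wmean_A : (5 / 4 * beta - 5 / 8) * wmean A =
  (beta / 4 * n%:R ^+ 2 + beta * n%:R) * wmean (fun=> 1).
Proof.
have d1 (a : R) : 0 < a -> is_derive a 1 (fun _ : R => 1 : R) 0 by move=> _; exact: is_derive_const.
have k1 (a : R) : 0 < a -> `|1 : R| <= 1 by rewrite normr1.
have k2 (a : R) : 0 < a -> `|a * 0 : R| <= 1 by rewrite mulr0 normr0 ler01.
have m1 (c : R) : measurable_fun setT (tuple_fun (fun _ : 'I_n -> R => c)).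
  exact: measurable_cst.
have aB : admissible (fun x => cotS x ^+ 2).
  apply: (admissible_le (K := n%:R ^+ 2) _ admissibleA).
    exact: measurable_cot2.
  by move=> x rx; rewrite !ger0_norm ?sqr_ge0 ?cosecS_ge0// cotS_sqr_le.
have a1 := admissible_cst 1.
have e1 := loop_rotation_cot beta_gt (m1 1) (m1 0) d1 k1 k2.
have e2 := loop_cot beta_gt (m1 1) (m1 0) d1 k1 k2.
have {}e1 : beta * wmean (fun x => cotS x ^+ 2) - 2^-1 * wmean A = 0.
  rewrite -e1 -(wmeanZ beta aB) -(wmeanZ _ admissibleA) -wmeanB//; try exact: admissibleZ.
    by apply: eq_Rintegral => y _; congr (_ * _); field.
  by apply: admissibleZ; exact: admissibleA.
have {}e2 : (5 / 4 * beta - 2^-1) * wmean A - beta / 4 * wmean (fun x => cotS x ^+ 2)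
   - (beta / 4 * n%:R ^+ 2 + beta * n%:R) * wmean (fun=> 1) = 0.
  have aZ := admissibleZ _ admissibleA.
  rewrite -e2 -(wmeanZ _ aB) -(wmeanZ _ admissibleA) -(wmeanZ _ a1).
  rewrite -!wmeanB//; try exact: admissibleZ.
    by apply: eq_Rintegral => y _; congr (_ * _); field.
  by apply: admissibleB => //; exact: admissibleZ.
have := e1; have := e2; lra.
Qed.

End weighted_mean.

(** * The second-order means *)

Section second_moment.
Context {R : realType} (beta : R) (n : nat).
Implicit Types (x : 'I_n -> R) (a : R).
Local Notation A := (@cosecS R n).
Hypothesis beta_gt : 3 / 2 < beta.
Hypothesis n_gt0 : (0 < n)%N.
Variables (s r : R).
Hypothesis s_gt0 : 0 < s.
Hypothesis r_ge1 : 1 <= r.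
Hypothesis r_le2 : r <= 2.
Hypothesis r_lt : r < beta - 2^-1.

(* The loop equations apply to observables that are [O(A)] only, whence a cutoff in
   front of quantities of size [A ^ 2]. *)
Definition cutoff (a : R) : R := ((1 + s * a) ^+ 2)^-1.
Definition dcutoff (a : R) : R := - 2 * s * ((1 + s * a) ^+ 3)^-1.

Local Notation wmean := (@wmean R beta n).
Local Notation admissible := (@admissible R n).
Local Notation psi := (truncpow s r).
Local Notation T := (@moment_const R beta n r).
Local Notation Z := (wmean (fun=> 1)).

Let r_ge0 : 0 <= r. Proof. by have := r_ge1; lra. Qed.

Let den_gt0 a : 0 < a -> 0 < 1 + s * a.
Proof. by move=> a0; rewrite addr_gt0 ?mulr_gt0. Qed.

Let den_ge1 a : 0 < a -> 1 <= 1 + s * a.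
Proof. by move=> a0; rewrite lerDl mulr_ge0 ?(ltW s_gt0) ?(ltW a0). Qed.

Let sa_gt0 a : 0 < a -> 0 < s * a. Proof. by move=> a0; rewrite mulr_gt0. Qed.

Lemma is_derive_cutoff a : 0 < a -> is_derive a 1 cutoff (dcutoff a).
Proof.
move=> a0; have d0 := den_gt0 a0.
have dd : is_derive a 1 (fun u : R => 1 + s * u) s.
  have := is_derive_add (is_derive_const 1 a)
    (is_derive_mul (is_derive_const s a) (is_derive_id a 1)).
  by rewrite mul0r mulr1 !add0r.
have d20 : (1 + s * a) ^+ 2 != 0 by rewrite lt0r_neq0// exprn_gt0.
have h := is_deriveV (f := fun u => (1 + s * u) ^+ 2) d20 (is_derive_mul dd dd).
by apply: (is_derive_eq h); rewrite /dcutoff /GRing.scale /=; field; rewrite gt_eqF.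
Qed.

Lemma is_derive_id_cutoff a : 0 < a ->
  is_derive a 1 (fun u => u * cutoff u) (cutoff a + a * dcutoff a).
Proof.
by move=> a0; have := is_derive_mul (is_derive_id a 1) (is_derive_cutoff a0); rewrite mul1r.
Qed.

Lemma cutoff_gt0 a : 0 < a -> 0 < cutoff a.
Proof. by move=> a0; rewrite invr_gt0 exprn_gt0// den_gt0. Qed.

Lemma dcutoff_le a : 0 < a -> `|dcutoff a| <= 2 * s * cutoff a.
Proof.
move=> a0; have d0 := den_gt0 a0.
rewrite /dcutoff !mulNr normrN ger0_norm; last first.
  by rewrite mulr_ge0 ?invr_ge0 ?exprn_ge0 ?(ltW d0)// mulr_ge0// ltW.
rewrite ler_wpM2l ?mulr_ge0 ?(ltW s_gt0)// lef_pV2 ?posrE ?exprn_gt0//.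
by rewrite [leRHS]exprS ler_peMl ?exprn_ge0 ?(ltW d0)// den_ge1.
Qed.

(** With y = a / (1 + s a) the left side is s y^2 = s^(r - 1) y^r (s y)^(2 - r), and s y <= 1; here
    [r <= 2] enters. For r > 1 the factor s^(r - 1) makes the cutoff errors small. *)
Lemma sqr_cutoff_le a : 0 < a -> s * (a ^+ 2 * cutoff a) <= s `^ (r - 1) * psi a.
Proof.
move=> a0; have d0 := den_gt0 a0.
pose y := a / (1 + s * a).
have y0 : 0 < y by rewrite divr_gt0.
have sy1 : s * y <= 1 by rewrite mulrA ler_pdivrMr// mul1r lerDr.
have sy0 : 0 < s * y by rewrite mulr_gt0.
have -> : a ^+ 2 * cutoff a = y ^+ 2 by rewrite /y expr_div_n.
rewrite /truncpow -/y.
have -> : s * y ^+ 2 = s `^ (r - 1) * y `^ r * (s * y) `^ (2 - r).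
  rewrite powRM ?(ltW s_gt0) ?(ltW y0)//.
  have E1 : s `^ (r - 1) * s `^ (2 - r) = s.
    rewrite -powRD; last by rewrite (gt_eqF s_gt0) implybT.
    by rewrite (_ : r - 1 + (2 - r) = 1) ?powRr1 ?(ltW s_gt0)//; ring.
  have E2 : y `^ r * y `^ (2 - r) = y ^+ 2.
    rewrite -powRD; last by rewrite (gt_eqF y0) implybT.
    by rewrite (_ : r + (2 - r) = 2) ?powR_mulrn ?(ltW y0)//; ring.
  rewrite -[in LHS]E1 -E2; ring.
rewrite ler_piMr ?mulr_ge0 ?powR_ge0//.
apply: (@le_trans _ _ (1 `^ (2 - r))); last by rewrite powR1.
apply: ge0_ler_powR; rewrite ?nnegrE ?(ltW sy0)//.
by have := r_le2; lra.
Qed.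

Let A0 x : regular x -> 0 < A x := cosecS_gt0 (Ordinal n_gt0).

Lemma a_cutoff_le a : 0 < a -> a * cutoff a <= s^-1.
Proof.
move=> a0; have d0 := den_gt0 a0.
rewrite /cutoff ler_pdivrMr ?exprn_gt0// ler_pdivlMl//.
apply: (@le_trans _ _ (1 + s * a)); first by rewrite lerDr.
by rewrite expr2 ler_peMl ?(ltW d0) ?den_ge1.
Qed.

Lemma cutoff_le1 a : 0 < a -> cutoff a <= 1.
Proof. by move=> a0; rewrite invf_le1 ?exprn_gt0 ?den_gt0// exprn_ege1// den_ge1. Qed.

Lemma sqa_cutoff_le1 a : 0 < a -> (s * a) ^+ 2 * cutoff a <= 1.
Proof.
move=> a0; have d0 := den_gt0 a0; rewrite /cutoff ler_pdivrMr ?exprn_gt0// mul1r.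
by rewrite lerXn2r ?nnegrE ?(ltW d0) ?(ltW (sa_gt0 a0))// lerDr.
Qed.

Let k1 a : 0 < a -> `|a * cutoff a| <= 3 * s^-1.
Proof.
move=> a0; rewrite ger0_norm ?mulr_ge0 ?(ltW a0) ?(ltW (cutoff_gt0 a0))//.
have s0 : 0 < s^-1 by rewrite invr_gt0.
by have := a_cutoff_le a0; lra.
Qed.

Let k2 a : 0 < a -> `|a * (cutoff a + a * dcutoff a)| <= 3 * s^-1.
Proof.
move=> a0; have c0 := cutoff_gt0 a0.
rewrite mulrDr (le_trans (ler_normD _ _))//.
rewrite [X in X + _ <= _]ger0_norm ?mulr_ge0 ?(ltW a0) ?(ltW c0)//.
have h1 := a_cutoff_le a0.
have h2 : `|a * (a * dcutoff a)| <= 2 * s^-1.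
  rewrite mulrA normrM ger0_norm ?mulr_ge0 ?(ltW a0)//.
  apply: (le_trans (ler_wpM2l _ (dcutoff_le a0))); first by rewrite mulr_ge0 ?(ltW a0).
  rewrite [leLHS](_ : _ = 2 * s^-1 * ((s * a) ^+ 2 * cutoff a)); last by field; rewrite gt_eqF.
  by rewrite ler_piMr ?sqa_cutoff_le1// mulr_ge0 ?invr_ge0 ?(ltW s_gt0).
have s0 : 0 < s^-1 by rewrite invr_gt0.
lra.
Qed.

Let k4 a : 0 < a -> `|a ^+ 2 * dcutoff a| <= 3 * s^-1.
Proof.
move=> a0; rewrite normrM ger0_norm ?sqr_ge0//.
apply: (le_trans (ler_wpM2l (sqr_ge0 _) (dcutoff_le a0))).
rewrite [leLHS](_ : _ = 2 * s^-1 * ((s * a) ^+ 2 * cutoff a)); last by field; rewrite gt_eqF.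
have h := sqa_cutoff_le1 a0.
apply: (@le_trans _ _ (2 * s^-1)); last first.
  by have s0 : 0 < s^-1 by [rewrite invr_gt0]; lra.
by rewrite ler_piMr// mulr_ge0 ?invr_ge0 ?(ltW s_gt0).
Qed.

Lemma measurable_cutoff : measurable_fun setT (tuple_fun (fun x => cutoff (A x))).
Proof.
apply: measurable_inv_ge0 => [x|]; first exact: sqr_ge0.
apply: measurable_funX; apply: measurable_funD => //.
by apply: measurable_funM => //; exact: measurable_cosecS.
Qed.

Lemma measurable_dcutoff : measurable_fun setT (tuple_fun (fun x => dcutoff (A x))).
Proof.
apply: measurable_funM => //; apply: measurable_inv_ge0 => [x|].
  by rewrite exprn_ge0// addr_ge0// mulr_ge0 ?cosecS_ge0// ltW.
apply: measurable_funX; apply: measurable_funD => //.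
by apply: measurable_funM => //; exact: measurable_cosecS.
Qed.

Let mA := @measurable_cosecS R n.
Let mP := @measurable_cosec2S R n.
Let mB := @measurable_cotS R n.
Let mD := @measurable_cotcosecS R n.
Let m1 : measurable_fun setT (tuple_fun (fun x => A x * cutoff (A x))).
Proof. by apply: measurable_funM => //; exact: measurable_cutoff. Qed.
Let m2 : measurable_fun setT (tuple_fun (fun x => cutoff (A x) + A x * dcutoff (A x))).
Proof.
apply: measurable_funD; first exact: measurable_cutoff.
by apply: measurable_funM => //; exact: measurable_dcutoff.
Qed.

Let aA : admissible A := admissibleA n.
Let a_a1 : admissible (fun x => A x * cutoff (A x)).
Proof.
apply: (admissible_le (K := 1) m1 aA) => x rx; have a0 := A0 rx.
rewrite mul1r normrM ler_piMr// ger0_norm ?cutoff_le1 ?(ltW (cutoff_gt0 a0))//.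
Qed.
Lemma admissible_sqr_cutoff : admissible (fun x => A x ^+ 2 * cutoff (A x)).
Proof.
apply: (admissible_le (K := s^-1) _ aA) => [|x rx].
  by apply: measurable_funM; [exact: measurable_funX|exact: measurable_cutoff].
have a0 := A0 rx; rewrite expr2 -mulrA normrM mulrC ler_wpM2r//.
by rewrite ger0_norm ?a_cutoff_le// mulr_ge0 ?(ltW a0) ?(ltW (cutoff_gt0 a0)).
Qed.
Let a_c := admissible_sqr_cutoff.
Let a_b : admissible (fun x => cotS x ^+ 2 * (A x * cutoff (A x))).
Proof.
apply: (admissible_le (K := n%:R ^+ 2) _ a_c) => [|x rx].
  by apply: measurable_funM => //; exact: measurable_funX.
have a0 := A0 rx; have c0 := cutoff_gt0 a0.
rewrite !ger0_norm; last 2 first.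
- by rewrite mulr_ge0 ?sqr_ge0 ?(ltW c0).
- by rewrite mulr_ge0 ?sqr_ge0 ?mulr_ge0 ?(ltW a0) ?(ltW c0).
rewrite expr2 -!mulrA [leRHS]mulrA; rewrite [in leRHS]mulrA mulrA -expr2.
by rewrite ler_wpM2r ?mulr_ge0 ?(ltW a0) ?(ltW c0)// cotS_sqr_le.
Qed.
Lemma admissible_cosec2S_cutoff : admissible (fun x => cosec2S x * cutoff (A x)).
Proof.
apply: (admissible_le (K := 1) _ a_c) => [|x rx].
  by apply: measurable_funM => //; exact: measurable_cutoff.
have a0 := A0 rx; have c0 := cutoff_gt0 a0.
rewrite mul1r (normrM (cosec2S x)) (normrM (A x ^+ 2)) ler_wpM2r//.
by rewrite (ger0_norm (sqr_ge0 _)) ger0_norm ?cosec2S_ge0// cosec2S_le.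
Qed.
Let a_e := admissible_cosec2S_cutoff.
Let a_d : admissible (fun x => cotS x * cotcosecS x * cutoff (A x)).
Proof.
apply: (admissible_le (K := 1) _ (admissibleD a_b a_c)) => [|x rx].
  by apply: measurable_funM; [apply: measurable_funM|exact: measurable_cutoff].
have a0 := A0 rx; have c0 := cutoff_gt0 a0.
rewrite mul1r normrM [`|cutoff _|]ger0_norm ?(ltW c0)//.
rewrite [leRHS]ger0_norm; last first.
  by rewrite addr_ge0// mulr_ge0 ?sqr_ge0 ?mulr_ge0 ?(ltW a0) ?(ltW c0).
rewrite mulrA -mulrDl ler_wpM2r ?(ltW c0)//.
rewrite (le_trans (cotS_cotcosecS_le n_gt0 rx))//.
by have := sqr_ge0 (cotS x); have := sqr_ge0 (A x); have := mulr_ge0 (ltW a0) (sqr_ge0 (cotS x)); lra.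
Qed.

(** Bounds the mean of s A^3 [cutoff s A]. With s about x^2 / (16 n^2) and [T] of order n^2 it is of
    order n^4 |x|^(2 r - 2) Z, for r > 1 negligible against n^4 Z as x tends to 0. *)
Definition moment_error : R := s `^ (r - 1) * (T * T `^ r * Z).

Let Z_ge0 : 0 <= Z. Proof. by apply: wmean_ge0. Qed.

(** Half a bound for A^3 times the derivative of the cutoff; in [qB] one factor A is replaced by
    [cotS ^+ 2]. *)
Let q x := A x * (s * (A x ^+ 2 * cutoff (A x))).
Let qB x := cotS x ^+ 2 * (s * (A x ^+ 2 * cutoff (A x))).

Let aq : admissible q.
Proof.
apply: (admissible_le (K := s * s^-1 ^+ 2) _ aA) => [|x rx].
  apply: measurable_funM => //; apply: measurable_funM => //.
  by apply: measurable_funM; [exact: measurable_funX|exact: measurable_cutoff].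
have a0 := A0 rx; have c0 := cutoff_gt0 a0.
rewrite normrM mulrC ler_wpM2r// normrM gtr0_norm// ler_wpM2l ?(ltW s_gt0)//.
rewrite ger0_norm; last by rewrite mulr_ge0 ?sqr_ge0// ltW.
rewrite [leLHS](_ : _ = s^-1 ^+ 2 * ((s * A x) ^+ 2 * cutoff (A x))); last by field; rewrite gt_eqF.
by rewrite ler_piMr ?sqr_ge0// sqa_cutoff_le1.
Qed.

Let aqB : admissible qB.
Proof.
apply: (admissible_le (K := n%:R ^+ 2) _ aq) => [|x rx].
  apply: measurable_funM; first exact: measurable_funX.
  apply: measurable_funM => //.
  by apply: measurable_funM; [exact: measurable_funX|exact: measurable_cutoff].
rewrite /qB /q (normrM (cotS x ^+ 2)) (normrM (A x)) [leRHS]mulrA ler_wpM2r//.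
by rewrite !ger0_norm ?sqr_ge0 ?cosecS_ge0// cotS_sqr_le.
Qed.

Let wmean_q : wmean q <= moment_error.
Proof.
have h := wmean_A_truncpow_le beta_gt n_gt0 s_gt0 r_ge0 r_lt.
have ap := admissible_A_truncpow n_gt0 s_gt0 r_ge0.
apply: (@le_trans _ _ (s `^ (r - 1) * wmean (fun x => A x * psi (A x)))); last first.
  by rewrite ler_wpM2l ?powR_ge0.
rewrite -(wmeanZ beta_gt _ ap); apply: wmean_le => //; first exact: admissibleZ.
move=> x rx; rewrite /q [leRHS]mulrCA ler_wpM2l ?cosecS_ge0//.
exact: sqr_cutoff_le (A0 rx).
Qed.

Let wmean_qB : wmean qB <= moment_error.
Proof.
have h := wmean_A_truncpow_le beta_gt n_gt0 s_gt0 r_ge0 r_lt.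
have hB := wmean_cot2_truncpow_le beta_gt n_gt0 s_gt0 r_ge0 r_lt.
have ap := admissible_cot2_truncpow n_gt0 s_gt0 r_ge0.
apply: (@le_trans _ _ (s `^ (r - 1) * wmean (fun x => cotS x ^+ 2 * psi (A x)))); last first.
  by rewrite ler_wpM2l ?powR_ge0// (le_trans hB).
rewrite -(wmeanZ beta_gt _ ap); apply: wmean_le => //; first exact: admissibleZ.
move=> x rx; rewrite /qB [leRHS]mulrCA ler_wpM2l ?sqr_ge0//.
exact: sqr_cutoff_le (A0 rx).
Qed.

Lemma moment_error_ge0 : 0 <= moment_error.
Proof.
apply: mulr_ge0; first exact: powR_ge0.
apply: mulr_ge0 => //; apply: mulr_ge0; last exact: powR_ge0.
by apply: ltW; exact: moment_const_gt0.
Qed.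

(* Every derivative of the cutoff is thereby an error term. *)
Let A3_dcutoff_le x : regular x -> A x ^+ 3 * `|dcutoff (A x)| <= 2 * q x.
Proof.
move=> rx; have a0 := A0 rx.
apply: (le_trans (ler_wpM2l (exprn_ge0 3 (ltW a0)) (dcutoff_le a0))).
by rewrite /q; apply: eq_ler; ring.
Qed.

(** The terms of the four equations in which the cutoff is differentiated. *)
Let e1 := fun x => cotS x * cotcosecS x * (A x * dcutoff (A x)).
Let e2 := fun x => cotcosecS x ^+ 2 * dcutoff (A x).
Let e3 := fun x => (cosec2S x - A x) * (A x * dcutoff (A x)).
Let e4 := fun x => cot2cosec2S x * dcutoff (A x).

Let md := measurable_dcutoff.

Let admissible_error (f : ('I_n -> R) -> R) (g : ('I_n -> R) -> R) :
  measurable_fun setT (tuple_fun f) -> admissible g ->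
  (forall x, regular x -> `|f x| <= g x) -> admissible f /\ `|wmean f| <= wmean g.
Proof.
move=> mf ag fg; have af : admissible f.
  by apply: (admissible_le (K := 1) mf ag) => x rx; rewrite mul1r (le_trans (fg x rx))// ler_norm.
by split => //; exact: wmean_norm_le.
Qed.

Let wmean_2q : wmean (fun x => 2 * q x) <= 2 * moment_error.
Proof. by rewrite wmeanZ// ler_wpM2l. Qed.

Let e1P : admissible e1 /\ `|wmean e1| <= 2 * moment_error.
Proof.
have [||x rx|ae we] := @admissible_error e1 (fun x => q x + qB x).
- by apply: measurable_funM; apply: measurable_funM.
- exact: admissibleD.
- have a0 := A0 rx; have c0 := cutoff_gt0 a0.
  rewrite /e1 normrM (le_trans (ler_wpM2r (normr_ge0 _) (cotS_cotcosecS_le n_gt0 rx)))//.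
  rewrite normrM gtr0_norm//.
  have h0 : 0 <= (A x * cotS x ^+ 2 + A x ^+ 2) / 2.
    by rewrite divr_ge0// addr_ge0 ?sqr_ge0// mulr_ge0 ?sqr_ge0// ltW.
  apply: (le_trans (ler_wpM2l h0 (ler_wpM2l (ltW a0) (dcutoff_le a0)))).
  by rewrite /q /qB; apply: eq_ler; field.
split=> //; rewrite (le_trans we)// wmeanD//.
by have := wmean_q; have := wmean_qB; lra.
Qed.

Let e2P : admissible e2 /\ `|wmean e2| <= 2 * moment_error.
Proof.
have [||x rx|ae we] := @admissible_error e2 (fun x => 2 * q x).
- by apply: measurable_funM => //; exact: measurable_funX.
- exact: admissibleZ.
- rewrite /e2 normrM ger0_norm ?sqr_ge0// (le_trans _ (A3_dcutoff_le rx))//.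
  by rewrite ler_wpM2r// cotcosecS_sqr_le.
by split=> //; rewrite (le_trans we).
Qed.

Let e3P : admissible e3 /\ `|wmean e3| <= 2 * moment_error.
Proof.
have [||x rx|ae we] := @admissible_error e3 (fun x => 2 * q x).
- by apply: measurable_funM; [exact: measurable_funB|exact: measurable_funM].
- exact: admissibleZ.
- have a0 := A0 rx; have h1 := cosec2S_ge rx; have h2 := cosec2S_le x.
  rewrite /e3 normrM ger0_norm ?subr_ge0// (le_trans _ (A3_dcutoff_le rx))//.
  rewrite normrM gtr0_norm// mulrA ler_wpM2r// exprSr ler_wpM2r ?(ltW a0)//.
  by rewrite (le_trans _ h2)// gerBl ltW.
by split=> //; rewrite (le_trans we).
Qed.

Let e4P : admissible e4 /\ `|wmean e4| <= 2 * moment_error.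
Proof.
have [||x rx|ae we] := @admissible_error e4 (fun x => 2 * q x).
- by apply: measurable_funM => //; exact: measurable_cot2cosec2S.
- exact: admissibleZ.
- rewrite /e4 normrM ger0_norm ?cot2cosec2S_ge0// (le_trans _ (A3_dcutoff_le rx))//.
  by rewrite ler_wpM2r// cot2cosec2S_le.
by split=> //; rewrite (le_trans we).
Qed.

(** The unknowns of a linear system: [c] and [e] are wanted, [b] and [d] are to be eliminated, and
    [a1] is the mean of [A] up to [cutoff_defect]. *)
Let a1 := wmean (fun x => A x * cutoff (A x)).
Let b := wmean (fun x => cotS x ^+ 2 * (A x * cutoff (A x))).
Let c := wmean (fun x => A x ^+ 2 * cutoff (A x)).
Let d := wmean (fun x => cotS x * cotcosecS x * cutoff (A x)).
Let e := wmean (fun x => cosec2S x * cutoff (A x)).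

(** [cutoff_eq1] and [cutoff_eq3] put [A * cutoff] into the linear fields, [cutoff_eq2] and
    [cutoff_eq4] put [cutoff] into the cubic ones, so that apart from the cutoff all four fields are
    of third order. *)
Lemma cutoff_eq1 : beta * b - 2^-1 * c - d - wmean e1 = 0.
Proof.
have h := loop_rotation_cot beta_gt m1 m2 is_derive_id_cutoff k1 k2.
have [ae1 _] := e1P.
rewrite -h /b /c /d -(wmeanZ beta_gt beta a_b) -(wmeanZ beta_gt _ a_c).
rewrite -!wmeanB//; try exact: admissibleZ.
- by apply: eq_Rintegral => y _; congr (_ * _); rewrite /e1; field.
- exact: admissibleB (admissibleB (admissibleZ _ a_b) (admissibleZ _ a_c)) a_d.
- exact: admissibleB (admissibleZ _ a_b) (admissibleZ _ a_c).
Qed.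

Lemma cutoff_eq2 : beta * d - 3 / 2 * e + a1 - wmean e2 = 0.
Proof.
have h := loop_rotation_cotcosec beta_gt measurable_cutoff md is_derive_cutoff k1 k4.
have [ae2 _] := e2P.
rewrite -h /d /e /a1 -(wmeanZ beta_gt beta a_d) -(wmeanZ beta_gt _ a_e).
have h1 := admissibleB (admissibleZ beta a_d) (admissibleZ (3 / 2) a_e).
have h2 := admissibleD h1 a_a1.
rewrite -wmeanB//; try exact: admissibleZ.
rewrite -wmeanD// -wmeanB//.
Qed.

Lemma cutoff_eq3 : (5 / 4 * beta - 2^-1) * c - e - beta / 4 * b
  - (beta / 4 * n%:R ^+ 2 + beta * n%:R - 1) * a1 - wmean e3 = 0.
Proof.
have h := loop_cot beta_gt m1 m2 is_derive_id_cutoff k1 k2.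
have [ae3 _] := e3P.
rewrite -h /c /e /b /a1 -(wmeanZ beta_gt _ a_c) -(wmeanZ beta_gt _ a_b) -(wmeanZ beta_gt _ a_a1).
have h1 := admissibleB (admissibleZ (5 / 4 * beta - 2^-1) a_c) a_e.
have h2 := admissibleB h1 (admissibleZ (beta / 4) a_b).
have h3 := admissibleB h2 (admissibleZ (beta / 4 * n%:R ^+ 2 + beta * n%:R - 1) a_a1).
rewrite -wmeanB//; try exact: admissibleZ.
rewrite -wmeanB//; try exact: admissibleZ.
rewrite -wmeanB//; try exact: admissibleZ.
rewrite -wmeanB//.
by apply: eq_Rintegral => y _; congr (_ * _); rewrite /e3; field.
Qed.

Lemma cutoff_eq4 : (7 / 4 * beta - 3 / 2) * e - beta / 2 * d - beta / 4 * c
  - (3 / 2 * beta - 1) * a1 - wmean e4 = 0.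
Proof.
have h := loop_cotcosec beta_gt measurable_cutoff md is_derive_cutoff k1 k4.
have [ae4 _] := e4P.
rewrite -h /c /e /d /a1 -(wmeanZ beta_gt _ a_e) -(wmeanZ beta_gt _ a_d) -(wmeanZ beta_gt _ a_c) -(wmeanZ beta_gt _ a_a1).
have h1 := admissibleB (admissibleZ (7 / 4 * beta - 3 / 2) a_e) (admissibleZ (beta / 2) a_d).
have h2 := admissibleB h1 (admissibleZ (beta / 4) a_c).
have h3 := admissibleB h2 (admissibleZ (3 / 2 * beta - 1) a_a1).
rewrite -wmeanB//; try exact: admissibleZ.
rewrite -wmeanB//; try exact: admissibleZ.
rewrite -wmeanB//; try exact: admissibleZ.
rewrite -wmeanB//.
Qed.

Lemma sqr_n_le : n%:R ^+ 2 <= T.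
Proof.
have k0 : 0 < beta - 2^-1 - r by have := r_lt; lra.
rewrite /moment_const ler_peMl ?exprn_ge0// ler_pdivlMr ?mulr_gt0//.
by have := beta_gt; have := r_ge0; lra.
Qed.

Lemma moment_const_le : moment_const beta n (r - 1) <= T.
Proof.
have k0 : 0 < beta - 2^-1 - r by have := r_lt; lra.
have k0' : 0 < beta - 2^-1 - (r - 1) by have := r_lt; lra.
rewrite /moment_const ler_wpM2r ?exprn_ge0// ler_wpM2l ?mulr_ge0//.
  by have := beta_gt; lra.
by rewrite lef_pV2 ?posrE ?mulr_gt0//; lra.
Qed.

(** With y = A / (1 + s A), the defect 1 - [cutoff] is at most 2 s y, hence at most 2 (s y)^(r - 1)
    since s y <= 1 and r <= 2. The moment bound of order r then applies to A y^(r - 1), and n^2 <= T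
    supplies the last power of [T]. *)
Lemma cutoff_defect : `|n%:R ^+ 2 * (a1 - wmean A)| <= 2 * moment_error.
Proof.
have r1 : 0 <= r - 1 by have := r_ge1; lra.
have r1lt : r - 1 < beta - 2^-1 by have := r_lt; lra.
have h := wmean_A_truncpow_le beta_gt n_gt0 s_gt0 r1 r1lt.
have ap := admissible_A_truncpow n_gt0 s_gt0 r1.
have [T0' T0] : 0 < moment_const beta n (r - 1) /\ 0 < T by split; exact: moment_const_gt0.
have TT := moment_const_le.
have h1 : `|wmean (fun x => A x * cutoff (A x) - A x)| <=
   wmean (fun x => 2 * s `^ (r - 1) * (A x * truncpow s (r - 1) (A x))).
  apply: wmean_norm_le => //; [exact: admissibleB|exact: admissibleZ|].
  move=> x rx; have a0 := A0 rx; have d0 := den_gt0 a0.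
  have -> : A x * cutoff (A x) - A x = A x * (cutoff (A x) - 1) by ring.
  rewrite normrM gtr0_norm// mulrCA ler_wpM2l ?(ltW a0)//.
  rewrite distrC ger0_norm ?subr_ge0 ?cutoff_le1//.
  have y0 : 0 < A x / (1 + s * A x) by rewrite divr_gt0.
  have sy1 : s * (A x / (1 + s * A x)) <= 1 by rewrite mulrA ler_pdivrMr// mul1r lerDr.
  rewrite /truncpow -mulrA -powRM ?(ltW s_gt0) ?(ltW y0)//.
  apply: (@le_trans _ _ (2 * (s * (A x / (1 + s * A x))))); last first.
    rewrite ler_wpM2l// ger1_powR//; first by rewrite mulr_gt0.
    by have := r_le2; lra.
  rewrite /cutoff -subr_ge0.
  rewrite (_ : _ - _ = (s * A x) ^+ 2 / (1 + s * A x) ^+ 2); last by field; rewrite gt_eqF.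
  by rewrite divr_ge0 ?sqr_ge0.
rewrite wmeanB// -/a1 in h1; rewrite wmeanZ// in h1.
rewrite normrM ger0_norm ?sqr_ge0//.
apply: (@le_trans _ _ (T * (2 * s `^ (r - 1) * (T * T `^ (r - 1) * Z)))).
  apply: ler_pM => //; first exact: sqr_n_le.
  apply: (le_trans h1); rewrite ler_wpM2l ?mulr_ge0 ?powR_ge0//.
  apply: (le_trans h); rewrite ler_wpM2r//; apply: ler_pM; rewrite ?powR_ge0 ?(ltW T0')//.
  by apply: ge0_ler_powR; rewrite ?nnegrE ?(ltW T0') ?(ltW T0).
rewrite /moment_error; apply: eq_ler.
rewrite -[in RHS](mulr_powRB1 (ltW T0) (lt_le_trans ltr01 r_ge1)); ring.
Qed.

(** The coefficient of n^2 in the normalised mean of [A]. Times beta / 16 it is, up to sign, the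
    coefficient of x^2 in the theorem. *)
Definition mean_slope : R := 2 * beta / (5 * (2 * beta - 1)).

Lemma wmean_A_eq : wmean A = (mean_slope * n%:R ^+ 2 + 4 * mean_slope * n%:R) * Z.
Proof.
have h := wmean_A beta_gt n_gt0.
have b0 : 0 < 2 * beta - 1 by have := beta_gt; lra.
have b1 : 5 / 4 * beta - 5 / 8 != 0 by apply: lt0r_neq0; have := beta_gt; lra.
apply: (mulfI b1); rewrite h /mean_slope; field.
by rewrite lt0r_neq0.
Qed.

(** The coefficient of n^4 in the normalised mean of beta^2 / 2 A^2 - beta / 2 P. Divided by 16^2 it
    is the coefficient of x^4 in the theorem. *)
Definition second_slope : R :=
  2 * beta ^+ 4 * (7 * beta - 10) /
    (35 * (2 * beta - 1) * (2 * beta - 3) * (5 * beta - 2)).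

(* Coefficients of the combination of [cutoff_eq1] to [cutoff_eq4] that isolates
   [beta ^ 2 / 2 * A ^ 2 - beta / 2 * cosec2S]. *)
Definition second_gain : R :=
  4 * beta ^+ 2 * (7 * beta - 10) / (7 * (5 * beta - 2) * (2 * beta - 3)).

(** What the combination leaves on [a1] without a power of [n]. As [a1] is of order n^2, only its
    multiple by n^2 contributes to the order n^4. *)
Definition second_rest : R :=
  second_gain * (- 1 - 1 / (4 * beta) +
    5 / 2 * (2 * beta - 1) / beta * (3 / 2 * (beta - 1))) - 3 * beta * (beta - 1).

(** The factor 2 comes from the bounds on the four error terms and from [cutoff_defect], the 5 from
    n^2 + 4 n <= 5 n^2 in the mean of [A], and the 4 from the linear part of that mean alone. *)
Definition second_const : R :=
  2 * (`|second_gain / 4| +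
       `|second_gain * (1 / (4 * beta) + 5 / 4 * (2 * beta - 1) / beta) - beta| +
       `|second_gain| +
       `|second_gain * (5 / 2) * (2 * beta - 1) / beta - 2 * beta| +
       `|second_gain * beta / 4|) +
  5 * mean_slope * (`|second_rest| + `|second_gain * beta|) +
  4 * mean_slope * `|second_gain * beta / 4|.

Lemma mean_slope_gt0 : 0 < mean_slope.
Proof.
have b0 : 0 < 2 * beta - 1 by have := beta_gt; lra.
have b1 : 0 < beta by have := beta_gt; lra.
by rewrite divr_gt0 ?mulr_gt0.
Qed.

Lemma wmean_second_bound :
  `|wmean (fun x => (beta ^+ 2 / 2 * A x ^+ 2 - beta / 2 * cosec2S x) * cutoff (A x))
    - second_slope * n%:R ^+ 4 * Z| <=
  second_const * (moment_error + n%:R ^+ 3 * Z).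
Proof.
have -> : wmean (fun x => (beta ^+ 2 / 2 * A x ^+ 2 - beta / 2 * cosec2S x) * cutoff (A x)) =
    beta ^+ 2 / 2 * c - beta / 2 * e.
  rewrite /c /e -(wmeanZ beta_gt _ a_c) -(wmeanZ beta_gt _ a_e).
  rewrite -wmeanB//; try exact: admissibleZ.
  by apply: eq_Rintegral => y _; congr (_ * _); ring.
have [_ b1] := e1P; have [_ b2] := e2P; have [_ b3] := e3P; have [_ b4] := e4P.
have b5 := cutoff_defect.
have E1 : wmean e1 = beta * b - 2^-1 * c - d by have := cutoff_eq1; lra.
have E2 : wmean e2 = beta * d - 3 / 2 * e + a1 by have := cutoff_eq2; lra.
have E3 : wmean e3 = (5 / 4 * beta - 2^-1) * c - e - beta / 4 * b
  - (beta / 4 * n%:R ^+ 2 + beta * n%:R - 1) * a1 by have := cutoff_eq3; lra.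
have E4 : wmean e4 = (7 / 4 * beta - 3 / 2) * e - beta / 2 * d - beta / 4 * c
  - (3 / 2 * beta - 1) * a1 by have := cutoff_eq4; lra.
have E5 := wmean_A_eq.
have q1 : 0 < 2 * beta - 1 by have := beta_gt; lra.
have q2 : 0 < 5 * beta - 2 by have := beta_gt; lra.
have q3 : 0 < 2 * beta - 3 by have := beta_gt; lra.
have q4 : 0 < beta by have := beta_gt; lra.
have nn0 : 0 <= n%:R :> R by [].
have nn1 : 1 <= n%:R :> R by rewrite ler1n.
have m0 := mean_slope_gt0.
have nn2 : 1 <= n%:R ^+ 2 :> R by rewrite exprn_ege1.
have nn12 : n%:R <= n%:R ^+ 2 :> R by rewrite expr2 ler_peMl.
have nn23 : n%:R ^+ 2 <= n%:R ^+ 3 :> R by rewrite [leRHS]exprS ler_peMl ?sqr_ge0.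
have EZ0 : 0 <= moment_error := moment_error_ge0.
have NZ0 : 0 <= n%:R ^+ 3 * Z by rewrite mulr_ge0// exprn_ge0.
have IA_le : wmean A <= 5 * mean_slope * n%:R ^+ 2 * Z.
  rewrite E5 ler_wpM2r//.
  by have := ler_wpM2l (ltW m0) nn12; lra.
have a1_ge0 : 0 <= a1.
  apply: wmean_ge0 => // x rx; have a0 := A0 rx.
  by rewrite mulr_ge0 ?(ltW a0) ?(ltW (cutoff_gt0 a0)).
have a1_le : a1 <= 5 * mean_slope * n%:R ^+ 2 * Z.
  apply: le_trans IA_le; apply: wmean_le => // x rx; have a0 := A0 rx.
  by rewrite ler_piMr ?(ltW a0)// cutoff_le1.
have a1_le3 : a1 <= 5 * mean_slope * (n%:R ^+ 3 * Z).
  apply: (le_trans a1_le); rewrite [leLHS](_ : _ = 5 * mean_slope * Z * n%:R ^+ 2); last by ring.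
  rewrite [leRHS](_ : _ = 5 * mean_slope * Z * n%:R ^+ 3); last by ring.
  by rewrite ler_wpM2l// mulr_ge0// mulr_ge0// ltW.
have na1_le3 : n%:R * a1 <= 5 * mean_slope * (n%:R ^+ 3 * Z).
  apply: (le_trans (ler_wpM2l nn0 a1_le)).
  by apply: eq_ler; ring.
have b6 : `|n%:R ^+ 2 * (wmean A - mean_slope * n%:R ^+ 2 * Z)| <= 4 * mean_slope * (n%:R ^+ 3 * Z).
  rewrite E5 (_ : _ * _ = 4 * mean_slope * (n%:R ^+ 3 * Z)); last by ring.
  by rewrite ger0_norm// mulr_ge0// mulr_ge0// ltW.
(* An exact identity: in the combination [b] and [d] cancel, and n^2 [a1] becomes [mean_slope] n^4 Z
   up to two differences kept as separate terms. *)
have -> : beta ^+ 2 / 2 * c - beta / 2 * e - second_slope * n%:R ^+ 4 * Z =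
  second_gain / 4 * wmean e1 +
  (second_gain * (1 / (4 * beta) + 5 / 4 * (2 * beta - 1) / beta) - beta) * wmean e2 +
  second_gain * wmean e3 +
  (second_gain * (5 / 2) * (2 * beta - 1) / beta - 2 * beta) * wmean e4 +
  second_gain * beta / 4 * (n%:R ^+ 2 * (a1 - wmean A)) +
  second_rest * a1 + second_gain * beta * (n%:R * a1) +
  second_gain * beta / 4 * (n%:R ^+ 2 * (wmean A - mean_slope * n%:R ^+ 2 * Z)).
  rewrite E1 E2 E3 E4 /second_rest /second_gain /second_slope /mean_slope.
  by field; rewrite !gt_eqF.
have st (k u v : R) : `|u| <= v -> `|k * u| <= `|k| * v.
  by move=> uv; rewrite normrM ler_wpM2l.
have c1 := st (second_gain / 4) _ _ b1.
have c2 := st (second_gain * (1 / (4 * beta) + 5 / 4 * (2 * beta - 1) / beta) - beta) _ _ b2.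
have c3 := st second_gain _ _ b3.
have c4 := st (second_gain * (5 / 2) * (2 * beta - 1) / beta - 2 * beta) _ _ b4.
have c5 := st (second_gain * beta / 4) _ _ b5.
have c6 : `|second_rest * a1| <= `|second_rest| * (5 * mean_slope * (n%:R ^+ 3 * Z)).
  by apply: st; rewrite ger0_norm.
have c7 : `|second_gain * beta * (n%:R * a1)| <=
    `|second_gain * beta| * (5 * mean_slope * (n%:R ^+ 3 * Z)).
  by apply: st; rewrite ger0_norm// mulr_ge0.
have c8 := st (second_gain * beta / 4) _ _ b6.
rewrite /second_const.
move: c1 c2 c3 c4 c5 c6 c7 c8.
set u1 := _ * wmean e1; set p1 := `|_ / 4|.
set u2 := _ * wmean e2; set p2 := `|_ - beta|.
set u3 := _ * wmean e3; set p3 := `|second_gain|.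
set u4 := _ * wmean e4; set p4 := `|_ - 2 * beta|.
set u5 := _ * (_ * (a1 - _)); set p5 := `|second_gain * beta / 4|.
set u6 := second_rest * a1; set p6 := `|second_rest|.
set u7 := _ * (_ * a1); set p7 := `|second_gain * beta|.
set u8 := _ * (_ * (wmean A - _)) => c1 c2 c3 c4 c5 c6 c7 c8.
apply: (@le_trans _ _ (`|u1| + `|u2| + `|u3| + `|u4| + `|u5| + `|u6| + `|u7| + `|u8|)).
  by do 7! (apply: (le_trans (ler_normD _ _)); apply: lerD => //).
have p0 : [/\ 0 <= p1, 0 <= p2, 0 <= p3, 0 <= p4 & [/\ 0 <= p5, 0 <= p6 & 0 <= p7]].
  by split; try exact: normr_ge0; split; exact: normr_ge0.
have mE : 0 <= mean_slope * moment_error by rewrite mulr_ge0// ltW.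
move: p0 c1 c2 c3 c4 c5 c6 c7 c8 NZ0 EZ0 mE.
move: p1 p2 p3 p4 p5 p6 p7 u1 u2 u3 u4 u5 u6 u7 u8 mean_slope moment_error (n%:R ^+ 3 * Z).
move=> p1 p2 p3 p4 p5 p6 p7 u1 u2 u3 u4 u5 u6 u7 u8 m E N.
move=> [p10 p20 p30 p40 [p50 p60 p70]] c1 c2 c3 c4 c5 c6 c7 c8 N0 E0 mE.
have := mulr_ge0 p10 N0; have := mulr_ge0 p20 N0; have := mulr_ge0 p30 N0.
have := mulr_ge0 p40 N0; have := mulr_ge0 p50 N0.
have := mulr_ge0 p60 mE; have := mulr_ge0 p70 mE; have := mulr_ge0 p50 mE.
lra.
Qed.

End second_moment.

(** * The characteristic polynomial ratio *)

Section complex_modulus.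
Context {R : realType}.
Implicit Types (z w : R[i]) (t : R).

Lemma cmod_ge0 z : 0 <= cmod z.
Proof. by case: z => a b; exact: sqrtr_ge0. Qed.

Lemma cmodM z w : cmod (z * w) = cmod z * cmod w.
Proof. exact: ComplexField.Normc.normcM. Qed.

Lemma cmodV z : cmod z^-1 = (cmod z)^-1.
Proof. exact: ComplexField.Normc.normcV. Qed.

Lemma cmod_prod I (r : seq I) (p : pred I) (F : I -> R[i]) :
  cmod (\prod_(i <- r | p i) F i) = \prod_(i <- r | p i) cmod (F i).
Proof.
apply: (big_morph (@cmod R) cmodM).
exact: ComplexField.Normc.normc1.
Qed.

Lemma cmodN z : cmod (- z) = cmod z.
Proof. exact: normcN. Qed.

Lemma cmod_dist z w : `|cmod z - cmod w| <= cmod (z - w).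
Proof.
have h (a b : R[i]) : cmod a - cmod b <= cmod (a - b).
  by rewrite lerBlDr -[in leLHS](subrK b a); exact: le_normcD.
rewrite ler_norml; apply/andP; split; last exact: h.
by rewrite lerNl opprB (le_trans (h w z))// -cmodN opprB.
Qed.

(** The norm of [R[i]^o] takes values in [R[i]], so the radius is injected there and the inequality
    is read back with [ltcR]. *)
Lemma continuous_cmod : continuous (@cmod R : R[i]^o -> R).
Proof.
move=> z.
have FF : Filter (nbhs (z : R[i]^o)) by exact: nbhs_filter.
apply: (proj2 (@cvgrPdist_lt R R R[i] (nbhs (z : R[i]^o)) FF (@cmod R) (cmod z))) => e e0.
have : nbhs (z : R[i]^o) (ball (z : R[i]^o) (e%:C)%C).
  by apply: nbhsx_ballx; rewrite (_ : 0 = (0%:C)%C)// ltcR.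
apply: filterS => w; rewrite -ball_normE /= => zw.
apply: (le_lt_trans (cmod_dist z w)).
by move: zw; rewrite normc_def ltcR; case: (z - w).
Qed.

Lemma cexp_imaginary t : cexp (Complex 0 t) = cis t. Proof. by []. Qed.

Lemma cmod_cis t : cmod (cis t) = 1.
Proof.
rewrite /cmod /cis /cexp /= expR0 !mul1r /ComplexField.Normc.normc.
by rewrite cos2Dsin2 sqrtr1.
Qed.

Lemma cmod_cisB (s t : R) : cmod (cis s - cis t) = 2 * `|sin ((s - t) / 2)|.
Proof.
rewrite /cmod /cis /cexp /= expR0 !mul1r /ComplexField.Normc.normc /=.
have -> : (cos s - cos t) ^+ 2 + (sin s - sin t) ^+ 2 = (2 * sin ((s - t) / 2)) ^+ 2.
  have E1 : (cos s - cos t) ^+ 2 + (sin s - sin t) ^+ 2 = 2 - 2 * cos (s - t).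
    rewrite cosB; have := cos2Dsin2 s; have := cos2Dsin2 t; lra.
  have E2 : cos (s - t) = 1 - 2 * sin ((s - t) / 2) ^+ 2.
    rewrite [in LHS](_ : s - t = (s - t) / 2 *+ 2); last by rewrite -mulr_natr -mulrA mulVf ?mulr1.
    by rewrite cos_mulr2n cos2sin2; ring.
  by rewrite E1 E2; ring.
by rewrite sqrtr_sqr normrM ger0_norm.
Qed.

Lemma cmod_cisB_powR (p s t : R) : cmod (cis s - cis t) `^ p = chordp p (s - t).
Proof. by rewrite cmod_cisB chordpE. Qed.

Lemma cis0 : cis 0 = 1 :> R[i].
Proof. by rewrite /cis /cexp /= expR0 cos0 sin0 mulr0 mulr1. Qed.

Lemma cmod_1cis_powR (p t : R) : cmod (1 - cis t) `^ p = chordp p t.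
Proof. by rewrite -cis0 cmod_cisB_powR sub0r chordpN. Qed.

Lemma cmod_char_ratio n (theta : n.-tuple R) (x : R) :
  cmod (char_ratio theta (real_complex R x)) =
  \prod_(j < n) (cmod (cis (x / n%:R) - cis (tnth theta j)) / cmod (1 - cis (tnth theta j))).
Proof.
rewrite /char_ratio cmodM cmod_prod.
have -> : - (Complex 0 1 * real_complex R x / 2%:R) = Complex 0 (- (x / 2)).
  rewrite -(rmorph_nat (real_complex R) 2) -fmorphV -mulrA -rmorphM /=.
  by simpc.
have -> : Complex 0 1 * real_complex R x / n%:R = Complex 0 (x / n%:R).
  rewrite -(rmorph_nat (real_complex R) n) -fmorphV -mulrA -rmorphM /=.
  by simpc.
rewrite !cexp_imaginary cmod_cis mul1r; apply: eq_bigr => j _.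
by rewrite cmodM cmodV.
Qed.

End complex_modulus.

(** * The characteristic polynomial ratio under the weight *)

Section weight_link.
Context {R : realType} (beta : R) (n : nat).
Implicit Types (x : 'I_n -> R).
Local Notation W := (@weight R beta n).
Local Notation V := (@vander R beta n).
Hypothesis beta_gt : 3 / 2 < beta.

Lemma circular_jacobi_weightE (theta : n.-tuple R) :
  circular_jacobi_weight beta (2 * beta) theta = W (tnth theta).
Proof.
rewrite /circular_jacobi_weight /weight /circular_weight /vander /radial.
congr (_ * _); last by apply: eq_bigr => j _; rewrite cmod_1cis_powR.
rewrite pair_big_dep/=; apply: eq_bigr => p _.
by rewrite cmod_cisB_powR.
Qed.

Definition shifted_radial (p u : R) x : R := \prod_i chordp p (x i - u).

Lemma shifted_radial_ge0 p u x : 0 <= shifted_radial p u x.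
Proof. by apply: prodr_ge0 => i _; exact: chordp_ge0. Qed.

Lemma powR_prod I (r : seq I) (F : I -> R) (p : R) : (forall i, 0 <= F i) ->
  (\prod_(i <- r) F i) `^ p = \prod_(i <- r) (F i `^ p).
Proof.
move=> F0; elim: r => [|i r IH]; first by rewrite !big_nil powR1.
by rewrite !big_cons powRM ?IH// prodr_ge0.
Qed.

Let beta_gt0 : 0 < beta. Proof. by have := beta_gt; lra. Qed.

Lemma chordp_double p t : chordp (2 * p) t = chordp p t ^+ 2 :> R.
Proof. by rewrite !chordpE (mulrC 2 p) powRrM powR_mulrn ?powR_ge0. Qed.

Lemma char_ratio_powR (theta : n.-tuple R) (x : R) :
  cmod (char_ratio theta (real_complex R x)) `^ beta =
  \prod_(j < n) (chordp beta (tnth theta j - x / n%:R) / chordp beta (tnth theta j)).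
Proof.
rewrite cmod_char_ratio powR_prod => [|j]; last first.
  by rewrite divr_ge0 ?cmod_ge0.
apply: eq_bigr => j _; rewrite powRM ?invr_ge0 ?cmod_ge0//.
rewrite cmod_cisB_powR -opprB chordpN; congr (_ * _).
rewrite -cmod_1cis_powR -powR_inv1 ?cmod_ge0// -powRrM mulN1r powRN.
by [].
Qed.

(** At exponent 2 beta each angle carries its chord power twice, and the ratio trades one copy for
    the shifted chord. *)
Lemma weight_char_ratio (theta : n.-tuple R) (x : R) :
  W (tnth theta) * cmod (char_ratio theta (real_complex R x)) `^ beta =
  V (tnth theta) * (shifted_radial beta (x / n%:R) (tnth theta) * shifted_radial beta 0 (tnth theta)).
Proof.
rewrite char_ratio_powR /weight -mulrA; congr (_ * _).
rewrite /radial /shifted_radial -!big_split/=; apply: eq_bigr => j _.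
rewrite subr0 chordp_double.
(* At a vanishing chord both sides are 0; dividing by it does no harm. *)
have [->|c0] := eqVneq (chordp beta (tnth theta j)) 0.
  by rewrite expr0n/= mul0r mulr0.
by field.
Qed.

(** The squared ratio trades both copies, which leaves the weight rotated by [x / n%:R]. It is only
    an inequality, since at a vanishing chord the left side is 0. *)
Lemma weight_char_ratio_sqr (theta : n.-tuple R) (x : R) :
  W (tnth theta) * (cmod (char_ratio theta (real_complex R x)) `^ beta) ^+ 2 <=
  V (tnth theta) * shifted_radial (2 * beta) (x / n%:R) (tnth theta).
Proof.
rewrite char_ratio_powR /weight -mulrA ler_wpM2l ?vander_ge0//.
rewrite -prodrXl /radial /shifted_radial -!big_split/=; apply: ler_prod => j _.
rewrite mulr_ge0 ?chordp_ge0 ?sqr_ge0//= chordp_double.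
have [c0|c0] := eqVneq (chordp beta (tnth theta j)) 0.
  by rewrite c0 expr0n/= mul0r chordp_ge0.
by rewrite chordp_double; apply: eq_ler; field.
Qed.

Lemma vander_shift (v : R) x : V (fun i => x i + v) = V x.
Proof. by apply: eq_bigr => p _; congr chordp; ring. Qed.

Lemma shifted_radial_shift p u v x :
  shifted_radial p u (fun i => x i + v) = shifted_radial p (u - v) x.
Proof. by apply: eq_bigr => i _; congr chordp; ring. Qed.

Lemma shifted_radial0 : shifted_radial (2 * beta) 0 = @radial R beta n.
Proof. by apply/funext => x; apply: eq_bigr => i _; rewrite subr0. Qed.

Lemma periodic_shifted_radial p u : shift_periodic (shifted_radial p u).
Proof.
move=> x j; apply: eq_bigr => i _; apply: (upd2piE (f := fun t => chordp p (t - u))) => t.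
by rewrite addrAC chordp_2pi.
Qed.

Lemma measurable_shifted_radial p u : measurable_fun setT (tuple_fun (shifted_radial p u)).
Proof.
apply: measurable_prod => i _; apply: (measurable_at i (f := fun t => chordp p (t - u))).
apply: (measurableT_comp (measurable_chordp p)).
by apply: measurable_funB.
Qed.

Lemma shifted_radial_le p u x : 0 <= p -> shifted_radial p u x <= \prod_(i < n) 2 `^ p.
Proof. by move=> p0; apply: ler_prod => i _; rewrite chordp_ge0 chordp_le. Qed.

Lemma bounded_vander_mul (f : ('I_n -> R) -> R) (K : R) :
  measurable_fun setT (tuple_fun f) -> (forall x, `|f x| <= K) ->
  bounded_mfun (fun x : n.-tuple R => V (tnth x) * f (tnth x)).
Proof.
move=> mf fK; apply: bounded_mfunM; last by split => //; exists K => y.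
split; first exact: measurable_vander.
exists (\prod_(p : 'I_n * 'I_n | (p.1 < p.2)%N) 2 `^ beta) => y.
by rewrite ger0_norm ?vander_ge0 ?vander_le.
Qed.

Lemma shifted_pair_le (u v : R) x : `|shifted_radial beta u x * shifted_radial beta v x| <=
  (\prod_(i < n) 2 `^ beta) * \prod_(i < n) 2 `^ beta.
Proof.
rewrite ger0_norm ?mulr_ge0 ?shifted_radial_ge0//.
by apply: ler_pM; rewrite ?shifted_radial_ge0 ?shifted_radial_le ?(ltW beta_gt0).
Qed.

Lemma bounded_vander_pair (u v : R) : bounded_mfun (fun x : n.-tuple R => V (tnth x) *
  (shifted_radial beta u (tnth x) * shifted_radial beta v (tnth x))).
Proof.
apply: (bounded_vander_mul (f := fun x => shifted_radial beta u x * shifted_radial beta v x)).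
  by apply: measurable_funM; exact: measurable_shifted_radial.
exact: shifted_pair_le.
Qed.

Lemma bounded_vander_shifted (u : R) :
  bounded_mfun (fun x : n.-tuple R => V (tnth x) * shifted_radial (2 * beta) u (tnth x)).
Proof.
have b2 : 0 <= 2 * beta by rewrite mulr_ge0// ltW.
apply: (bounded_vander_mul (f := shifted_radial (2 * beta) u)
  (K := \prod_(i < n) 2 `^ (2 * beta))); first exact: measurable_shifted_radial.
by move=> x; rewrite ger0_norm ?shifted_radial_ge0 ?shifted_radial_le.
Qed.

Lemma mean_rotate (v : R) (f : ('I_n -> R) -> R) (K : R) : `|v| <= 2 * pi ->
  measurable_fun setT (tuple_fun f) -> (forall x, `|f x| <= K) -> shift_periodic f ->
  mean (fun x => V x * f (fun i => x i + v)) = mean (fun x => V x * f x).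
Proof.
move=> v2 mf fK pf.
apply: (etrans _ (@Rintegral_torus_shift R n (fun=> v) (fun x => V x * f x) _ _ _)).
- by apply: eq_Rintegral => y _; rewrite vander_shift.
- by [].
- exact: bounded_vander_mul fK.
- by move=> x j; rewrite periodic_vander pf.
Qed.

Lemma mean_shifted_radial (u : R) : `|u| <= 2 * pi ->
  mean (fun x => V x * shifted_radial (2 * beta) u x) = mean W.
Proof.
move=> u2; have b2 : 0 <= 2 * beta by rewrite mulr_ge0// ltW.
apply: (etrans (esym (@mean_rotate u _ (\prod_(i < n) 2 `^ (2 * beta)) _ _ _ _)) _).
- exact: u2.
- exact: measurable_shifted_radial.
- by move=> x; rewrite ger0_norm ?shifted_radial_ge0 ?shifted_radial_le.
- exact: periodic_shifted_radial.
- by apply: eq_Rintegral => y _; rewrite shifted_radial_shift subrr shifted_radial0.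
Qed.

End weight_link.

(** * Expansion at fixed size *)

Section elementary_expansion.
Context {R : realType}.
Implicit Types (y z beta : R).

Lemma le_of_derive_ge0 (f df : R -> R) (t : R) : 0 <= t ->
  (forall u : R, 0 <= u <= t -> is_derive u 1 f (df u)) ->
  (forall u : R, 0 <= u <= t -> 0 <= df u) -> f 0 <= f t.
Proof.
move=> t0 hf hd; have [c|cf|c ct] := @MVT_segment R f df 0 t t0.
- by rewrite in_itv/= => /andP[c0 ct]; apply: hf; rewrite (ltW c0) (ltW ct).
- by apply: derivable_within_continuous => u; rewrite in_itv/= => ut; have [] := hf u ut.
by rewrite subr0 => E; rewrite -subr_ge0 E mulr_ge0// hd.
Qed.

Lemma is_derive_Xn (k : nat) (u : R) : is_derive u 1 (fun v : R => v ^+ k.+1) (k.+1%:R * u ^+ k).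
Proof.
elim: k => [|k IH]; first by rewrite expr0 mulr1; exact: is_derive_id.
rewrite (_ : (fun v : R => v ^+ k.+2) = fun v : R => v * v ^+ k.+1); last first.
  by apply/funext => v; rewrite exprS.
apply: (is_derive_eq (is_derive_mul (is_derive_id u 1) IH)).
by rewrite exprS -[in RHS]natr1; ring.
Qed.

Let is_derive_cX (c : R) (k : nat) (u : R) :
  is_derive u 1 (fun v : R => c * v ^+ k.+1) (c * (k.+1%:R * u ^+ k)).
Proof.
have := is_derive_mul (is_derive_const c u) (is_derive_Xn k u).
by rewrite mul0r add0r.
Qed.

Lemma is_derive_ln1B (u : R) : u < 1 -> is_derive u 1 (fun v : R => ln (1 - v)) (- (1 - u)^-1).
Proof.
move=> u1; have d0 : 0 < 1 - u by rewrite subr_gt0.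
have d1 : is_derive u 1 (fun v : R => 1 - v) (0 - 1).
  exact: is_deriveB (is_derive_const 1 u) (is_derive_id u 1).
have := is_derive_compose (f := @ln R) (g := fun v : R => 1 - v) (is_derive1_ln d0) d1.
by rewrite sub0r mulrN1.
Qed.

Lemma ln1B_le y : 0 <= y <= 1 / 2 -> ln (1 - y) <= - y - y ^+ 2 / 2.
Proof.
move=> /andP[y0 y1].
pose f v : R := - ln (1 - v) + (- v) + (- 2^-1) * v ^+ 2.
have df (u : R) : 0 <= u <= y -> is_derive u 1 f (- - (1 - u)^-1 + (- 1) + (- 2^-1) * (2 * u ^+ 1)).
  move=> /andP[u0 uy]; have u1 : u < 1 by lra.
  have d1 : is_derive u 1 (fun v : R => - ln (1 - v)) (- - (1 - u)^-1).
    exact: is_deriveN (is_derive_ln1B u1).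
  have d2 : is_derive u 1 (fun v : R => - v) (- 1) by exact: is_deriveN (is_derive_id u 1).
  exact: is_derive_add (is_derive_add d1 d2) (is_derive_cX (- 2^-1) 1 u).
have := le_of_derive_ge0 y0 df.
rewrite /f !subr0 ln1 expr0n/= mulr0 oppr0 !addr0 => h.
suff : 0 <= - ln (1 - y) - y + - 2^-1 * y ^+ 2 by lra.
apply: h => u /andP[u0 uy].
have d0 : 0 < 1 - u by lra.
rewrite (_ : _ + _ = u ^+ 2 / (1 - u)); last by field; rewrite gt_eqF.
by rewrite divr_ge0 ?sqr_ge0// ltW.
Qed.

(** The cubic coefficient 1, in place of the 1/3 of the Taylor series, gives the difference the
    derivative u^2 (2 - 3 u) / (1 - u), nonnegative on [0, 1/2]. *)
Lemma ln1B_ge y : 0 <= y <= 1 / 2 -> - y - y ^+ 2 / 2 - y ^+ 3 <= ln (1 - y).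
Proof.
move=> /andP[y0 y1].
pose f v : R := ln (1 - v) + v + 2^-1 * v ^+ 2 + v ^+ 3.
have df (u : R) : 0 <= u <= y ->
    is_derive u 1 f (- (1 - u)^-1 + 1 + 2^-1 * (2 * u ^+ 1) + 3 * u ^+ 2).
  move=> /andP[u0 uy]; have u1 : u < 1 by lra.
  have d1 := is_derive_add (is_derive_ln1B u1) (is_derive_id u 1).
  exact: is_derive_add (is_derive_add d1 (is_derive_cX (2^-1) 1 u)) (is_derive_Xn 2 u).
have := le_of_derive_ge0 y0 df.
rewrite /f subr0 ln1 !expr0n/= mulr0 !addr0 => h.
suff : 0 <= ln (1 - y) + y + 2^-1 * y ^+ 2 + y ^+ 3 by lra.
apply: h => u /andP[u0 uy].
have d0 : 0 < 1 - u by lra.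
rewrite (_ : _ + _ = u ^+ 2 * (2 - 3 * u) / (1 - u)); last by field; rewrite gt_eqF.
by rewrite divr_ge0 ?mulr_ge0 ?sqr_ge0 ?(ltW d0)//; lra.
Qed.

Let is_derive_expN (u : R) : is_derive u 1 (fun v : R => expR (- v)) (- expR (- u)).
Proof.
have dN : is_derive u 1 (fun v : R => - v) (-1) by exact: is_deriveN (is_derive_id u 1).
have := is_derive_compose (f := @expR R) (g := fun v : R => - v) (is_derive_expR _) dN.
by rewrite mulrN1.
Qed.

Lemma expRN_le z : 0 <= z -> expR (- z) <= 1 - z + z ^+ 2 / 2.
Proof.
move=> z0; pose f v : R := 1 + (- v) + 2^-1 * v ^+ 2 + - expR (- v).
have df (u : R) : 0 <= u <= z -> is_derive u 1 f (0 + (- 1) + 2^-1 * (2 * u ^+ 1) + - - expR (- u)).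
  move=> _; have d1 : is_derive u 1 (fun v : R => - v) (- 1).
    exact: is_deriveN (is_derive_id u 1).
  have d2 : is_derive u 1 (fun v : R => - expR (- v)) (- - expR (- u)).
    exact: is_deriveN (is_derive_expN u).
  have d3 := is_derive_add (is_derive_const 1 u) d1.
  exact: is_derive_add (is_derive_add d3 (is_derive_cX (2^-1) 1 u)) d2.
have := le_of_derive_ge0 z0 df.
rewrite /f oppr0 expR0 expr0n/= mulr0 !addr0 subrr => h.
suff : 0 <= 1 - z + 2^-1 * z ^+ 2 - expR (- z) by lra.
by apply: h => u _; rewrite expr1; have := expR_ge1Dx (- u); lra.
Qed.

Lemma expRN_ge z : 0 <= z -> 1 - z + z ^+ 2 / 2 - z ^+ 3 / 6 <= expR (- z).
Proof.
move=> z0; pose f v : R := expR (- v) + (- 1) + v + (- 2^-1) * v ^+ 2 + 6^-1 * v ^+ 3.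
have df (u : R) : 0 <= u <= z ->
    is_derive u 1 f (- expR (- u) + 0 + 1 + (- 2^-1) * (2 * u ^+ 1) + 6^-1 * (3 * u ^+ 2)).
  move=> _; have d1 := is_derive_add (is_derive_expN u) (is_derive_const (- 1) u).
  have d2 := is_derive_add (is_derive_add d1 (is_derive_id u 1)) (is_derive_cX (- 2^-1) 1 u).
  exact: is_derive_add d2 (is_derive_cX (6^-1) 2 u).
have := le_of_derive_ge0 z0 df.
rewrite /f oppr0 expR0 !expr0n/= !mulr0 !addr0 subrr => h.
suff : 0 <= expR (- z) - 1 + z + - 2^-1 * z ^+ 2 + 6^-1 * z ^+ 3 by lra.
by apply: h => u /andP[u0 _]; rewrite expr1; have := expRN_le u0; lra.
Qed.

Lemma sum_sqr_le n (F : 'I_n -> R) : (forall i, 0 <= F i) ->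
  \sum_i F i ^+ 2 <= (\sum_i F i) ^+ 2.
Proof.
move=> F0; rewrite [leRHS]expr2 mulr_suml; apply: ler_sum => i _.
by rewrite expr2 ler_wpM2l// (bigD1 i)//= lerDl sumr_ge0.
Qed.

Lemma sum_cube_le n (F : 'I_n -> R) : (forall i, 0 <= F i) ->
  \sum_i F i ^+ 3 <= (\sum_i F i) ^+ 3.
Proof.
move=> F0; rewrite [leRHS]exprS mulr_suml; apply: ler_sum => i _.
rewrite exprS ler_wpM2l// lerXn2r ?nnegrE ?sumr_ge0//.
by rewrite (bigD1 i)//= lerDl sumr_ge0.
Qed.

(** With S the sum and z minus the logarithm of the product: beta bounds the third-order part of z,
    3/2 beta^2 the replacement of z^2 / 2 by (beta S)^2 / 2, and 2 beta^3 covers the remainder z^3 /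
    6, where z <= 2 beta S. *)
Definition expansion_const beta : R := beta + 3 / 2 * beta ^+ 2 + 2 * beta ^+ 3.

(** The product is [expR (- z)] with [z] minus beta times a sum of logarithms. Sums of squares and
    cubes are bounded by powers of the sum, which makes the constant independent of [n]. *)
Lemma prod_powR_expansion n (F : 'I_n -> R) beta : 0 < beta ->
  (forall i, 0 <= F i) -> \sum_i F i <= 1 / 2 ->
  `|\prod_i `|1 - F i| `^ beta - (1 - beta * \sum_i F i + beta ^+ 2 / 2 * (\sum_i F i) ^+ 2
     - beta / 2 * \sum_i F i ^+ 2)| <= expansion_const beta * (\sum_i F i) ^+ 3.
Proof.
move=> b0 F0 FS.
have FiS i : F i <= \sum_i F i by rewrite (bigD1 i)//= lerDl sumr_ge0.
pose z := - (beta * \sum_i ln (1 - F i)).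
have -> : \prod_i `|1 - F i| `^ beta = expR (- z).
  rewrite /z opprK mulr_sumr expR_sum; apply: eq_bigr => i _.
  have d0 : 0 < 1 - F i by rewrite subr_gt0; have := FiS i; lra.
  by rewrite gtr0_norm// /powR gt_eqF.
have S20 : 0 <= \sum_i F i ^+ 2 by apply: sumr_ge0 => i _; exact: sqr_ge0.
have S2le := sum_sqr_le F0; have S3le := sum_cube_le F0.
have S0 : 0 <= \sum_i F i by apply: sumr_ge0.
have Li i : - F i - F i ^+ 2 / 2 - F i ^+ 3 <= ln (1 - F i) <= - F i - F i ^+ 2 / 2.
  have Fi : 0 <= F i <= 1 / 2 by rewrite F0/= (le_trans (FiS i)).
  by rewrite ln1B_ge ?ln1B_le.
have zlo : beta * (\sum_i F i + (\sum_i F i ^+ 2) / 2) <= z.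
  rewrite /z -mulrN ler_wpM2l ?(ltW b0)// lerNr opprD -sumrN mulr_suml -sumrN -big_split/=.
  by apply: ler_sum => i _; have /andP[] := Li i.
have zhi : z <= beta * (\sum_i F i + (\sum_i F i ^+ 2) / 2 + \sum_i F i ^+ 3).
  rewrite /z -mulrN ler_wpM2l ?(ltW b0)// lerNl !opprD -!sumrN mulr_suml -sumrN -!big_split/=.
  by apply: ler_sum => i _; have /andP[] := Li i.
move: zlo zhi S2le S3le S0 FS S20; rewrite /expansion_const; move: z.
move: (\sum_i F i) (\sum_i F i ^+ 2) (\sum_i F i ^+ 3) => S S2 S3 z zlo zhi S2le S3le S0 S1 S20.
have SS : S ^+ 2 <= S / 2 by rewrite expr2 [leRHS]mulrC ler_wpM2r// -div1r.
have S3S : S ^+ 3 <= S ^+ 2 / 2 by rewrite exprS [leRHS]mulrC ler_wpM2r ?sqr_ge0// -div1r.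
have S30 : 0 <= S ^+ 3 by rewrite exprn_ge0.
have w0 : 0 <= z - beta * (S + S2 / 2) by rewrite subr_ge0.
have w1 : z - beta * (S + S2 / 2) <= beta * S ^+ 3.
  have := ler_wpM2l (ltW b0) S3le; have := zhi; lra.
have zS0 : 0 <= z - beta * S.
  by have := mulr_ge0 (ltW b0) S20; lra.
have zS1 : z - beta * S <= beta * S ^+ 2.
  have := ler_wpM2l (ltW b0) S2le; have := ler_wpM2l (ltW b0) S3S; lra.
have z2S : z <= 2 * beta * S.
  by have := ler_wpM2l (ltW b0) SS; have := mulr_ge0 (ltW b0) S0; lra.
have bS0 : 0 <= beta * S by rewrite mulr_ge0// ltW.
have z0 : 0 <= z by lra.
have zz : 0 <= z ^+ 2 - (beta * S) ^+ 2 <= 3 * beta ^+ 2 * S ^+ 3.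
  rewrite subr_sqr mulr_ge0//=; last by rewrite addr_ge0.
  apply: (@le_trans _ _ ((beta * S ^+ 2) * (3 * beta * S))).
    by apply: ler_pM => //; [rewrite addr_ge0|lra].
  by apply: eq_ler; ring.
have z3 : z ^+ 3 <= 8 * beta ^+ 3 * S ^+ 3.
  apply: (@le_trans _ _ ((2 * beta * S) ^+ 3)); first by rewrite lerXn2r ?nnegrE//; lra.
  by apply: eq_ler; ring.
have := expRN_le z0; have := expRN_ge z0.
have b3 : 0 <= beta ^+ 3 * S ^+ 3 by rewrite mulr_ge0// exprn_ge0// ltW.
have b2 : 0 <= beta ^+ 2 * S ^+ 3 by rewrite mulr_ge0// sqr_ge0.
have b1 : 0 <= beta * S ^+ 3 by rewrite mulr_ge0// ltW.
case/andP: zz => zz0 zz1 e1 e2.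
have E : (beta * S) ^+ 2 = beta ^+ 2 * S ^+ 2 by ring.
rewrite E in zz0 zz1.
have bS2 : beta * S2 <= beta * S ^+ 2 by rewrite ler_wpM2l// ltW.
rewrite ler_norml; apply/andP; split; lra.
Qed.

End elementary_expansion.

(** * Pointwise expansion of the symmetrised weight *)

Section symmetric_expansion.
Context {R : realType} (beta : R) (n : nat).
Implicit Types (x : 'I_n -> R).
Local Notation W := (@weight R beta n).
Local Notation V := (@vander R beta n).
Local Notation A := (@cosecS R n).
Local Notation wmean := (@wmean R beta n).
Local Notation T := (@moment_const R beta n).
Local Notation Z := (wmean (fun=> 1)).
Hypothesis beta_gt : 3 / 2 < beta.
Hypothesis n_gt0 : (0 < n)%N.
Variables (s v r : R).
Hypothesis r_ge1 : 1 <= r.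
Hypothesis r_le2 : r <= 2.

Hypothesis s_def : s = sin (v / 2) ^+ 2.
Hypothesis s_gt0 : 0 < s.

Let beta_gt0 : 0 < beta. Proof. by have := beta_gt; lra. Qed.

(* The numerator of the mean, after a rotation that makes it even in [v]. *)
Definition pair_weight x : R := V x * (shifted_radial beta v x * shifted_radial beta (- v) x).

(** This is sin(a - b) sin(a + b) = sin(a)^2 - sin(b)^2. The absolute value serves the angles closer
    to 0 than [v], where the difference is negative. *)
Lemma chordp_pair (t : R) : sin (t / 2) != 0 ->
  chordp beta (t - v) * chordp beta (t + v) =
  chordp (2 * beta) t * `|1 - s * cosec2 t| `^ beta.
Proof.
move=> t0; rewrite !chordpE -powRM ?mulr_ge0//.
rewrite (mulrC 2 beta) [X in _ = X * _](_ : _ = ((2 * `|sin (t / 2)|) ^+ 2) `^ beta); last first.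
  by rewrite -powR_mulrn ?mulr_ge0// -powRrM mulrC.
rewrite -powRM ?sqr_ge0//; congr (_ `^ _).
have -> : (t - v) / 2 = t / 2 - v / 2 by ring.
have -> : (t + v) / 2 = t / 2 + v / 2 by ring.
rewrite sinB sinD.
have := cos2Dsin2 (t / 2); have := cos2Dsin2 (v / 2).
rewrite s_def /cosec2; move: t0.
set a := sin (t / 2); set b := cos (t / 2); set c := sin (v / 2); set d := cos (v / 2).
move=> a0 h1 h2.
rewrite exprMn real_normK ?num_real// mulrACA -normrM.
have -> : (a * d - b * c) * (a * d + b * c) = a ^+ 2 * (1 - c ^+ 2 * a ^- 2).
  have -> : (a * d - b * c) * (a * d + b * c) = a ^+ 2 * d ^+ 2 - b ^+ 2 * c ^+ 2 by ring.
  have -> : d ^+ 2 = 1 - c ^+ 2 by have := h1; lra.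
  have -> : b ^+ 2 = 1 - a ^+ 2 by have := h2; lra.
  by field.
by rewrite normrM [`|a ^+ 2|]ger0_norm ?sqr_ge0//; ring.
Qed.

Lemma pair_weightE x : regular x ->
  pair_weight x = W x * \prod_i `|1 - s * cosec2 (x i)| `^ beta.
Proof.
move=> rx; rewrite /pair_weight /weight -mulrA; congr (_ * _).
rewrite /shifted_radial /radial -!big_split/=; apply: eq_bigr => i _.
by rewrite opprK chordp_pair.
Qed.

Definition far x : bool := (radial beta x == 0) || (1 / 4 < s * A x).

Lemma not_far x : ~~ far x -> regular x /\ s * A x <= 1 / 4.
Proof.
rewrite negb_or -leNgt => /andP[rx ->]; split=> //.
by apply: contrapT => /(not_regular_radial beta_gt) r0; rewrite r0 eqxx in rx.
Qed.

(* Of order [(s * A) `^ (1 + r)] where [s * A <= 1], and [s * A] elsewhere. *)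
Definition expansion_rest x : R := s * (A x * (s `^ r * truncpow s r (A x))).

Let A0 x : regular x -> 0 < A x := cosecS_gt0 (Ordinal n_gt0).

Lemma expansion_rest_ge0 x : 0 <= expansion_rest x.
Proof.
by rewrite /expansion_rest !mulr_ge0 ?cosecS_ge0 ?(ltW s_gt0)// /truncpow powR_ge0.
Qed.

Lemma expansion_restE x : regular x ->
  expansion_rest x = s * A x * (s * A x / (1 + s * A x)) `^ r.
Proof.
move=> rx; have a0 := A0 rx.
have y0 : 0 < A x / (1 + s * A x) by rewrite divr_gt0// addr_gt0 ?mulr_gt0.
rewrite /expansion_rest /truncpow -powRM ?(ltW s_gt0) ?(ltW y0)//.
by rewrite !mulrA.
Qed.

(** The map y / (1 + y) is increasing, and as its value at [k] is at most 1, [r <= 2] bounds the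
    power below by a square. *)
Lemma expansion_rest_far (k : R) x : 0 < k -> k <= 1 -> regular x -> k <= s * A x ->
  (k / (1 + k)) ^+ 2 * (s * A x) <= expansion_rest x.
Proof.
move=> k0 k1 rx ky; rewrite expansion_restE//.
move: ky; move: (s * A x) => y ky.
have y0 : 0 < y by apply: lt_le_trans ky.
rewrite mulrC ler_wpM2l ?(ltW y0)//.
have q0 : 0 < k / (1 + k) by rewrite divr_gt0// addr_gt0.
have q1 : k / (1 + k) <= 1 by rewrite ler_pdivrMr ?addr_gt0// mul1r lerDr.
apply: (@le_trans _ _ ((k / (1 + k)) `^ r)).
  by rewrite -powR_mulrn ?(ltW q0)//; apply: ger_powR; rewrite ?q0.
apply: ge0_ler_powR; rewrite ?nnegrE ?(ltW q0)//.
- by have := r_ge1; lra.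
- by rewrite divr_ge0 ?(ltW y0)// addr_ge0// ltW.
rewrite ler_pdivrMr ?addr_gt0// mulrAC ler_pdivlMr ?addr_gt0//.
by rewrite !mulrDr !mulr1 [y * k]mulrC lerD2r.
Qed.

(** For y = s A <= 1 and r <= 2 one has y^2 <= y^r = (1 + y)^r (y / (1 + y))^r, and the first factor
    is at most 2^2. *)
Lemma expansion_rest_near x : regular x -> s * A x <= 1 ->
  (s * A x) ^+ 3 <= 4 * expansion_rest x.
Proof.
move=> rx y1; rewrite expansion_restE//.
have y0 : 0 < s * A x by rewrite mulr_gt0// A0.
move: y0 y1; move: (s * A x) => y y0 y1.
rewrite exprS [leRHS]mulrCA ler_wpM2l ?(ltW y0)//.
have d0 : 0 < 1 + y by rewrite addr_gt0.
have q0 : 0 < y / (1 + y) by rewrite divr_gt0.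
apply: (@le_trans _ _ (y `^ r)).
  by rewrite -powR_mulrn ?(ltW y0)//; apply: ger_powR; rewrite ?y0.
have {1}-> : y = (1 + y) * (y / (1 + y)) by field; rewrite gt_eqF.
rewrite powRM ?(ltW d0) ?(ltW q0)// ler_wpM2r ?powR_ge0//.
apply: (@le_trans _ _ (2 `^ r)).
  apply: ge0_ler_powR; rewrite ?nnegrE ?(ltW d0)//; last by lra.
  by have := r_ge1; lra.
apply: (@le_trans _ _ (2 `^ 2)); first by apply: ler_powR => //; rewrite ler1n.
by rewrite powR_mulrn// expr2 -natrM.
Qed.

(** The cutoff makes the quadratic term admissible; where s A is small, removing it costs only third
    order in s A. *)
Definition near_main x : R := 1 - beta * s * A x +
  s ^+ 2 * ((beta ^+ 2 / 2 * A x ^+ 2 - beta / 2 * cosec2S x) * cutoff s (A x)).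

(** The 4 is that of [expansion_rest_near]; the 25 is the inverse square of (1/4) / (1 + 1/4), from
    [expansion_rest_far] at k = 1/4. *)
Definition pointwise_const : R :=
  4 * (expansion_const beta + beta ^+ 2 + beta) + 25 * (4 + beta + 2 * (beta ^+ 2 + beta)).

(** Off the far set the expansion error and the removal of the cutoff are both of order (s A)^3. On
    it [near_main] is of order s A, hence bounded by [expansion_rest], and [pair_weight] is kept as
    it stands, to be handled in the mean. *)
Lemma pair_weight_near x :
  `|pair_weight x - W x * near_main x| <=
  W x * (pointwise_const * expansion_rest x) + pair_weight x * (far x)%:R.
Proof.
have pw0 : 0 <= pair_weight x.
  by rewrite mulr_ge0 ?vander_ge0// mulr_ge0 ?shifted_radial_ge0.
have W0 := weight_ge0 beta x.
have C0 : 0 <= expansion_const beta.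
  by rewrite !addr_ge0 ?mulr_ge0 ?exprn_ge0 ?(ltW beta_gt0).
have bb0 : 0 <= beta ^+ 2 + beta by rewrite addr_ge0 ?sqr_ge0 ?(ltW beta_gt0).
have er0 := expansion_rest_ge0 x.
have [rx|rx] := pselect (regular x); last first.
  rewrite (not_regular_weight beta_gt)// !mul0r subr0 add0r ger0_norm//.
  by rewrite /far (not_regular_radial beta_gt rx) eqxx mulr1.
have a0 := A0 rx; have y0 : 0 < s * A x by rewrite mulr_gt0.
have chi0 := cutoff_gt0 s_gt0 a0.
have quad : `|s ^+ 2 * (beta ^+ 2 / 2 * A x ^+ 2 - beta / 2 * cosec2S x)| <=
    (beta ^+ 2 + beta) / 2 * (s * A x) ^+ 2.
  have p0 := cosec2S_ge0 x; have p1 := cosec2S_le x.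
  rewrite (normrM (s ^+ 2)) (ger0_norm (sqr_ge0 s)) exprMn [leRHS]mulrCA ler_wpM2l ?sqr_ge0//.
  have := ler_wpM2l (ltW beta_gt0) p1; have := mulr_ge0 (ltW beta_gt0) p0.
  have := mulr_ge0 (sqr_ge0 beta) (sqr_ge0 (A x)).
  have := mulr_ge0 (ltW beta_gt0) (sqr_ge0 (A x)).
  by move=> h1 h2 h3 h4; rewrite ler_norml; apply/andP; split; lra.
have [fx|nfx] := boolP (far x).
  have y1 : 1 / 4 < s * A x.
    by move: fx; rewrite /far (negbTE (regular_radial beta rx)).
  rewrite mulr1n mulr1 [leRHS]addrC; apply: (le_trans (ler_normB _ _)).
  rewrite ger0_norm// lerD2l normrM ger0_norm// ler_wpM2l//.
  have h : s * A x <= 25 * expansion_rest x.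
    have k0 : 0 < 1 / 4 :> R by lra.
    have k1 : 1 / 4 <= 1 :> R by lra.
    have := expansion_rest_far k0 k1 rx (ltW y1).
    by rewrite (_ : (1 / 4 / (1 + 1 / 4)) ^+ 2 = 25^-1 :> R); [lra|field].
  apply: (@le_trans _ _ ((4 + beta + 2 * (beta ^+ 2 + beta)) * (s * A x))).
    rewrite /near_main; apply: (le_trans (ler_normD _ _)).
    (* As [1 / 4 < s * A x], the constant 1 is charged to [4 * (s * A x)]. *)
    have t1 : `|1 - beta * s * A x| <= 4 * (s * A x) + beta * (s * A x).
      have := mulr_ge0 (ltW beta_gt0) (ltW y0) => b1.
      by rewrite ler_norml; apply/andP; split; lra.
    have t2 : `|s ^+ 2 * ((beta ^+ 2 / 2 * A x ^+ 2 - beta / 2 * cosec2S x) * cutoff s (A x))|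
       <= 2 * (beta ^+ 2 + beta) * (s * A x).
      rewrite mulrA normrM (gtr0_norm chi0).
      apply: (le_trans (ler_wpM2r (ltW chi0) quad)).
      have sq := sqa_cutoff_le1 s_gt0 a0.
      have := ler_wpM2l bb0 sq; have := ler_wpM2l bb0 (ltW y1); lra.
    lra.
  have k0 : 0 <= 4 + beta + 2 * (beta ^+ 2 + beta) by have := beta_gt0; lra.
  have := ler_wpM2l k0 h; have := mulr_ge0 C0 er0; have := mulr_ge0 bb0 er0.
  rewrite /pointwise_const; lra.
have [_ y1] := not_far nfx.
rewrite mulr0 addr0 pair_weightE// -mulrBr normrM ger0_norm// ler_wpM2l//.
have h : `|\prod_i `|1 - s * cosec2 (x i)| `^ beta - (1 - beta * (s * A x) +
   beta ^+ 2 / 2 * (s * A x) ^+ 2 - beta / 2 * (s ^+ 2 * cosec2S x))| <=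
   expansion_const beta * (s * A x) ^+ 3.
  have := @prod_powR_expansion R n (fun i => s * cosec2 (x i)) beta beta_gt0.
  under [X in beta / 2 * X]eq_bigr do rewrite exprMn.
  rewrite -!mulr_sumr -/(A x) -/(cosec2S x); apply => [i|].
    by rewrite mulr_ge0 ?cosec2_ge0// ltW.
  lra.
have h2 : `|s ^+ 2 * (beta ^+ 2 / 2 * A x ^+ 2 - beta / 2 * cosec2S x) * (1 - cutoff s (A x))| <=
   (beta ^+ 2 + beta) * (s * A x) ^+ 3.
  have c1 : 0 <= 1 - cutoff s (A x) <= 2 * (s * A x).
    rewrite subr_ge0 cutoff_le1//=.
    have d0 : 0 < 1 + s * A x by rewrite addr_gt0.
    rewrite /cutoff -subr_ge0.
    rewrite (_ : _ - _ = (s * A x) ^+ 2 * (3 + 2 * (s * A x)) / (1 + s * A x) ^+ 2); last first.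
      by field; rewrite gt_eqF.
    by rewrite divr_ge0 ?sqr_ge0// mulr_ge0 ?sqr_ge0//; lra.
  case/andP: c1 => c10 c11.
  rewrite normrM (ger0_norm c10).
  apply: (@le_trans _ _ ((beta ^+ 2 + beta) / 2 * (s * A x) ^+ 2 * (2 * (s * A x)))).
    by apply: ler_pM.
  by apply: eq_ler; field.
have y11 : s * A x <= 1 by lra.
have h3 := expansion_rest_near rx y11.
apply: (@le_trans _ _ ((expansion_const beta + (beta ^+ 2 + beta)) * (s * A x) ^+ 3)).
  rewrite mulrDl.
  apply: (le_trans _ (lerD h h2)); apply: (le_trans _ (ler_normD _ _)).
  by apply: eq_ler; congr `|_|; rewrite /near_main; ring.
have k0 : 0 <= expansion_const beta + (beta ^+ 2 + beta) by rewrite addr_ge0.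
have := ler_wpM2l k0 h3; have := mulr_ge0 (ltW beta_gt0) er0; have := mulr_ge0 bb0 er0.
rewrite /pointwise_const; lra.
Qed.

End symmetric_expansion.

(** * Expansion of the mean of the symmetrised weight *)

Section mean_expansion.
Context {R : realType} (beta : R) (n : nat).
Implicit Types (x : 'I_n -> R).
Local Notation W := (@weight R beta n).
Local Notation V := (@vander R beta n).
Local Notation A := (@cosecS R n).
Local Notation wmean := (@wmean R beta n).
Local Notation Z := (wmean (fun=> 1)).
Hypothesis beta_gt : 3 / 2 < beta.
Hypothesis n_gt0 : (0 < n)%N.
Variables (s v r : R).
Hypothesis r_ge1 : 1 <= r.
Hypothesis r_le2 : r <= 2.
Hypothesis r_lt : r < beta - 2^-1.
Hypothesis v_le : `|v| <= 2 * pi.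
Hypothesis s_def : s = sin (v / 2) ^+ 2.
Hypothesis s_gt0 : 0 < s.
Local Notation pw := (@pair_weight R beta n v).
Local Notation rest := (@expansion_rest R n s r).
Local Notation near_main' := (@near_main R beta n s).
Local Notation farR := (fun x => ((@far R beta n s x)%:R : R)).

Let beta_gt0 : 0 < beta. Proof. by have := beta_gt; lra. Qed.
Let r_ge0 : 0 <= r. Proof. by have := r_ge1; lra. Qed.

(* [16 * 17 ^ 2], from [expansion_rest_far] at [k = 1 / 16]. *)
Definition far_const : R := 4624.
Let far_const_ge0 : 0 <= far_const. Proof. exact: ler0n. Qed.

(** The bound on s gives |sin(u / 2)| <= |sin(t / 2)| / 4 and |cos(u / 2)| >= 3/4, so by the
    addition formula the sine at the rotated angle is at least (3/4 - 1/4) |sin(t / 2)|. *)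
Lemma cosec2_rotate_le (u t : R) : sin (u / 2) ^+ 2 = s -> sin (t / 2) != 0 ->
  s * cosec2 t <= 1 / 16 ->
  sin ((t + u) / 2) != 0 /\ cosec2 (t + u) <= 4 * cosec2 t.
Proof.
move=> su t0 st; rewrite /cosec2 (_ : (t + u) / 2 = t / 2 + u / 2); last by ring.
rewrite sinD.
have := cos2Dsin2 (t / 2); have := cos2Dsin2 (u / 2).
move: st su t0; rewrite /cosec2.
set a := sin (t / 2); set b := cos (t / 2); set c := sin (u / 2); set d := cos (u / 2).
move=> st su a0 hd hb.
have a2 : 0 < a ^+ 2 by rewrite exprn_even_gt0.
have s16 : 16 * s <= a ^+ 2 by move: st; rewrite ler_pdivrMr//; lra.
have a21 : a ^+ 2 <= 1 by have := sqr_ge0 b; lra.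
have cle : `|c| <= `|a| / 4.
  rewrite -(@ler_pXn2r _ 2)// ?nnegrE ?divr_ge0//.
  by rewrite expr_div_n !real_normK ?num_real// su; lra.
have dge : 3 / 4 <= `|d|.
  rewrite -(@ler_pXn2r _ 2)// ?nnegrE ?divr_ge0//.
  by rewrite real_normK ?num_real// expr_div_n; have := su; lra.
have ble : `|b| <= 1.
  rewrite -(@ler_pXn2r _ 2)// ?nnegrE// real_normK ?num_real// expr1n.
  by have := sqr_ge0 a; lra.
have an : 0 < `|a| by rewrite normr_gt0.
have key : `|a| / 2 <= `|a * d + b * c|.
  have h1 : `|a| * (3 / 4) <= `|a * d| by rewrite normrM ler_wpM2l.
  have h2 : `|b * c| <= 1 * (`|a| / 4) by rewrite normrM; apply: ler_pM.
  have h3 : `|a * d| - `|b * c| <= `|a * d + b * c|.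
    by have := ler_normB (a * d + b * c) (b * c); rewrite addrK; lra.
  lra.
have k0 : 0 < `|a * d + b * c| by apply: lt_le_trans key; rewrite divr_gt0.
split; first by rewrite -normr_gt0.
have k2 : a ^+ 2 / 4 <= (a * d + b * c) ^+ 2.
  rewrite -(real_normK (num_real (a * d + b * c))) -(real_normK (num_real a)).
  have -> : `|a| ^+ 2 / 4 = (`|a| / 2) ^+ 2 by field.
  by rewrite lerXn2r ?nnegrE ?divr_ge0.
rewrite -[a ^- 2]mul1r -[X in X <= _]mul1r.
have k20 : 0 < (a * d + b * c) ^+ 2 by apply: lt_le_trans k2; rewrite divr_gt0.
rewrite ler_pdivrMr// mulrAC mulrA ler_pdivlMr//; lra.
Qed.

(** The factor 4 of [cosec2_rotate_le] turns the threshold 1/16 into the 1/4 of [far]. *)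
Lemma rotate_not_far (u : R) x : sin (u / 2) ^+ 2 = s -> regular x ->
  s * A x <= 1 / 16 -> ~~ far beta s (fun i => x i + u).
Proof.
move=> su rx sA.
have h i : sin ((x i + u) / 2) != 0 /\ cosec2 (x i + u) <= 4 * cosec2 (x i).
  apply: cosec2_rotate_le => //; apply: le_trans sA.
  by rewrite ler_wpM2l ?(ltW s_gt0)// cosec2_le_cosecS.
have rx' : regular (fun i => x i + u) by move=> i; have [] := h i.
rewrite /far negb_or regular_radial//= -leNgt.
apply: (@le_trans _ _ (s * (4 * A x))); last by rewrite mulrCA; lra.
rewrite ler_wpM2l ?(ltW s_gt0)// mulr_sumr; apply: ler_sum => i _.
by have [] := h i.
Qed.

Lemma measurable_far : measurable_fun setT (tuple_fun farR).
Proof.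
rewrite (_ : (fun x : n.-tuple R => _) =
  fun x : n.-tuple R => if far beta s (tnth x) then 1 else 0 : R); last first.
  by apply/funext => y; case: far.
apply: measurable_fun_ifT => //; apply: measurable_or.
  by apply: measurable_fun_eqr => //; exact: measurable_radial.
apply: measurable_fun_ltr => //; apply: measurable_funM => //; exact: measurable_cosecS.
Qed.

Lemma periodic_far : shift_periodic farR.
Proof. by move=> x j; rewrite /far periodic_radial periodic_cosecS. Qed.

Lemma shifted_radial_sqr (u : R) x :
  shifted_radial (2 * beta) u x = shifted_radial beta u x ^+ 2.
Proof. by rewrite /shifted_radial -prodrXl; apply: eq_bigr => i _; exact: chordp_double. Qed.

(** From a b <= (a^2 + b^2) / 2: the pair is replaced by two singly shifted weights, each of which a
    rotation takes back to [W]. *)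
Lemma pair_weight_le x : pw x <=
  2^-1 * (V x * shifted_radial (2 * beta) v x) + 2^-1 * (V x * shifted_radial (2 * beta) (- v) x).
Proof.
rewrite /pair_weight !shifted_radial_sqr !(mulrCA 2^-1) -mulrDr ler_wpM2l ?vander_ge0//.
move: (shifted_radial beta v x) (shifted_radial beta (- v) x) => a b.
by have := sqr_ge0 (a - b); rewrite sqrrB; lra.
Qed.

Let bound2 := \prod_(i < n) (2 : R) `^ (2 * beta).

Let b2 : 0 <= 2 * beta. Proof. by rewrite mulr_ge0// ltW. Qed.

Let far01 x : 0 <= farR x <= 1. Proof. by rewrite /=; case: (far beta s x); rewrite /= ?lexx ?ler01. Qed.

Let shf (u : R) x := shifted_radial (2 * beta) u x * farR x.

Let sh_far (u : R) x : `|shf u x| <= bound2.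
Proof.
have /andP[f0 f1] := far01 x.
rewrite ger0_norm ?mulr_ge0 ?shifted_radial_ge0//.
apply: (@le_trans _ _ (shifted_radial (2 * beta) u x)); last exact: shifted_radial_le.
by rewrite ler_piMr ?shifted_radial_ge0.
Qed.

Let m_sh_far (u : R) : measurable_fun setT (tuple_fun (shf u)).
Proof. by apply: measurable_funM; [exact: measurable_shifted_radial|exact: measurable_far]. Qed.

Let restE : rest = fun x => s * s `^ r * (A x * truncpow s r (A x)).
Proof. by apply/funext => x; rewrite /expansion_rest; ring. Qed.

Lemma admissible_rest : admissible rest.
Proof. by rewrite restE; apply: admissibleZ; exact: admissible_A_truncpow. Qed.

Lemma wmean_rest_le : wmean rest <= s ^+ 2 * moment_error beta n s r.
Proof.
rewrite restE wmeanZ//; last exact: admissible_A_truncpow.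
have := wmean_A_truncpow_le beta_gt n_gt0 s_gt0 r_ge0 r_lt.
move/(ler_wpM2l (mulr_ge0 (ltW s_gt0) (powR_ge0 s r))) => /le_trans; apply.
rewrite /moment_error -[s `^ r](mulr_powRB1 (ltW s_gt0) (lt_le_trans ltr01 r_ge1)).
by apply: eq_ler; ring.
Qed.

(* A configuration that becomes far after a rotation by [u] has [1 / 16 < s * A],
   where [expansion_rest] is bounded below. *)
Lemma mean_rotated_far_le (u : R) : sin (u / 2) ^+ 2 = s -> `|u| <= 2 * pi ->
  mean (fun x => V x * shf u x) <= far_const * wmean rest.
Proof.
move=> su u2.
have E := @mean_rotate R beta n beta_gt u (shf u) bound2 u2 (@m_sh_far u) (@sh_far u).
have per : shift_periodic (shf u).
  by move=> x j; rewrite /shf periodic_shifted_radial periodic_far.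
have {E} E := E per; apply: (le_trans (_ : _ <= wmean (fun x => far_const * rest x))); last first.
  by rewrite wmeanZ//; exact: admissible_rest.
apply: (le_trans (_ : _ <= mean (fun x => V x * shf u (fun i => x i + u)))); first by rewrite le_eqVlt E eqxx.
apply: bounded_le_Rintegral.
- apply: (@bounded_vander_mul R beta n beta_gt (fun x => shf u (fun i => x i + u)) bound2) => [|x]; last exact: sh_far.
  exact: (measurable_torus_shift (fun=> u) (@m_sh_far u)).
- apply: (admissible_bounded (f := fun x => far_const * rest x) beta_gt).
  by apply: admissibleZ; exact: admissible_rest.
move=> y; rewrite /shf shifted_radial_shift subrr shifted_radial0 mulrA -/(W (tnth y)).
have [rx|rx] := pselect (regular (tnth y)); last by rewrite (not_regular_weight beta_gt)// !mul0r.
rewrite ler_wpM2l ?weight_ge0//.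
have rest0 := expansion_rest_ge0 r s_gt0 (tnth y).
case: (boolP (far beta s (fun i => tnth y i + u))) => [fy|_]; last first.
  by apply: mulr_ge0.
have sA : 1 / 16 < s * A (tnth y).
  by rewrite ltNge; apply/negP => /(rotate_not_far su rx); rewrite fy.
have k0 : 0 < 1 / 16 :> R by lra.
have k1 : 1 / 16 <= 1 :> R by lra.
have := expansion_rest_far n_gt0 r_ge1 r_le2 s_gt0 k0 k1 rx (ltW sA).
rewrite (_ : (1 / 16 / (1 + 1 / 16)) ^+ 2 = 289^-1 :> R); last by field.
rewrite mulr1n /far_const; move: rest0; lra.
Qed.

Let bounded_pair_weight : bounded_mfun (tuple_fun pw).
Proof. exact: bounded_vander_pair. Qed.

Let bounded_farR : bounded_mfun (tuple_fun farR).
Proof.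
split; first exact: measurable_far.
by exists 1 => y; have /andP[f0 f1] := far01 (tnth y); rewrite ger0_norm.
Qed.

Lemma mean_pair_weight_far_le :
  mean (fun x => pw x * farR x) <= far_const * wmean rest.
Proof.
have b1 (u : R) : bounded_mfun (tuple_fun (fun x => V x * shf u x)).
  by apply: (@bounded_vander_mul R beta n beta_gt (shf u) bound2); [exact: m_sh_far|exact: sh_far].
pose g (u : R) x := V x * shf u x.
apply: (le_trans (_ : _ <= \int[torus_prob R n]_x (2^-1 * g v (tnth x) + 2^-1 * g (- v) (tnth x)))).
  apply: bounded_le_Rintegral.
  - exact: bounded_mfunM.
  - by apply: bounded_mfunD; apply: bounded_mfunZ; exact: b1.
  move=> y; rewrite /g /shf !(mulrA (V _)) !(mulrA 2^-1) -mulrDl.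
  have /andP[f0 _] := far01 (tnth y).
  by have := ler_wpM2r f0 (pair_weight_le (tnth y)); rewrite !(mulrA 2^-1).
rewrite bounded_RintegralD; try by apply: bounded_mfunZ; exact: b1.
rewrite !bounded_RintegralZ; try exact: b1.
have h1 : mean (g v) <= far_const * wmean rest := @mean_rotated_far_le v (esym s_def) v_le.
have h2 : mean (g (- v)) <= far_const * wmean rest.
  by apply: mean_rotated_far_le; rewrite ?normrN// mulNr sinN sqrrN.
move: h1 h2; move: (mean (g v)) (mean (g (- v))) (far_const * wmean rest) => a b c; lra.
Qed.

Let second x := (beta ^+ 2 / 2 * A x ^+ 2 - beta / 2 * cosec2S x) * cutoff s (A x).

Let admissible_second : admissible second.
Proof.
rewrite (_ : second = fun x => beta ^+ 2 / 2 * (A x ^+ 2 * cutoff s (A x)) -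
    beta / 2 * (cosec2S x * cutoff s (A x))); last by apply/funext => x; rewrite /second; ring.
apply: admissibleB; apply: admissibleZ.
- exact: admissible_sqr_cutoff.
- exact: admissible_cosec2S_cutoff.
Qed.

Let near_mainE : @near_main R beta n s =
  fun x => (1 + (- (beta * s)) * A x) + s ^+ 2 * second x.
Proof. by apply/funext => x; rewrite /near_main /second; ring. Qed.

Let adm1 : admissible (fun x => 1 + (- (beta * s)) * A x).
Proof. by apply: admissibleD; [exact: admissible_cst|apply: admissibleZ; exact: admissibleA]. Qed.

Lemma admissible_near_main : admissible near_main'.
Proof. by rewrite near_mainE; apply: admissibleD => //; exact: admissibleZ. Qed.

Lemma wmean_near_main : wmean near_main' = Z - beta * s * wmean A + s ^+ 2 * wmean second.
Proof.
rewrite near_mainE wmeanD//; last exact: admissibleZ.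
rewrite wmeanZ// wmeanD//; [|exact: admissible_cst|by apply: admissibleZ; exact: admissibleA].
by rewrite wmeanZ ?mulNr//; exact: admissibleA.
Qed.

Definition mean_const : R := pointwise_const beta + far_const + second_const beta.

Definition mean_main : R :=
  1 - beta * s * (mean_slope beta * n%:R ^+ 2 + 4 * mean_slope beta * n%:R)
    + s ^+ 2 * (second_slope beta * n%:R ^+ 4).

(** Integrates [pair_weight_near]: the mean of [A] is exact, the quadratic term is known up to
    [wmean_second_bound], and [expansion_rest] and the far part are bounded by multiples of s^2
    times [moment_error]. *)
Lemma mean_pair_weight_bound :
  `|mean pw - mean_main * Z| <=
  mean_const * s ^+ 2 * (moment_error beta n s r + n%:R ^+ 3 * Z).
Proof.
have rest_adm := admissible_rest.
have pc0 : 0 <= pointwise_const beta.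
  rewrite /pointwise_const /expansion_const.
  by rewrite ?(addr_ge0, mulr_ge0, exprn_ge0, ltW beta_gt0).
have bnm := admissible_bounded beta_gt admissible_near_main.
have h1 : `|mean pw - wmean near_main'| <=
    (pointwise_const beta + far_const) * wmean rest.
  pose G y := pw (tnth y) + (-1) * (W (tnth y) * near_main beta s (tnth y)).
  pose E y := W (tnth y) * (pointwise_const beta * rest (tnth y))
       + pw (tnth y) * farR (tnth y).
  have bR : bounded_mfun (fun y : n.-tuple R => W (tnth y) * (pointwise_const beta * rest (tnth y))).
    by apply: (admissible_bounded (f := fun x => pointwise_const beta * rest x) beta_gt); exact: admissibleZ.
  have bG : bounded_mfun G by apply: bounded_mfunD => //; exact: bounded_mfunZ.
  have bE : bounded_mfun E by apply: bounded_mfunD => //; exact: bounded_mfunM.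
  have -> : mean pw - wmean near_main' = \int[torus_prob R n]_y G y.
    rewrite bounded_RintegralD//; last exact: bounded_mfunZ.
    by rewrite bounded_RintegralZ// mulN1r.
  have hE : \int[torus_prob R n]_y E y <= (pointwise_const beta + far_const) * wmean rest.
    rewrite bounded_RintegralD//; last exact: bounded_mfunM.
    rewrite mulrDl; apply: lerD; last exact: mean_pair_weight_far_le.
    by rewrite -wmeanZ.
  have hpt (y : n.-tuple R) : - E y <= G y <= E y.
    have := pair_weight_near beta_gt n_gt0 r_ge1 r_le2 s_def s_gt0 (tnth y).
    by rewrite /G mulN1r ler_norml.
  rewrite ler_norml; apply/andP; split; last first.
    by apply: le_trans hE; apply: bounded_le_Rintegral => // y; have /andP[] := hpt y.
  rewrite lerNl; apply: le_trans hE; rewrite -mulN1r -bounded_RintegralZ//.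
  apply: bounded_le_Rintegral => //; first exact: bounded_mfunZ.
  by move=> y; rewrite mulN1r lerNl; have /andP[] := hpt y.
have h2 := wmean_rest_le.
have h3 := wmean_second_bound beta_gt n_gt0 s_gt0 r_ge1 r_le2 r_lt.
rewrite -/second in h3.
rewrite wmean_near_main (wmean_A_eq beta_gt n_gt0) in h1.
have Z0 : 0 <= Z by apply: wmean_ge0.
have me0 := moment_error_ge0 beta_gt n_gt0 s r_lt.
have nZ : 0 <= n%:R ^+ 3 * Z by rewrite mulr_ge0// exprn_ge0.
have s2 := sqr_ge0 s.
have K0 := addr_ge0 pc0 far_const_ge0.
have k1 := ler_wpM2l K0 h2.
have k2 := ler_wpM2l s2 h3.
have k3 := mulr_ge0 K0 (mulr_ge0 s2 nZ).
rewrite -[X in X * `|_ - _|](ger0_norm s2) -normrM in k2.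
have -> : mean pw - mean_main * Z =
  (mean pw - (Z - beta * s * ((mean_slope beta * n%:R ^+ 2 + 4 * mean_slope beta * n%:R) * Z)
    + s ^+ 2 * wmean second)) + s ^+ 2 * (wmean second - second_slope beta * n%:R ^+ 4 * Z) by rewrite /mean_main; ring.
have -> : mean_const * s ^+ 2 * (moment_error beta n s r + n%:R ^+ 3 * Z) =
    (pointwise_const beta + far_const) * (s ^+ 2 * moment_error beta n s r) +
    (pointwise_const beta + far_const) * (s ^+ 2 * (n%:R ^+ 3 * Z)) +
    s ^+ 2 * (second_const beta * (moment_error beta n s r + n%:R ^+ 3 * Z)).
  by rewrite /mean_const; move: far_const => fc; ring.
apply: (le_trans (ler_normD _ _)); apply: lerD k2.
by apply: (le_trans h1); apply: (le_trans k1); rewrite lerDl; exact: k3.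
Qed.

End mean_expansion.

(** * The truncated mean of the ratio at size [n] *)

Section truncated_mean.
Context {R : realType} (beta : R) (n : nat).
Implicit Types (x : 'I_n -> R).
Local Notation W := (@weight R beta n).
Local Notation V := (@vander R beta n).
Local Notation Z := (@wmean R beta n (fun=> 1)).
Hypothesis beta_gt : 3 / 2 < beta.
Hypothesis n_gt0 : (0 < n)%N.
Variables (y r M : R).
Hypothesis r_ge1 : 1 <= r.
Hypothesis r_le2 : r <= 2.
Hypothesis r_lt : r < beta - 2^-1.
Hypothesis y_neq0 : y != 0.
Hypothesis y_le1 : `|y| <= 1.
Hypothesis M_gt0 : 0 < M.
Hypothesis Z_gt0 : 0 < Z.

Let beta_gt0 : 0 < beta. Proof. by have := beta_gt; lra. Qed.
Let ratio (theta : n.-tuple R) := cmod (char_ratio theta (real_complex R y)) `^ beta.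
Let u := y / n%:R.
Let s := sin (u / 2 / 2) ^+ 2.

Let n1 : 1 <= n%:R :> R. Proof. by rewrite ler1n. Qed.
Let nR : 0 < n%:R :> R. Proof. by rewrite ltr0n. Qed.

Let u_le1 : `|u| <= 1.
Proof.
rewrite /u normrM normfV (gtr0_norm nR) ler_pdivrMr// mul1r.
exact: le_trans n1.
Qed.

Let pi1 : 1 <= pi :> R. Proof. by have := pi_ge2 R; lra. Qed.

Let s_gt0 : 0 < s.
Proof.
rewrite exprn_even_gt0//=; apply/eqP => s0.
have u0 : u != 0 by rewrite mulf_neq0// invr_neq0// gt_eqF.
have uN : `|u / 2 / 2| = `|u| / 4.
  by move: u => w; rewrite !normrM !normfV !(ger0_norm (ler0n R 2)); field.
have : 0 < sin `|u / 2 / 2|.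
  rewrite uN; apply: sin_gt0_pi; apply/andP; split.
    by rewrite divr_gt0// normr_gt0.
  by have := u_le1; have := pi1; lra.
by case: (ger0P (u / 2 / 2)) => _; rewrite ?sinN s0 ?oppr0 ltxx.
Qed.

(** Rotating by half the shift replaces the shifts u and 0 by u / 2 and - u / 2. *)
Lemma mean_ratio : \int[torus_prob R n]_t (W (tnth t) * ratio t) =
  mean (@pair_weight R beta n (u / 2)).
Proof.
pose f x := shifted_radial beta u x * shifted_radial beta 0 x.
have b0 := ltW beta_gt0.
apply: (etrans (y := mean (fun x => V x * f x))).
  by apply: eq_Rintegral => t _; rewrite /ratio weight_char_ratio.
apply: (etrans (esym (mean_rotate beta_gt (v := u / 2) (f := f) _ _
  (shifted_pair_le beta_gt u 0) _))).
- rewrite normrM normfV (ger0_norm (ler0n _ 2)).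
  by have := u_le1; have := pi1; lra.
- by apply: measurable_funM; exact: measurable_shifted_radial.
- by move=> x j; rewrite /f !periodic_shifted_radial.
apply: eq_Rintegral => t _; rewrite /f /pair_weight !shifted_radial_shift.
by rewrite (_ : u - u / 2 = u / 2) ?sub0r//; field.
Qed.

Definition moment_ratio : R := 5 * beta / (2 * (beta - 2^-1 - r)).

Lemma moment_constE : moment_const beta n r = moment_ratio * n%:R ^+ 2.
Proof. by []. Qed.

(** This is n^2 s. In terms of it the powers of [n] in the bounds cancel, up to corrections of order
    1 / n, and it tends to y^2 / 16. *)
Definition scaled_sin : R := n%:R ^+ 2 * sin (y / n%:R / 2 / 2) ^+ 2.

Definition limit_poly (a : R) : R := 1 - beta * mean_slope beta * a + second_slope beta * a ^+ 2.

Lemma mean_ratio_bound :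
  `|\int[torus_prob R n]_t (W (tnth t) * ratio t) -
     (limit_poly scaled_sin - 4 * beta * mean_slope beta * scaled_sin / n%:R) * Z| <=
  mean_const beta * (moment_ratio * scaled_sin * (moment_ratio * scaled_sin) `^ r +
     scaled_sin ^+ 2 / n%:R) * Z.
Proof.
have v2 : `|u / 2| <= 2 * pi.
  rewrite normrM normfV (ger0_norm (ler0n _ 2)).
  by have := u_le1; have := pi1; lra.
have := @mean_pair_weight_bound R beta n beta_gt n_gt0 s (u / 2) r r_ge1 r_le2 r_lt v2 erefl s_gt0.
rewrite -mean_ratio.
have K0 : 0 < moment_ratio by rewrite divr_gt0 ?mulr_gt0//; have := r_lt; lra.
have -> : mean_main beta n s =
  limit_poly scaled_sin - 4 * beta * mean_slope beta * scaled_sin / n%:R.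
  rewrite /mean_main /limit_poly /scaled_sin -/u -/s; field; rewrite gt_eqF//.
have -> // : mean_const beta * s ^+ 2 * (moment_error beta n s r + n%:R ^+ 3 * Z) =
  mean_const beta * (moment_ratio * scaled_sin * (moment_ratio * scaled_sin) `^ r +
     scaled_sin ^+ 2 / n%:R) * Z.
rewrite /moment_error moment_constE /scaled_sin -/u -/s.
have -> : moment_ratio * (n%:R ^+ 2 * s) = s * (moment_ratio * n%:R ^+ 2) by ring.
rewrite [X in _ * X + _]powRM ?(ltW s_gt0)//; last by rewrite mulr_ge0 ?(ltW K0)// sqr_ge0.
rewrite -[s `^ r](mulr_powRB1 (ltW s_gt0) (lt_le_trans ltr01 r_ge1)).
by field; rewrite gt_eqF.
Qed.

Let bounded_W_ratio : bounded_mfun (fun t : n.-tuple R => W (tnth t) * ratio t).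
Proof.
rewrite (_ : (fun t => _) = fun t : n.-tuple R => V (tnth t) *
  (shifted_radial beta u (tnth t) * shifted_radial beta 0 (tnth t))).
  exact: bounded_vander_pair.
by apply/funext => t; rewrite /ratio weight_char_ratio.
Qed.

Let ratio_ge0 t : 0 <= ratio t. Proof. exact: powR_ge0. Qed.

Let bounded_weight : bounded_mfun (tuple_fun W).
Proof. by have := bounded_vander_shifted n beta_gt 0; rewrite shifted_radial0. Qed.

Let minE t : W (tnth t) * Num.min (ratio t) M = Num.min (W (tnth t) * ratio t) (M * W (tnth t)).
Proof. by rewrite [M * _]mulrC minr_pMr ?weight_ge0. Qed.

Let bounded_W_min : bounded_mfun (fun t : n.-tuple R => W (tnth t) * Num.min (ratio t) M).
Proof.
have [m1 [K1 h1]] := bounded_W_ratio.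
rewrite (_ : (fun t => _) = fun t => Num.min (W (tnth t) * ratio t) (M * W (tnth t))); last first.
  by apply/funext => t; exact: minE.
split.
  by apply: measurable_minr => //; apply: measurable_funM => //; exact: bounded_weight.1.
exists K1 => t; rewrite -minE [X in X <= _]ger0_norm; last by rewrite mulr_ge0 ?weight_ge0// le_min ratio_ge0 ltW.
apply: le_trans (h1 t); rewrite ger0_norm; last by rewrite mulr_ge0 ?weight_ge0.
by rewrite ler_wpM2l ?weight_ge0// ge_min lexx.
Qed.

(* [ratio - min ratio M <= ratio ^ 2 / M], and a rotation shows that the mean of
   [W * ratio ^ 2] is at most [Z]. *)
Lemma mean_truncated_bound :
  `|mean_density (@circular_jacobi_weight R beta (2 * beta) n) (fun t => Num.min (ratio t) M) -
     limit_poly scaled_sin| <=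
  `|4 * beta * mean_slope beta * scaled_sin / n%:R| +
  mean_const beta * (moment_ratio * scaled_sin * (moment_ratio * scaled_sin) `^ r +
     scaled_sin ^+ 2 / n%:R) + M^-1.
Proof.
have b0 := ltW beta_gt0.
rewrite /mean_density.
have -> : \int[torus_prob R n]_t circular_jacobi_weight beta (2 * beta) t = Z.
  by apply: eq_Rintegral => t _; rewrite circular_jacobi_weightE mulr1.
have -> : \int[torus_prob R n]_t (circular_jacobi_weight beta (2 * beta) t * Num.min (ratio t) M) =
    \int[torus_prob R n]_t (W (tnth t) * Num.min (ratio t) M).
  by apply: eq_Rintegral => t _; rewrite circular_jacobi_weightE.
set m := \int[torus_prob R n]_t _.
have hF := mean_ratio_bound.
set F := \int[torus_prob R n]_t (W (tnth t) * ratio t) in hF.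
have mF : m <= F.
  apply: bounded_le_Rintegral; [exact: bounded_W_min|exact: bounded_W_ratio|move=> t].
  by rewrite ler_wpM2l ?weight_ge0// ge_min lexx.
have Fm : F <= m + M^-1 * Z.
  have E : mean (fun x => V x * shifted_radial (2 * beta) u x) = Z.
    rewrite mean_shifted_radial//; first by apply: eq_Rintegral => t _; rewrite mulr1.
    by have := u_le1; have := pi1; lra.
  have bs := bounded_vander_shifted n beta_gt u.
  rewrite -E -bounded_RintegralZ// -bounded_RintegralD; [|exact: bounded_W_min|exact: bounded_mfunZ].
  apply: bounded_le_Rintegral; first exact: bounded_W_ratio.
    by apply: bounded_mfunD; [exact: bounded_W_min|exact: bounded_mfunZ].
  move=> t; have := weight_char_ratio_sqr beta t y; rewrite -/(ratio t) -/u => h.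
  apply: (@le_trans _ _ (W (tnth t) * Num.min (ratio t) M + M^-1 * (W (tnth t) * ratio t ^+ 2))).
    rewrite [M^-1 * _]mulrCA -mulrDr ler_wpM2l ?weight_ge0//.
    have q0 : 0 <= M^-1 * ratio t ^+ 2 by rewrite mulr_ge0 ?sqr_ge0// invr_ge0 ltW.
    case: (leP (ratio t) M) => hM; first by rewrite lerDl.
    apply: (@le_trans _ _ (M^-1 * ratio t ^+ 2)); last by rewrite lerDr ltW.
    rewrite ler_pdivlMl// expr2 ler_wpM2r ?ratio_ge0// ltW//.
  by rewrite lerD2l ler_wpM2l// invr_ge0 ltW.
move: hF; set a := limit_poly _; set b := _ / n%:R; set c := mean_const beta * _ => hF.
have -> : m / Z - a = (m - a * Z) / Z by field; rewrite gt_eqF.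
rewrite normrM normfV (gtr0_norm Z_gt0) ler_pdivrMr//.
have hb : `|b * Z| = `|b| * Z by rewrite normrM (gtr0_norm Z_gt0).
have h1 := ler_norm (b * Z); have h2 := lerNnormlW (lexx `|b * Z|).
rewrite hb in h1 h2.
move: hF; rewrite ler_norml => /andP[h3 h4].
rewrite ler_norml; apply/andP; split; lra.
Qed.

End truncated_mean.

(** * Passage to the limit *)

Section limit_tools.
Context {R : realType}.

Lemma continuous_normr_powR (p : R) : 0 < p -> continuous (fun a : R => `|a| `^ p).
Proof.
move=> p0 a; have [->|a0] := eqVneq a 0; last first.
  have an : 0 < `|a| by rewrite normr_gt0.
  have nb : \forall b \near a, b != 0.
    exists `|a| => //= b ab; apply/eqP => b0.
    by move: ab; rewrite /= b0 subr0 ltxx.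
  apply: (@cvg_trans _ (expR (p * ln `|b|) @[b --> a])).
    apply: near_eq_cvg; near=> b; rewrite /powR gt_eqF// normr_gt0.
    by near: b; exact: nb.
  rewrite /powR gt_eqF//.
  have c1 : ln `|b| @[b --> a] --> ln `|a|.
    apply: (@cvg_comp _ _ _ (fun b : R => `|b|) (@ln R) _ (nbhs `|a|)).
      exact: norm_continuous.
    exact: continuous_ln.
  have c2 : p * ln `|b| @[b --> a] --> p * ln `|a| by apply: cvgM => //; exact: cvg_cst.
  apply: (@cvg_comp _ _ _ (fun b : R => p * ln `|b|) (@expR R) _ (nbhs (p * ln `|a|))).
    exact: c2.
  exact: continuous_expR.
rewrite /continuous_at normr0 powR0 ?gt_eqF//.
apply/cvgrPdist_lt => e e0.
have nb : \forall b \near (0 : R), `|b| < e `^ p^-1.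
  exists (e `^ p^-1) => [|b]; first by rewrite /= powR_gt0.
  by rewrite /= sub0r normrN.
near=> b.
rewrite sub0r normrN ger0_norm ?powR_ge0//.
rewrite -[ltRHS](powRr1 (ltW e0)) -[1](mulVf (lt0r_neq0 p0)) powRrM.
apply: gt0_ltr_powR; rewrite ?nnegrE ?powR_ge0//.
by near: b; exact: nb.
Unshelve. all: by end_near. Qed.

Lemma cvg_normr_powR {T : Type} {F : set_system T} {FF : Filter F} (f : T -> R) (l p : R) :
  0 < p -> f @ F --> l -> `|f x| `^ p @[x --> F] --> `|l| `^ p.
Proof.
move=> p0 fl; apply: (@cvg_comp _ _ _ f (fun a : R => `|a| `^ p) F (nbhs l)) => //.
exact: continuous_normr_powR.
Qed.

(** Points are compact, so uniform convergence on compact sets controls the value at [z]. *)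
Lemma continuous_eval (z : R[i]) :
  continuous (fun f : {family compact, R[i]^o -> R[i]^o} => f z : R[i]^o).
Proof.
move=> f W; rewrite /= -nbhs_entourageE => -[E entE EW].
have nb := fam_nbhs f entE (@compact_set1 _ (z : R[i]^o)).
change (nbhs f [set g : {family compact, R[i]^o -> R[i]^o} | W (g z)]).
apply: filterS nb => g /= fg.
by apply: EW; apply/xsectionP; exact: fg.
Qed.

(** The minimum with [M] makes the functional bounded, as the convergence in law of [is_xi] asks of
    its test functionals. *)
Definition truncated_modulus (p M : R) (z : R[i])
  (f : {family compact, R[i]^o -> R[i]^o}) : R := Num.min (cmod (f z) `^ p) M.

Lemma continuous_truncated_modulus (p M : R) (z : R[i]) : 0 < p ->
  continuous (truncated_modulus p M z).
Proof.
move=> p0.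
have c1 : continuous (fun a : R => Num.min (`|a| `^ p) M).
  move=> a; apply: (@continuous_min R R (fun a => `|a| `^ p) (fun=> M)); last exact: cvg_cst.
  exact: continuous_normr_powR.
have c2 : continuous ((fun a : R => Num.min (`|a| `^ p) M) \o (@cmod R : R[i]^o -> R)).
  by move=> w; apply: continuous_comp; [exact: continuous_cmod|exact: c1].
rewrite (_ : truncated_modulus p M z =
    ((fun a : R => Num.min (`|a| `^ p) M) \o (@cmod R : R[i]^o -> R)) \o
      (fun f : {family compact, R[i]^o -> R[i]^o} => f z : R[i]^o)); last first.
  by apply/funext => f /=; rewrite ger0_norm ?cmod_ge0.
by move=> f; apply: continuous_comp; [exact: continuous_eval|exact: c2].
Qed.

Lemma truncated_modulus_le (p M : R) (z : R[i]) f : 0 <= M ->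
  `|truncated_modulus p M z f| <= M.
Proof. by move=> M0; rewrite ger0_norm ?le_min ?powR_ge0// ge_min lexx orbT. Qed.

Lemma natV_cvg0 : (n%:R^-1 : R) @[n --> \oo] --> (0 : R).
Proof. by rewrite -(cvg_shiftS (fun n => n%:R^-1 : R)); exact: cvg_harmonic. Qed.

(** The factor n sin(y / (4 n)), whose square this is, is a difference quotient at 0 of the map
    sending w to sin(y w / 4). *)
Lemma scaled_sin_cvg (y : R) : scaled_sin n y @[n --> \oo] --> y ^+ 2 / 16.
Proof.
have d : is_derive (0 : R) 1 (fun w : R => sin (y / 4 * w)) (y / 4).
  have d1 : is_derive (0 : R) 1 (fun w : R => y / 4 * w) (y / 4).
    have := is_derive_mul (is_derive_const (y / 4) 0) (is_derive_id (0 : R) 1).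
    by rewrite mul0r add0r mulr1.
  have := is_derive_compose (f := @sin R) (g := fun w : R => y / 4 * w) (is_derive_sin _) d1.
  by rewrite mulr0 cos0 mul1r.
rewrite -(cvg_shiftS (fun n => scaled_sin n y)).
have := derive_quotient_cvg d; rewrite mulr0 sin0 => h.
rewrite (_ : y ^+ 2 / 16 = (y / 4) * (y / 4)); last by field.
have E : [sequence scaled_sin n.+1 y]_n = (fun k : nat => k.+1%:R * (sin (y / 4 * (0 + k.+1%:R^-1)) - 0))
   \* (fun k : nat => k.+1%:R * (sin (y / 4 * (0 + k.+1%:R^-1)) - 0)).
  apply/funext => k /=; rewrite subr0 add0r /scaled_sin.
  rewrite (_ : y / k.+1%:R / 2 / 2 = y / 4 / k.+1%:R); first by ring.
  have : k.+1%:R != 0 :> R by rewrite pnatr_eq0.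
  by move: (k.+1%:R) => c c0; field.
by rewrite E; exact: cvgM.
Qed.

End limit_tools.

(** * From finite size to the limiting random function *)

Section limit_expansion.
Context {R : realType} (beta : R) (d : measure_display) (S : measurableType d).
Variables (Q : probability S R) (xi : S -> R[i] -> R[i]).
Hypothesis hxi : is_xi beta (2 * beta) Q xi.
Hypothesis beta_gt : 3 / 2 < beta.
Variable r : R.
Hypothesis r_gt1 : 1 < r.
Hypothesis r_le2 : r <= 2.
Hypothesis r_lt : r < beta - 2^-1.

Let beta_gt0 : 0 < beta. Proof. by have := beta_gt; lra. Qed.
Local Notation modulus y w := (cmod (xi w (real_complex R y)) `^ beta).
Local Notation partition_function N := (@wmean R beta N (fun=> 1)).

(** The mean of the constant 1 is the total mass divided by itself, which is 0 if the mass is 0, by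
    the convention for division. Its assumed limit is 1, so the mass is eventually nonzero. *)
Lemma partition_function_gt0 : \forall N \near \oo, 0 < partition_function N.
Proof.
have [_ _ _ /(_ (cst 1))] := hxi.
have c0 : continuous (cst 1 : {family compact, R[i]^o -> R[i]^o} -> R) by exact: cst_continuous.
have c1 := continuous_subspaceT (A := [set f : {family compact, R[i]^o -> R[i]^o} | entire f]) c0.
move=> /(_ c1) => h.
have I1 : \int[Q]_w cst (1 : R) (xi w) = 1.
  by rewrite /Rintegral /= integral_cst//= probability_setT mule1.
have {}h : mean_density (@circular_jacobi_weight R beta (2 * beta) N) (fun=> 1) @[N --> \oo] --> (1 : R).
  by rewrite -[X in _ --> X]I1; apply: h; exists 1 => f; rewrite normr1.
have : \forall N \near \oo,
    mean_density (@circular_jacobi_weight R beta (2 * beta) N) (fun=> 1) != 0.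
  exact: (cvgr_neq0 (1 : R^o) h (oner_neq0 _)).
apply: filterS => N; rewrite /mean_density => h1.
rewrite lt_neqAle wmean_ge0 ?andbT//; apply: contraNneq h1 => Z0.
rewrite [X in _ / X](_ : _ = 0) ?invr0 ?mulr0// Z0.
by apply: eq_Rintegral => t _; rewrite circular_jacobi_weightE mulr1.
Qed.

Let truncated_mean (M y : R) := \int[Q]_w Num.min (modulus y w) M.

Lemma truncated_mean_cvg (M y : R) : 0 <= M ->
  mean_density (@circular_jacobi_weight R beta (2 * beta) N)
    (fun t => Num.min (cmod (char_ratio t (real_complex R y)) `^ beta) M)
    @[N --> \oo] --> truncated_mean M y.
Proof.
move=> M0; have [_ _ _ h] := hxi.
apply: (h (truncated_modulus beta M (real_complex R y))).
  by apply: continuous_subspaceT; exact: continuous_truncated_modulus.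
by exists M => f; exact: truncated_modulus_le.
Qed.

(** What [mean_truncated_bound] leaves as the size tends to infinity, apart from the truncation
    error [M^-1]. *)
Definition limit_error (y : R) : R := mean_const beta *
  (moment_ratio beta r * (y ^+ 2 / 16) * (moment_ratio beta r * (y ^+ 2 / 16)) `^ r).

Let K0 : 0 < moment_ratio beta r.
Proof. by rewrite divr_gt0 ?mulr_gt0//; have := r_lt; lra. Qed.

Lemma scaled_sin_ge0 n (y : R) : 0 <= scaled_sin n y.
Proof. by rewrite mulr_ge0 ?sqr_ge0. Qed.

Lemma truncated_mean_bound (M y : R) : 0 < M -> y != 0 -> `|y| <= 1 ->
  `|truncated_mean M y - limit_poly beta (y ^+ 2 / 16)| <= limit_error y + M^-1.
Proof.
move=> M0 y0 y1.
pose l := moment_ratio beta r * (y ^+ 2 / 16); pose k n := moment_ratio beta r * scaled_sin n y.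
pose D N := mean_density (@circular_jacobi_weight R beta (2 * beta) N)
  (fun t => Num.min (cmod (char_ratio t (real_complex R y)) `^ beta) M).
have cs := @scaled_sin_cvg R y.
have ci := @natV_cvg0 R.
have ck : k n @[n --> \oo] --> l by apply: cvgM => //; exact: cvg_cst.
have cp : k n `^ r @[n --> \oo] --> l `^ r.
  have r0 : 0 < r by apply: lt_trans r_gt1.
  have q0 : 0 <= l by rewrite mulr_ge0 ?(ltW K0)// divr_ge0 ?sqr_ge0.
  rewrite -[X in X `^ r](ger0_norm q0).
  have E n : k n `^ r = `|k n| `^ r.
    by rewrite ger0_norm// mulr_ge0 ?(ltW K0) ?scaled_sin_ge0.
  under eq_fun do rewrite E.
  exact: cvg_normr_powR r0 ck.
have cpoly : limit_poly beta (scaled_sin n y) @[n --> \oo] --> limit_poly beta (y ^+ 2 / 16).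
  rewrite /limit_poly; apply: cvgD; first apply: cvgB.
  - exact: cvg_cst.
  - by apply: cvgM => //; exact: cvg_cst.
  - apply: cvgM; first exact: cvg_cst.
    by under eq_fun do rewrite expr2; rewrite expr2; exact: cvgM.
have cf : `|D N - limit_poly beta (scaled_sin N y)| @[N --> \oo] -->
    `|truncated_mean M y - limit_poly beta (y ^+ 2 / 16)|.
  by apply: cvg_norm; apply: cvgB => //; apply: truncated_mean_cvg; exact: ltW.
have cg : `|4 * beta * mean_slope beta * scaled_sin n y / n%:R| +
  mean_const beta * (k n * k n `^ r + scaled_sin n y ^+ 2 / n%:R) + M^-1 @[n --> \oo] -->
   `|4 * beta * mean_slope beta * (y ^+ 2 / 16) * 0| +
  mean_const beta * (l * l `^ r + (y ^+ 2 / 16) ^+ 2 * 0) + M^-1.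
  apply: cvgD; last exact: cvg_cst.
  apply: cvgD.
    by apply: cvg_norm; apply: cvgM => //; apply: cvgM => //; exact: cvg_cst.
  apply: cvgM; first exact: cvg_cst.
  apply: cvgD; first exact: cvgM.
  apply: cvgM => //.
  by under eq_fun do rewrite expr2; rewrite expr2; exact: cvgM.
rewrite !mulr0 normr0 add0r addr0 in cg.
apply: (ler_cvg_to cf cg); near=> N; apply: mean_truncated_bound => //.
- by near: N; exists 1%N.
- exact: ltW.
- by near: N; exact: partition_function_gt0.
Unshelve. all: by end_near. Qed.

Let measurable_modulus y : measurable_fun setT (fun w => modulus y w).
Proof.
have [_ _ /(_ (real_complex R y)) [mR mI] _] := hxi.
apply: (measurableT_comp (measurable_powR beta)).
rewrite (_ : (fun w => cmod _) = fun w =>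
  (complex.Re (xi w (real_complex R y)) ^+ 2 + complex.Im (xi w (real_complex R y)) ^+ 2) `^ 2^-1).
  apply: (measurableT_comp (measurable_powR 2^-1)).
  by apply: measurable_funD; exact: measurable_funX.
apply/funext => w; rewrite powR12_sqrt ?addr_ge0 ?sqr_ge0// /cmod.
by case: (xi w _).
Qed.

Let bounded_truncated y (M : R) : 0 <= M -> bounded_mfun (fun w => Num.min (modulus y w) M).
Proof.
move=> M0; split; first by apply: measurable_minr => //; exact: measurable_modulus.
by exists M => w; rewrite ger0_norm ?le_min ?powR_ge0// ge_min lexx orbT.
Qed.

Lemma truncated_mean_monotone_cvg y :
  (truncated_mean k%:R y)%:E @[k --> \oo] --> (\int[Q]_w (modulus y w)%:E)%E.
Proof.
pose g (k : nat) w : \bar R := (Num.min (modulus y w) k%:R)%:E.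
have glim w : g k w @[k --> \oo] --> (modulus y w)%:E.
  apply: cvg_near_cst; near=> k; rewrite /g; congr EFin; apply/min_idPl.
  by near: k; exact: nbhs_infty_ger.
have mg k : measurable_fun setT (g k).
  by apply/measurable_EFinP; have [] := @bounded_truncated y k%:R (ler0n _ _).
have g0 k w : setT w -> (0 <= g k w)%E.
  by move=> _; rewrite lee_fin le_min powR_ge0/=.
have ndg w : setT w -> nondecreasing_seq (g ^~ w).
  move=> _ k l kl; rewrite lee_fin le_min ge_min lexx/= ge_min ler_nat kl orbT//.
have := cvg_monotone_convergence (mu := Q) measurableT mg g0 ndg.
rewrite (_ : (fun k => (\int[Q]_w g k w)%E) = fun k => (truncated_mean k%:R y)%:E); last first.
  by apply/funext => k; rewrite fine_bounded_integral//; exact: bounded_truncated.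
rewrite (eq_integral (fun w => (modulus y w)%:E)) => [//|w _].
exact: cvg_lim.
Unshelve. all: by end_near. Qed.

(** The truncation level tends to infinity along the integers; monotone convergence gives the full
    mean, and the [M^-1] of [truncated_mean_bound] disappears. *)
Lemma modulus_mean_bound (y : R) : y != 0 -> `|y| <= 1 ->
  `|fine (\int[Q]_w (modulus y w)%:E) - limit_poly beta (y ^+ 2 / 16)| <= limit_error y.
Proof.
move=> y0 y1; have mc := @truncated_mean_monotone_cvg y.
set I := (\int[Q]_w (modulus y w)%:E)%E in mc *.
have bnd (k : nat) : (0 < k)%N ->
    `|truncated_mean k%:R y - limit_poly beta (y ^+ 2 / 16)| <= limit_error y + k%:R^-1.
  by move=> k0; apply: truncated_mean_bound => //; rewrite ltr0n.
have I0 : (0 <= I)%E by apply: integral_ge0 => w _; rewrite lee_fin powR_ge0.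
(* A uniform bound on the truncated means makes the integral finite; [fine] would send an infinite
   one to 0. *)
have IB : (I <= (limit_poly beta (y ^+ 2 / 16) + limit_error y + 1)%:E)%E.
  apply: (lee_cvg_to mc (cvg_cst _)); near=> k.
  have k0 : (0 < k)%N by near: k; exists 1%N.
  have := bnd k k0; rewrite ler_norml lee_fin => /andP[_ h].
  have : k%:R^-1 <= 1 :> R by rewrite invf_le1 ?ltr0n// ler1n.
  move: h; lra.
have If : I \is a fin_num.
  by rewrite fin_numElt (lt_le_trans _ I0) ?ltNy0// (le_lt_trans IB)// ltry.
have cL : truncated_mean k%:R y @[k --> \oo] --> fine I.
  by have := mc; rewrite -[X in _ --> X](fineK If) => /fine_cvg.
have cn : `|truncated_mean k%:R y - limit_poly beta (y ^+ 2 / 16)| @[k --> \oo] -->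
   `|fine I - limit_poly beta (y ^+ 2 / 16)|.
  by apply: cvg_norm; apply: cvgB => //; exact: cvg_cst.
have ci := @natV_cvg0 R.
have cr : limit_error y + k%:R^-1 @[k --> \oo] --> limit_error y + 0.
  by apply: cvgD => //; exact: cvg_cst.
rewrite -[leRHS]addr0; apply: (ler_cvg_to cn cr); near=> k; apply: bnd.
by near: k; exists 1%N.
Unshelve. all: by end_near. Qed.

(** Dividing by [y ^+ 4] leaves a constant times (y^2)^(r - 1), and [1 < r]. *)
Lemma limit_error_little : limit_error y / y ^+ 4 @[y --> 0^'] --> (0 : R).
Proof.
pose c := mean_const beta * (moment_ratio beta r / 16) ^+ 2.
have r1 : 0 < r - 1 by rewrite subr_gt0.
have h : c * `|moment_ratio beta r * (y ^+ 2 / 16)| `^ (r - 1) @[y --> 0^'] --> c * 0.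
  apply: cvgM; first exact: cvg_cst.
  have ck : moment_ratio beta r * (y ^+ 2 / 16) @[y --> 0^'] --> (0 : R).
    apply: cvg_within_filter.
    have h0 : moment_ratio beta r * (y ^+ 2 / 16) @[y --> (0 : R)] -->
        moment_ratio beta r * (0 * 0 / 16).
      apply: cvgM; first exact: cvg_cst.
      apply: cvgM; last exact: cvg_cst.
      by under eq_fun do rewrite expr2; apply: cvgM; exact: cvg_id.
    by rewrite !mul0r mulr0 in h0.
  have h0 : `|moment_ratio beta r * (y ^+ 2 / 16)| `^ (r - 1) @[y --> 0^'] --> `|0 : R| `^ (r - 1).
    exact: cvg_normr_powR r1 ck.
  by rewrite normr0 powR0 ?gt_eqF in h0.
rewrite mulr0 in h; apply: cvg_trans h; apply: near_eq_cvg.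
near=> y.
have y0 : y != 0 by near: y; exact: nbhs_dnbhs_neq.
have q0 : 0 < moment_ratio beta r * (y ^+ 2 / 16).
  by rewrite mulr_gt0// divr_gt0// exprn_even_gt0.
rewrite (gtr0_norm q0) /limit_error -[_ `^ r](mulr_powRB1 (ltW q0) (lt_trans ltr01 r_gt1)).
by rewrite /c; field.
Unshelve. all: by end_near. Qed.

End limit_expansion.

Lemma limit_polyE (R : realType) (beta x : R) : 3 / 2 < beta ->
  limit_poly beta (x ^+ 2 / 16) = 1 - beta ^+ 2 / (40 * (2 * beta - 1)) * x ^+ 2
    + beta ^+ 4 * (7 * beta - 10)
        / (4480 * (2 * beta - 1) * (2 * beta - 3) * (5 * beta - 2)) * x ^+ 4.
Proof.
move=> hbeta; rewrite /limit_poly /mean_slope /second_slope.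
have b1 : 2 * beta - 1 != 0 by rewrite gt_eqF//; lra.
have b2 : 2 * beta - 3 != 0 by rewrite gt_eqF//; lra.
have b3 : 5 * beta - 2 != 0 by rewrite gt_eqF//; lra.
by field; rewrite b1 b2 b3.
Qed.

Theorem corollary1p2 (R : realType) (beta : R) (hbeta : 3 / 2 < beta)
    (d : measure_display) (T : measurableType d) (P : probability T R)
    (X : T -> set R) (hX : is_sine_beta beta P X)
    (rho : R -> R -> R) (hrho : is_two_point_correlation P X rho)
    (d' : measure_display) (S : measurableType d') (Q : probability S R)
    (xi : S -> R[i] -> R[i]) (hxi : is_xi beta (2 * beta) Q xi)
    (representation : forall x1 x2 : R,
       (rho x1 x2)%:E = ((corr_const beta 2 * `|x1 - x2| `^ beta)%:E *
         \int[Q]_w (cmod (xi w (real_complex R (x2 - x1))) `^ beta)%:E)%E) :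
  exists e : R -> R,
    (e x / x ^+ 4 @[x --> 0^'] --> (0 : R)) /\
    forall x : R, x != 0 ->
      rho 0 x = corr_const beta 2 * `|x| `^ beta *
        (1 - beta ^+ 2 / (40 * (2 * beta - 1)) * x ^+ 2
         + beta ^+ 4 * (7 * beta - 10)
             / (4480 * (2 * beta - 1) * (2 * beta - 3) * (5 * beta - 2))
           * x ^+ 4
         + e x).
Proof.
(* [beta / 2 + 1 / 4] is the midpoint of 1 and [beta - 2^-1]; the cap 2 is what [sqr_cutoff_le] and
   the bounds on [expansion_rest] ask for. *)
pose r := Num.min 2 (beta / 2 + 1 / 4).
have r_gt1 : 1 < r by rewrite lt_min; apply/andP; split; lra.
have r_le2 : r <= 2 by rewrite ge_min lexx.
have r_lt : r < beta - 2^-1 by rewrite gt_min; apply/orP; right; lra.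
pose I x := (\int[Q]_w (cmod (xi w (real_complex R x)) `^ beta)%:E)%E.
exists (fun x => fine (I x) - limit_poly beta (x ^+ 2 / 16)); split.
  have h := limit_error_little hbeta r_gt1 r_lt.
  apply: (squeeze_cvgr _ (f := fun x : R => - (limit_error beta r x / x ^+ 4)) _ h); last first.
    have hN : - (limit_error beta r x / x ^+ 4) @[x --> 0^'] --> - (0 : R) by exact: cvgN.
    by rewrite oppr0 in hN.
  near=> x.
  have x0 : x != 0 by near: x; exact: nbhs_dnbhs_neq.
  have x1 : `|x| <= 1.
    near: x; apply: dnbhs0_le => //.
  have x4 : 0 < x ^+ 4 by rewrite exprn_even_gt0.
  rewrite -mulNr !ler_pM2r ?invr_gt0// -ler_norml.
  exact: (modulus_mean_bound hxi).
move=> x x0; have := representation 0 x; rewrite sub0r normrN subr0 -/(I x) => rhoE.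
rewrite -limit_polyE// addrC subrK.
(* Unless the prefactor is [0], in which case both sides vanish, finiteness of
   [rho 0 x] forces that of the integral. *)
have [c0|c0] := eqVneq (corr_const beta 2 * `|x| `^ beta) 0.
  by move: rhoE; rewrite c0 mul0e mul0r => -[].
have I0 : (0 <= I x)%E by apply: integral_ge0 => w _; rewrite lee_fin powR_ge0.
case: (I x) I0 rhoE => [a||] //=.
  by move=> _ [].
move=> _; case: (ltgtP (corr_const beta 2 * `|x| `^ beta) 0) c0 => // c0 _.
  by rewrite lt0_muley// lte_fin.
by rewrite gt0_muley// lte_fin.
Unshelve. all: by end_near. Qed.
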